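(* Let $M_*$ be either the Fraïssé limit of the class $\mathbf{K}$ of all finite simple $\wedge$-matroids of rank $\leq 3$, or, for a given finite projective plane $P$, the Fraïssé limit of the class $\mathbf{K}_P$ of all finite simple $\wedge$-matroids of rank $\leq 3$ omitting $M_P$. Then: (1) the first-order theory of $M_*$ (in the language $\{R,\wedge\}$) is not $\aleph_0$-categorical; (2) the first-order theory of $M_*$ has the independence property; (3) $M_*$ admits a stationary independence relation; (4) $\mathrm{Aut}(M_* )$ embeds the symmetric group $\mathrm{Sym}(\omega)$; (5) if the age of $M_*$ has the extension property for partial automorphisms, then $\mathrm{Aut}(M_* )$ has ample generics, and in particular it has the small index property.
   Context: A simple matroid of rank $\leq 3$ is a $3$-hypergraph $(V,R)$, $R$ irreflexive and symmetric, such that $R(a,b,c)$ and $R(a,b,d)$ imply every $3$-subset of $\{a,b,c,d\}$ is in $R$; lines are $a\vee b:=\{a,b\}\cup\{c:R(a,b,c)\}$ for $a\ne b$. A simple $\wedge$-matroid of rank $\le 3$ is $(V,R,\wedge)$ with $\wedge(a,b,c,d)=p$ if $a\neq b$, $c\neq d$, the lines $a\vee b\neq c\vee d$ meet in a point $p\notin\{a,b,c,d\}$, and $\wedge(a,b,c,d)=a$ otherwise. Substructures and embeddings are in the language $\{R,\wedge\}$. For a finite projective plane $P$, $M_P$ is the matroid on its points whose $R$-triples are the collinear triples of distinct points; $N$ omits $M_P$ if no subset of $N$ induces a $3$-hypergraph isomorphic to $M_P$. Both classes are Fraïssé classes; their Fraïssé limit is the unique countable homogeneous structure whose age (class of finite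 structures embeddable in it) is exactly the class. A stationary independence relation on a homogeneous $M$ is a ternary relation $A\,\mathop{\smile\!\!\!\!\!\!\mid}_C\, B$ between finitely generated substructures satisfying: (Invariance) preserved by automorphisms; (Symmetry) $A\mathop{\smile\!\!\!\!\!\!\mid}_C B\Rightarrow B\mathop{\smile\!\!\!\!\!\!\mid}_C A$; (Monotonicity) if $A\mathop{\smile\!\!\!\!\!\!\mid}_C \langle BD\rangle$ and $A\mathop{\smile\!\!\!\!\!\!\mid}_C B$ then $A\mathop{\smile\!\!\!\!\!\!\mid}_{\langle BC\rangle} D$; (Existence) for any $A,B,C$ there is $A'\equiv_B A$ with $A'\mathop{\smile\!\!\!\!\!\!\mid}_B C$; (Stationarity) if $A\equiv_C A'$, $A\mathop{\smile\!\!\!\!\!\!\mid}_C B$ and $A'\mathop{\smile\!\!\!\!\!\!\mid}_C B$ then $A\equiv_{\langle BC\rangle}A'$. Here $\langle X\rangle$ is the generated substructure and $A\equiv_B A'$ means some automorphism fixing $B$ pointwise maps $A$ to $A'$ (as enumerated). A class $\mathbf{K}$ has the extension property for partial automorphisms if every $A\in\mathbf{K}$ is contained in some $B\in\mathbf{K}$ such that every isomorphism between substructures of $A$ extends to an automorphism of $B$. A Polish group $G$ has ample generics if for each $n\ge1$ the diagonal conjugation action of $G$ on $G^n$ has a comeager orbit; it has the small index property if every subgroup of index $<2^{\aleph_0}$ is open ($\mathrm{Aut}(M_* )$ carries the pointwise convergence topology). *)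

(* Defs.v *)
From HB Require Import structures.
From mathcomp Require Import all_boot.
From mathcomp Require Import all_classical.
From mathcomp Require Import topology.

Set Implicit Arguments.
Unset Strict Implicit.
Unset Printing Implicit Defensive.

Local Open Scope classical_set_scope.
Local Open Scope card_scope.

Record structure : Type := Structure {
  carrier :> Type;
  Rel : carrier -> carrier -> carrier -> Prop;
  wedge : carrier -> carrier -> carrier -> carrier -> carrier }.

HB.instance Definition _ (M : structure) := gen_eqMixin (carrier M).
HB.instance Definition _ (M : structure) := gen_choiceMixin (carrier M).

Definition embedding (M N : structure) (f : M -> N) : Prop :=
  [/\ injective f,
      forall x y z, Rel x y z <-> Rel (f x) (f y) (f z) &
      forall a b c d, f (wedge a b c d) = wedge (f a) (f b) (f c) (f d)].

Definition isomorphic (M N : structure) : Prop :=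
  exists f : M -> N, bijective f /\ embedding f.

(* The language has no constants, so the empty set is a substructure. *)
Definition substructure (M : structure) (X : set M) : Prop :=
  forall a b c d, X a -> X b -> X c -> X d -> X (wedge a b c d).

Definition gen (M : structure) (X : set M) : set M := smallest (@substructure M) X.

Definition fg_substructure (M : structure) (X : set M) : Prop :=
  exists2 F : set M, finite_set F & X = gen F.

(* Only the values of [f] on [X] matter. *)
Definition partial_iso (M : structure) (X Y : set M) (f : M -> M) : Prop :=
  [/\ set_bij X Y f,
      forall x y z, X x -> X y -> X z -> Rel x y z <-> Rel (f x) (f y) (f z) &
      forall a b c d, X a -> X b -> X c -> X d ->
        f (wedge a b c d) = wedge (f a) (f b) (f c) (f d)].

(* Continuity of the operations plays no role in the notions below, so it is not
   part of the structure. *)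
#[short(type="groupWithTopologyType")]
HB.structure Definition GroupWithTopology := {G of Group G & Topological G}.

Record sym (T : Type) : Type := Sym {
  sym_fun :> T -> T;
  sym_inv : T -> T;
  sym_funK : cancel sym_fun sym_inv;
  sym_invK : cancel sym_inv sym_fun }.

Section SymGroup.
Variable T : Type.
Implicit Types g h k : sym T.

Lemma sym_ext g h : sym_fun g =1 sym_fun h -> g = h.
Proof.
case: g h => [f f' fK f'K] [g g' gK g'K] /= /funext efg; subst g.
have efg' : f' = g' by apply/funext => x; rewrite -[in LHS](g'K x) fK.
by subst g'; congr Sym; exact: Prop_irrelevance.
Qed.

HB.instance Definition _ := gen_eqMixin (sym T).
HB.instance Definition _ := gen_choiceMixin (sym T).

Definition sym_one : sym T := @Sym T id id (fun=> erefl) (fun=> erefl).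
Definition sym_mul g h : sym T :=
  Sym (can_comp (sym_funK g) (sym_funK h)) (can_comp (sym_invK h) (sym_invK g)).
Definition sym_opp g : sym T := Sym (sym_invK g) (sym_funK g).

Fact sym_mulA : associative sym_mul. Proof. by move=> g h k; apply: sym_ext. Qed.
Fact sym_mul1g : left_id sym_one sym_mul. Proof. by move=> g; apply: sym_ext. Qed.
Fact sym_mulg1 : right_id sym_one sym_mul. Proof. by move=> g; apply: sym_ext. Qed.
Fact sym_mulVg : left_inverse sym_one sym_opp sym_mul.
Proof. by move=> g; apply: sym_ext => x /=; rewrite sym_funK. Qed.
Fact sym_mulgV : right_inverse sym_one sym_opp sym_mul.
Proof. by move=> g; apply: sym_ext => x /=; rewrite sym_invK. Qed.

HB.instance Definition _ := isGroup.Build (sym T)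
  sym_mulA sym_mul1g sym_mulg1 sym_mulVg sym_mulgV.

End SymGroup.

Record aut (M : structure) : Type := Aut {
  aut_sym :> sym M;
  aut_embedding : `[< embedding (sym_fun aut_sym) >] }.

Section AutGroup.
Variable M : structure.

HB.instance Definition _ := [isSub for @aut_sym M].
HB.instance Definition _ := [Choice of aut M by <:].

Fact aut_group_closed :
  group_closed (fun g : sym M => `[< embedding (sym_fun g) >]).
Proof.
split=> [|g h]; rewrite !unfold_in; first by apply/asboolP; split=> //.
move=> /asboolP[gI gR gW] /asboolP[hI hR hW]; apply/asboolP; split=> /=.
- exact: inj_comp gI (can_inj (sym_invK h)).
- by move=> x y z; rewrite -gR [X in _ <-> X]hR !sym_invK.
- by move=> a b c d; rewrite -gW; congr (g _); apply: hI; rewrite hW !sym_invK.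
Qed.

HB.instance Definition _ :=
  SubChoice_isSubGroup.Build _ _ (aut M) aut_group_closed.

(* Pointwise convergence: the topology induced by the product [M -> M], where
   [M] is discrete. *)
Definition aut_eval (g : aut M) : prod_topology (fun _ : M => discrete_topology M) :=
  sym_fun g.

HB.instance Definition _ := Topological.copy (aut M) (initial_topology aut_eval).

End AutGroup.

Definition comeager (T : topologicalType) (A : set T) : Prop :=
  exists U : nat -> set T,
    (forall n, open (U n) /\ dense (U n)) /\ \bigcap_n U n `<=` A.

Definition conj_orbit (G : groupType) n (h : 'I_n -> G) : set ('I_n -> G) :=
  [set k | exists g : G, forall i, k i = (g * h i * g^-1)%g].

Definition ample_generics (G : groupWithTopologyType) : Prop :=
  forall n, (0 < n)%N -> exists h : 'I_n -> G,
    @comeager (prod_topology (fun _ : 'I_n => G)) (conj_orbit h).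

Definition subgroup (G : groupType) (H : set G) : Prop :=
  H 1%g /\ forall x y, H x -> H y -> H (x / y)%g.

Definition left_cosets (G : groupType) (H : set G) : set (set G) :=
  [set X | exists g : G, X = [set (g * h)%g | h in H]].

Definition card_lt T U (A : set T) (B : set U) : Prop := A #<= B /\ ~ (B #<= A).

Definition small_index_property (G : groupWithTopologyType) : Prop :=
  forall H : set G, subgroup H -> card_lt (left_cosets H) [set: set nat] -> open H.

Definition group_embeds (G H : groupType) : Prop :=
  exists f : G -> H, injective f /\ {morph f : x y / (x * y)%g >-> (x * y)%g}.

(* De Bruijn style: [formula n] has its free variables among [n] of them, and
   variable 0 of the body of [FAll] is the bound one. Sentences thus make sense
   in an empty structure too. *)
Inductive term (n : nat) : Type :=
| TVar of 'I_n
| TWedge of term n & term n & term n & term n.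

Inductive formula : nat -> Type :=
| FEq n of term n & term n : formula n
| FRel n of term n & term n & term n : formula n
| FFalse n : formula n
| FImp n of formula n & formula n : formula n
| FAll n of formula n.+1 : formula n.

Section Semantics.
Variable M : structure.

Fixpoint teval n (v : 'I_n -> M) (t : term n) : M :=
  match t with
  | TVar i => v i
  | TWedge t1 t2 t3 t4 => wedge (teval v t1) (teval v t2) (teval v t3) (teval v t4)
  end.

Definition extend n (x : M) (v : 'I_n -> M) : 'I_n.+1 -> M :=
  fun i => if unlift ord0 i is Some j then v j else x.

Fixpoint sat n (phi : formula n) : ('I_n -> M) -> Prop :=
  match phi in formula n return ('I_n -> M) -> Prop with
  | FEq _ t u => fun v => teval v t = teval v u
  | FRel _ t u w => fun v => Rel (teval v t) (teval v u) (teval v w)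
  | FFalse _ => fun=> False
  | FImp _ phi psi => fun v => sat phi v -> sat psi v
  | FAll _ phi => fun v => forall x, sat phi (extend x v)
  end.

Definition tuple_cat k l (a : 'I_k -> M) (b : 'I_l -> M) : 'I_(k + l) -> M :=
  fun i => match fintype.split i with inl j => a j | inr j => b j end.

End Semantics.

Definition theory := set (formula 0).

Definition true_in (M : structure) (phi : formula 0) : Prop :=
  forall v : 'I_0 -> M, sat phi v.

Definition Th (M : structure) : theory := [set phi | true_in M phi].

Definition model (T : theory) (N : structure) : Prop :=
  forall phi, T phi -> true_in N phi.

Definition aleph0_categorical (T : theory) : Prop :=
  forall N N' : structure, [set: N] #= [set: nat] -> [set: N'] #= [set: nat] ->
    model T N -> model T N' -> isomorphic N N'.

(* Finite shattering, required in all models of T; for a complete T, such as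
   [Th M], one model decides it. *)
Definition independence_property (T : theory) : Prop :=
  exists k l (phi : formula (k + l)), forall N : structure, model T N ->
    forall n, exists b : 'I_n -> 'I_l -> N, forall X : set 'I_n,
      exists a : 'I_k -> N, forall i, sat phi (tuple_cat a (b i)) <-> X i.

Definition struct_class := structure -> Prop.

(* With [age M = K] for a class K of finite structures, finite generation makes
   every finitely generated substructure of M finite. *)
Definition age (M : structure) : struct_class := fun N =>
  fg_substructure [set: N] /\ exists f : N -> M, embedding f.

Definition homogeneous (M : structure) : Prop :=
  forall (X Y : set M) (f : M -> M),
    fg_substructure X -> fg_substructure Y -> partial_iso X Y f ->
    exists g : aut M, forall x, X x -> g x = f x.

Definition fraisse_limit (K : struct_class) (M : structure) : Prop :=
  [/\ countable [set: M], homogeneous M & forall N, age M N <-> K N].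

Definition EPPA (K : struct_class) : Prop :=
  forall A, K A -> exists (B : structure) (e : A -> B), [/\ K B, embedding e &
    forall (X Y : set A) (f : A -> A),
      substructure X -> substructure Y -> partial_iso X Y f ->
      exists g : aut B, forall x, X x -> g (e x) = e (f x)].

Definition distinct3 T (x y z : T) : Prop := [/\ x <> y, x <> z & y <> z].

Definition simple_matroid3 T (R : T -> T -> T -> Prop) : Prop :=
  [/\ forall a b c, R a b c -> distinct3 a b c,
      forall a b c, R a b c -> R b a c /\ R a c b &
      forall a b c d, R a b c -> R a b d ->
        forall x y z, distinct3 x y z -> [set x; y; z] `<=` [set a; b; c; d] ->
          R x y z].

(* Meaningful for [a <> b]. *)
Definition line T (R : T -> T -> T -> Prop) (a b : T) : set T :=
  [set a; b] `|` [set c | R a b c].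

Definition lines_meet_at T (R : T -> T -> T -> Prop) (a b c d p : T) : Prop :=
  [/\ a <> b, c <> d, line R a b <> line R c d,
      line R a b `&` line R c d = [set p] & ~ [set a; b; c; d] p].

Definition wedge_matroid3 (M : structure) : Prop :=
  [/\ simple_matroid3 (@Rel M),
      forall a b c d p : M, lines_meet_at (@Rel M) a b c d p -> wedge a b c d = p &
      forall a b c d : M, ~ (exists p, lines_meet_at (@Rel M) a b c d p) ->
        wedge a b c d = a].

Record projective_plane : Type := ProjectivePlane {
  point : finType;
  pline : finType;
  incident : point -> pline -> bool;
  point_join : forall p q, p != q -> exists! l, incident p l /\ incident q l;
  line_meet : forall l m, l != m -> exists! p, incident p l /\ incident p m;
  quadrangle : exists p : 'I_4 -> point, injective p /\
    forall i j k, distinct3 i j k ->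
      ~ exists l, [/\ incident (p i) l, incident (p j) l & incident (p k) l] }.

Definition plane_Rel (P : projective_plane) (x y z : point P) : Prop :=
  distinct3 x y z /\ exists l, [/\ incident x l, incident y l & incident z l].

Definition omits_plane (P : projective_plane) (N : structure) : Prop :=
  ~ exists (X : set N) (f : point P -> N), set_bij [set: point P] X f /\
      forall x y z, plane_Rel x y z <-> Rel (f x) (f y) (f z).

Definition K_all : struct_class := fun N =>
  finite_set [set: N] /\ wedge_matroid3 N.

Definition K_omit (P : projective_plane) : struct_class := fun N =>
  K_all N /\ omits_plane P N.

Section Stationary.
Variable M : structure.

(* [a] and [a'] enumerate, with the same index type, the two substructures that
   are compared. *)
Definition equiv_over (B : set M) (I : Type) (a a' : I -> M) : Prop :=
  exists g : aut M, (forall x, B x -> g x = x) /\ forall i, g (a i) = a' i.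

(* [ind A C B] reads "A is independent from B over C"; its values outside
   finitely generated substructures are irrelevant. *)
Record stationary_independence (ind : set M -> set M -> set M -> Prop) : Prop := {
  ind_invariance : forall (g : aut M) A B C,
    fg_substructure A -> fg_substructure B -> fg_substructure C ->
    ind A C B -> ind (g @` A) (g @` C) (g @` B);
  ind_symmetry : forall A B C,
    fg_substructure A -> fg_substructure B -> fg_substructure C ->
    ind A C B -> ind B C A;
  ind_monotonicity : forall A B C D,
    fg_substructure A -> fg_substructure B ->
    fg_substructure C -> fg_substructure D ->
    ind A C (gen (B `|` D)) -> ind A C B -> ind A (gen (B `|` C)) D;
  ind_existence : forall (I : Type) (a : I -> M) B C,
    fg_substructure (range a) -> fg_substructure B -> fg_substructure C ->
    exists a' : I -> M, equiv_over B a' a /\ ind (range a') B C;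
  ind_stationarity : forall (I : Type) (a a' : I -> M) B C,
    fg_substructure (range a) -> fg_substructure (range a') ->
    fg_substructure B -> fg_substructure C ->
    equiv_over C a a' -> ind (range a) C B -> ind (range a') C B ->
    equiv_over (gen (B `|` C)) a a' }.

End Stationary.

(* Main.v *)
(* Forgetting the operation, a wedge-matroid is a linear space in which the
   substructures are the sets closed under the points of intersection of their lines.
   Two such spaces, or a whole family over a common base, have a free amalgam, whose
   only new collinearities come from lines having two points in the base. It omits
   every projective plane that the factors omit: a new point lies on at most one line
   of the base, whereas a plane has three lines through each point.

   (3) Independence is being freely amalgamated. (4) Gluing, functorially and at each of
   countably many stages, all finite extensions along all finite substructures gives a
   copy of the limit carrying an action of [Sym(nat)] that extends its action on the
   initial set. (5) A tuple of automorphisms is generic when the limit with this tuple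
   is the Fraisse limit of the finite structures with a tuple of automorphisms; EPPA and
   free amalgamation make such tuples comeager, and back-and-forth makes them conjugate.
   The small index property then follows by the Kechris-Rosendal tree argument.
   (1) Six points generate arbitrarily large finite matroids, hence an infinite one in
   an elementarily equivalent countable structure, while the limit is locally finite.
   (2) Whether two lines meet can be prescribed freely. *)
From HB Require Import structures.
From mathcomp Require Import all_boot all_classical topology zify.
Require Import Defs.
Set Implicit Arguments.
Unset Strict Implicit.
Unset Printing Implicit Defensive.
Local Open Scope classical_set_scope.

(** * Linear spaces *)

(** Both classes are handled at once as [K_omits PP], with [PP] empty or a single plane. The wedge
    is recovered from [Rel], so the work is done with relations, and only closure under meets
    remembers the operation. The base of an amalgam has to be closed on both sides: closedness in a
    factor keeps a new point off two lines of the base, closedness in the base structure keeps the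
    factor closed in the amalgam.

    In (4) the glued structure is not proved to be homogeneous. It is matched with the given limit
    by back-and-forth, where gluing answers one kind of request and universality with homogeneity of
    the limit the other. In (5) genericity is needed relative to a tuple that is already generic,
    because the tree argument adjoins one automorphism per level and must keep the earlier ones;
    ample generics are the case of an empty starting tuple. In (1) an ultrapower would be
    uncountable, so a countable family of sequences closed under Skolem functions is divided by the
    ultrafilter instead. *)

Definition matroid T (R : T -> T -> T -> Prop) : Prop :=
  [/\ forall a b c, R a b c -> distinct3 a b c,
      forall a b c, R a b c -> R b a c /\ R a c b &
      forall a b c d, R a b c -> R a b d -> c <> d -> R a c d].

(* The lines [a \/ b] and [c \/ d] are distinct and meet in [p], where [p] is not
   one of the four points: the relational content of [wedge a b c d = p]. *)
Definition meets T (R : T -> T -> T -> Prop) (a b c d p : T) : Prop :=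
  [/\ R a b p, R c d p & ~ line R a b c].

(** By [substructureP] these are the substructures of a wedge-matroid, described without the
    operation. *)
Definition meet_closed T (R : T -> T -> T -> Prop) (S : set T) : Prop :=
  forall a b c d p, S a -> S b -> S c -> S d -> meets R a b c d p -> S p.

Section Lines.
Variables (T : Type) (R : T -> T -> T -> Prop).
Hypothesis mR : matroid R.

Lemma matroid_neq a b c : R a b c -> [/\ a <> b, a <> c & b <> c].
Proof. by case: mR => h _ _ /h. Qed.

Lemma matroid_C12 a b c : R a b c -> R b a c.
Proof. by case: mR => _ h _ /h[]. Qed.

Lemma matroid_C23 a b c : R a b c -> R a c b.
Proof. by case: mR => _ h _ /h[]. Qed.

Lemma line_l a b : line R a b a. Proof. by left; left. Qed.
Lemma line_r a b : line R a b b. Proof. by left; right. Qed.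

Lemma lineC a b x : line R a b x -> line R b a x.
Proof.
by case=> [[->|->]|h]; [left; right|left; left|right; exact: matroid_C12].
Qed.

Lemma line_exchange a b c x : c <> a ->
  line R a b c -> line R a b x -> line R a c x.
Proof.
move=> ca [[//|->//]|Rc] [[->|->]|Rx]; first exact: line_l.
  by right; exact: matroid_C23.
have [->|xc] := pselect (x = c); first exact: line_r.
right; case: mR => _ _ h; apply: (h _ _ _ _ Rc Rx) => e; exact: xc.
Qed.

Lemma line_trans a b c d x : a <> b -> c <> d ->
  line R a b c -> line R a b d -> line R a b x -> line R c d x.
Proof.
move=> ab cd lc ld lx; have [ca|ca] := pselect (c = a).
  by subst c; apply: line_exchange ld lx => e; exact: cd.
apply: (@line_exchange c a); first by move=> e; exact: cd.
  exact/lineC/(line_exchange ca lc).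
exact/lineC/(line_exchange ca lc).
Qed.

Lemma line_eq a b c d : a <> b -> c <> d ->
  line R a b c -> line R a b d -> line R c d = line R a b.
Proof.
move=> ab cd lc ld; have trans x := line_trans (x := x) ab cd lc ld.
apply/seteqP; split=> x //; last exact: trans.
by apply: line_trans => //; apply: trans; [exact: line_l|exact: line_r].
Qed.

Lemma line_rel a b x : a <> x -> b <> x -> line R a b x -> R a b x.
Proof. by move=> ax bx [[e|e]|//]; [case: ax|case: bx]. Qed.

Lemma line_rel3 a b x y z : a <> b -> distinct3 x y z ->
  line R a b x -> line R a b y -> line R a b z -> R x y z.
Proof.
by move=> ab [xy xz yz] lx ly lz; apply: line_rel => //; apply: line_trans lz.
Qed.

Lemma rel_line a b x : R a b x -> line R a b x. Proof. by right. Qed.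

End Lines.

(** All points in question lie on the line through [a] and [b], and any two points of a line
    determine it; so the one triple in the third axiom of [matroid] yields all the others. *)
Lemma matroid_simple T (R : T -> T -> T -> Prop) :
  matroid R <-> simple_matroid3 R.
Proof.
split=> [mR|[dR sR tR]].
  case: (mR) => dR sR tR; split=> // a b c d Rc Rd x y z dxyz sub.
  have lin t : [set a; b; c; d] t -> line R a b t.
    by move=> [[[->|->]|->]|->]; [left; left|left; right|right|right].
  have [ab _ _] := matroid_neq mR Rc.
  by apply: (line_rel3 mR ab dxyz); apply: lin; apply: sub;
    [left; left|left; right|right].
split=> // a b c d Rc Rd cd; apply: (tR _ _ _ _ Rc Rd).
  by have [_ ac _] := dR _ _ _ Rc; have [_ ad _] := dR _ _ _ Rd.
by move=> t /= [[->|->]|->]; [left; left; left|left; right|right].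
Qed.

(** If [c] were on the line of [a] and [b], both lines would be the line through [c] and [p]; so
    keeping [c] off that line is enough to make them distinct, and their intersection is then the
    single point [p]. *)
Lemma lines_meet_atP T (R : T -> T -> T -> Prop) a b c d p : matroid R ->
  lines_meet_at R a b c d p <-> meets R a b c d p.
Proof.
move=> mR; split=> [[ab cd nl int np]|[Rp Rp' nl]].
  have [lp lp'] : line R a b p /\ line R c d p.
    by have : [set p] p by []; rewrite -int.
  have [pa pb pc pd] : [/\ a <> p, b <> p, c <> p & d <> p].
    by split=> e; apply: np; rewrite -e /=; tauto.
  split; [exact: line_rel|exact: line_rel|] => lc; apply: nl.
  rewrite -(@line_eq _ _ mR _ _ c p ab) // -(@line_eq _ _ mR _ _ c p cd) //.
  exact: line_l.
have [ab ap bp] := matroid_neq mR Rp; have [cd cp dp] := matroid_neq mR Rp'.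
split=> //.
- by move=> e; apply: nl; rewrite e; exact: line_l.
- apply/seteqP; split=> x /=; last by move=> ->; split; right.
  move=> [lx lx']; apply: contrapT => xp; apply: nl.
  rewrite -(@line_eq _ _ mR _ _ x p ab) //; last by right.
  by rewrite (@line_eq _ _ mR _ _ x p cd) //; [exact: line_l|right].
- by move=> [[[]|]|] e; [apply: ap|apply: bp|apply: cp|apply: dp].
Qed.

(** * Linear spaces given by their lines *)

Section PartialLinearSpace.
Variables (T : Type) (blk : set (set T)).
Hypothesis blk_uniq : forall L L' u v, blk L -> blk L' -> u <> v ->
  L u -> L v -> L' u -> L' v -> L = L'.

(** The blocks need not join every pair: two-point lines stay implicit, and a block with at most two
    points contributes nothing. *)
Definition blk_rel (u v w : T) : Prop :=
  distinct3 u v w /\ exists L, [/\ blk L, L u, L v & L w].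

Lemma blk_rel_matroid : matroid blk_rel.
Proof.
split=> [a b c [] //|a b c [[ab ac bc] [L [bL La Lb Lc]]]|a b c d].
  split; split.
  - by split=> // e; apply: ab.
  - by exists L.
  - by split=> // e; apply: bc.
  - by exists L.
move=> [[ab ac bc] [L [bL La Lb Lc]]] [[_ ad bd] [L' [bL' L'a L'b L'd]]] cd.
have e := blk_uniq bL bL' ab La Lb L'a L'b; subst L'.
by split=> //; exists L.
Qed.

End PartialLinearSpace.

(** * Projective planes *)

Section Plane.
Variable P : projective_plane.

Lemma plane_line_eq (p q : point P) l m : p <> q -> incident p l -> incident q l ->
  incident p m -> incident q m -> l = m.
Proof.
move=> /eqP pq pl ql pm qm; have [n [_ u]] := point_join pq.
by rewrite -(u l) // -(u m).
Qed.

Lemma plane_Rel_matroid : matroid (@plane_Rel P).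
Proof.
split=> [a b c [] //|a b c [[ab ac bc] [l [al bl cl]]]|a b c e].
  by split; split; (try exists l); split=> //; exact: nesym.
move=> [[ab ac bc] [l [al bl cl]]] [[_ ae be] [m [am bm em]]] ce.
split=> //; exists l; split=> //.
by rewrite (plane_line_eq ab al bl am bm).
Qed.

Lemma plane_join (p q : point P) : exists l, incident p l /\ incident q l.
Proof.
have [<-|pq] := eqVneq p q; last by have [l [h _]] := point_join pq; exists l.
have [f [fI _]] := quadrangle P.
have [i pi] : exists i, p != f i.
  have [e|] := eqVneq p (f ord0); last by exists ord0.
  exists (lift ord0 ord0); rewrite e; apply/eqP => /fI; discriminate.
by have [l [[h _] _]] := point_join pi; exists l.
Qed.

Lemma plane_meet (l m : pline P) : l <> m -> exists p, incident p l /\ incident p m.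
Proof. by move=> /eqP lm; have [p [h _]] := line_meet lm; exists p. Qed.

Lemma plane_quadrangle : exists a b c d : point P,
  [/\ distinct3 a b c, distinct3 a b d, distinct3 a c d, distinct3 b c d &
   forall l, [/\ ~ [/\ incident a l, incident b l & incident c l],
     ~ [/\ incident a l, incident b l & incident d l],
     ~ [/\ incident a l, incident c l & incident d l] &
     ~ [/\ incident b l, incident c l & incident d l]]].
Proof.
have [f [fI fN]] := quadrangle P.
pose i0 : 'I_4 := ord0; pose i1 : 'I_4 := lift ord0 ord0.
pose i2 : 'I_4 := lift ord0 (lift ord0 ord0).
pose i3 : 'I_4 := lift ord0 (lift ord0 (lift ord0 ord0)).
exists (f i0), (f i1), (f i2), (f i3).
have d3 i j k : distinct3 i j k -> distinct3 (f i) (f j) (f k).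
  by move=> [ij ik jk]; split=> /fI.
split; try by apply: d3; split=> e; discriminate.
by move=> l; split=> h; [apply: (fN i0 i1 i2)|apply: (fN i0 i1 i3)|
  apply: (fN i0 i2 i3)|apply: (fN i1 i2 i3)];
  (try by split=> e; discriminate); exists l.
Qed.

(** At most two points of a quadrangle lie on [l]. Projecting the other three from one that is off
    [l] gives three points of [l], distinct because the projecting lines are. *)
Lemma plane_three_points (l : pline P) : exists x y z : point P,
  [/\ distinct3 x y z, incident x l, incident y l & incident z l].
Proof.
have key (o a b c : point P) : ~ incident o l -> distinct3 o a b ->
    distinct3 o a c -> distinct3 o b c ->
    (forall m, [/\ ~ [/\ incident o m, incident a m & incident b m],
     ~ [/\ incident o m, incident a m & incident c m] &
     ~ [/\ incident o m, incident b m & incident c m]]) ->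
    exists x y z : point P, [/\ distinct3 x y z, incident x l, incident y l & incident z l].
  move=> ol [oa ob ab] [_ oc ac] [_ _ bc] nc.
  have proj q : o <> q -> exists m x, [/\ incident o m, incident q m, incident x m,
      incident x l & o <> x].
    move=> oq; have [m [om qm]] := plane_join o q.
    have ml : m <> l by move=> e; apply: ol; rewrite -e.
    have [x [xm xl]] := plane_meet ml; exists m, x; split=> // e.
    by apply: ol; rewrite e.
  have [m [x [om am xm xl ox]]] := proj _ oa.
  have [m' [y [om' bm' ym' yl oy]]] := proj _ ob.
  have [m'' [z [om'' cm'' zm'' zl oz]]] := proj _ oc.
  exists x, y, z; split=> //; split=> e; subst.
  - have e := plane_line_eq ox om xm om' ym'; subst m'.
    by have [h _ _] := nc m; apply: h.
  - have e := plane_line_eq ox om xm om'' zm''; subst m''.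
    by have [_ h _] := nc m; apply: h.
  - have e := plane_line_eq oy om' ym' om'' zm''; subst m''.
    by have [_ _ h] := nc m'; apply: h.
have [a [b [c [d [d1 d2 d3 d4 nc]]]]] := plane_quadrangle.
have [[ab ac bc] [_ ad bd] [_ _ cd]] := And3 d1 d2 d3.
have [al|al] := pselect (incident a l); last first.
  by apply: (key a b c d) => // m; have [] := nc m.
have [bl|bl] := pselect (incident b l); last first.
  apply: (key b a c d) => //; try by split=> //; exact: nesym.
  move=> m; have [h1 h2 h3 h4] := nc m; split=> -[] *; [exact: h1|exact: h2|exact: h4].
have [cl|cl] := pselect (incident c l); first by have [h _ _ _] := nc l; case: h.
apply: (key c a b d) => //; try by split=> //; exact: nesym.
move=> m; have [h1 h2 h3 h4] := nc m; split=> -[] *; [exact: h1|exact: h3|exact: h4].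
Qed.

Lemma plane_third_point (p q : point P) : p <> q -> exists r, plane_Rel p q r.
Proof.
move=> pq; have [l [pl ql]] := plane_join p q.
have [x [y [z [[xy xz yz] xl yl zl]]]] := plane_three_points l.
suff [r [pr qr rl]] : exists r, [/\ p <> r, q <> r & incident r l].
  by exists r; split=> //; exists l.
have [px|px] := pselect (p = x).
  have [qy|qy] := pselect (q = y); first by exists z; subst.
  by exists y; subst.
have [qx|qx] := pselect (q = x); last by exists x.
have [py|py] := pselect (p = y); first by exists z; subst.
by exists y; subst.
Qed.

(** The sides of a triangle do not all pass through [p], so some line [l] misses [p]; the [q i] are
    three points of [l]. *)
Lemma plane_three_lines (p : point P) : exists q : 'I_3 -> point P,
  (forall i, exists r, plane_Rel p (q i) r) /\
  forall i j, i <> j -> q i <> q j /\ ~ plane_Rel p (q i) (q j).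
Proof.
have [a [b [c [d [[ab ac bc] _ _ _ nc]]]]] := plane_quadrangle.
have [l pl] : exists l, ~ incident p l.
  have [l [al bl]] := plane_join a b; have [m [am cm]] := plane_join a c.
  have [n [bn cn]] := plane_join b c; apply: contrapT => h.
  have pA k : incident p k by apply: contrapT => pk; apply: h; exists k.
  have pa : p = a.
    apply: contrapT => pa; have e := plane_line_eq pa (pA l) al (pA m) am.
    by subst m; have [h1 _ _ _] := nc l; apply: h1.
  by have [h1 _ _ _] := nc n; apply: h1; split=> //; rewrite -pa.
have [x [y [z [[xy xz yz] xl yl zl]]]] := plane_three_points l.
pose q (i : 'I_3) := if val i == 0 then x else if val i == 1 then y else z.
have ql i : incident (q i) l by rewrite /q; case: ifP => // _; case: ifP.
have qI i j : i <> j -> q i <> q j.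
  move=> ij e; apply: ij; apply/val_inj; move: e; rewrite /q.
  case: i j => [[|[|[|i]]] hi] [[|[|[|j]]] hj] //= e; exfalso; subst; auto.
exists q; split=> [i|i j ij].
  by apply: plane_third_point => e; apply: pl; rewrite e.
split; first exact: qI.
move=> [_ [m [pm qm qm']]]; apply: pl.
by rewrite (plane_line_eq (qI _ _ ij) (ql i) (ql j) qm qm').
Qed.

Definition omits T (R : T -> T -> T -> Prop) (X : set T) : Prop :=
  ~ exists f : point P -> T, [/\ injective f, forall x, X (f x) &
      forall x y z, plane_Rel x y z <-> R (f x) (f y) (f z)].

Lemma omits_image T T' (R : T -> T -> T -> Prop) (R' : T' -> T' -> T' -> Prop)
    (X : set T) (X' : set T') (g : T -> T') : {in X &, injective g} ->
  (forall x y z, X x -> X y -> X z -> R x y z <-> R' (g x) (g y) (g z)) ->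
  (forall x, X x -> X' (g x)) -> omits R' X' -> omits R X.
Proof.
move=> gI gR gX h [f [fI fX fR]]; apply: h; exists (g \o f); split=> [x y /= e|x|x y z] /=.
- by apply: fI; apply: gI e; rewrite inE.
- exact: gX.
- by rewrite fR gR.
Qed.

(* A copy of the plane has a point of largest rank, and that point lies on three
   lines of the copy. *)
Lemma omits_rank T (R : T -> T -> T -> Prop) (X : set T) (rk : T -> nat) :
  (forall p, exists L L' : set T,
     (forall q r, R p q r -> rk q <= rk p -> rk r <= rk p -> L q \/ L' q) /\
     forall M, M = L \/ M = L' -> forall q r, q <> r -> p <> q -> p <> r ->
        M q -> M r -> R p q r) ->
  omits R X.
Proof.
move=> two [f [fI fX fR]].
have [a _] := plane_quadrangle.
pose p := [arg max_(x > a) rk (f x)].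
have pmax x : rk (f x) <= rk (f p) by rewrite /p; case: arg_maxnP => //= y _; apply.
have [L [L' [cov col]]] := two (f p).
have [q [qr qN]] := plane_three_lines p.
have pq i : p <> q i by have [r [[]]] := qr i.
have qL i : L (f (q i)) \/ L' (f (q i)).
  by have [r /fR h] := qr i; apply: cov h _ _.
have no K i j : K = L \/ K = L' -> i <> j -> K (f (q i)) -> K (f (q j)) -> False.
  move=> eK ij Ki Kj; have [nq] := qN i j ij; apply; apply/fR; apply: (col K eK) => //.
  - by move=> /fI.
  - by move=> /fI; exact: pq.
  - by move=> /fI; exact: pq.
pose i0 : 'I_3 := ord0; pose i1 : 'I_3 := lift ord0 ord0; pose i2 : 'I_3 := ord_max.
have [n01 n02 n12] : [/\ i0 <> i1, i0 <> i2 & i1 <> i2] by split; discriminate.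
have nL i j : i <> j -> L (f (q i)) -> L (f (q j)) -> False by apply: no; left.
have nL' i j : i <> j -> L' (f (q i)) -> L' (f (q j)) -> False by apply: no; right.
(* Pigeonhole: two of the three points fall into the same set [L] or [L']. *)
by case: (qL i0) (qL i1) (qL i2) => h0 [] h1 [] h2; eauto.
Qed.

End Plane.

(** * Free amalgamation of a family over a common base *)

(* [X] carries [RX], each [B i] carries [RB i], all inside one ambient type, and
   distinct [B i] meet only inside [X]. *)
Record amalgam_data (T : Type) (X : set T) (RX : T -> T -> T -> Prop)
    (I : Type) (B : I -> set T) (RB : I -> T -> T -> T -> Prop) : Prop := {
  am_mX : matroid RX;
  am_mB : forall i, matroid (RB i);
  am_sX : forall a b c, RX a b c -> X a;
  am_sB : forall i a b c, RB i a b c -> B i a;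
  am_agree : forall i a b c, X a -> X b -> X c -> B i a -> B i b -> B i c ->
    RX a b c <-> RB i a b c;
  am_disj : forall i j u, B i u -> B j u -> ~ X u -> i = j;
  am_clB : forall i, meet_closed (RB i) (X `&` B i);
  am_clX : forall i, meet_closed RX (X `&` B i) }.

Section Amalgam.
Variables (T : Type) (X : set T) (RX : T -> T -> T -> Prop).
Variables (I : Type) (B : I -> set T) (RB : I -> T -> T -> T -> Prop).

(* The points of the amalgam on the line [L] of [X]: a point outside [X] lies on it
   if its own [B i] says so, by means of two points of [X]. *)
Definition am_on (L : set T) (u : T) : Prop :=
  L u \/ exists i d d', [/\ X d, X d', RB i d d' u, L d & L d'].

(** An extended line of [X] may contain points of several factors, which is the only way to
    collinearities not already present in [X] or in one factor. *)
Definition am_rel (u v w : T) : Prop := distinct3 u v w /\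
  ((exists c c', [/\ X c, X c', c <> c', am_on (line RX c c') u &
     am_on (line RX c c') v /\ am_on (line RX c c') w]) \/ exists i, RB i u v w).

Hypothesis D : amalgam_data X RX B RB.

Let mX := am_mX D.
Let mB := am_mB D.

Lemma am_sX3 a b c : RX a b c -> [/\ X a, X b & X c].
Proof.
move=> h; split; apply: (am_sX D); first exact: h.
  exact: (matroid_C12 mX) h.
exact: (matroid_C12 mX) (matroid_C23 mX h).
Qed.

Lemma am_sB3 i a b c : RB i a b c -> [/\ B i a, B i b & B i c].
Proof.
move=> h; split; apply: (am_sB D); first exact: h.
  exact: (matroid_C12 (mB i)) h.
exact: (matroid_C12 (mB i)) (matroid_C23 (mB i) h).
Qed.

Lemma am_lineX c c' u : X c -> X c' -> line RX c c' u -> X u.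
Proof. by move=> Xc Xc' [[->|->]//|/am_sX3[]]. Qed.

Lemma am_lineB i c c' u : B i c -> B i c' -> line (RB i) c c' u -> B i u.
Proof. by move=> Xc Xc' [[->|->]//|/am_sB3[]]. Qed.

Lemma am_line_agree i a b c : X a -> X b -> X c -> B i a -> B i b -> B i c ->
  line RX a b c <-> line (RB i) a b c.
Proof. by move=> *; rewrite /line /= (@am_agree _ _ _ _ _ _ D i). Qed.

Lemma am_on_X c c' u : X c -> X c' -> c <> c' -> X u ->
  am_on (line RX c c') u -> line RX c c' u.
Proof.
move=> Xc Xc' cc' Xu [//|[i [d [d' [Xd Xd' h Ld Ld']]]]].
have [Bd Bd' Bu] := am_sB3 h; have [dd' _ _] := matroid_neq (mB i) h.
rewrite -(line_eq mX cc' dd' Ld Ld'); right.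
exact/(am_agree D Xd Xd' Xu Bd Bd' Bu).
Qed.

Lemma am_on_new c c' i u : X c -> X c' -> B i u -> ~ X u ->
  am_on (line RX c c') u -> exists d d', [/\ X d, X d', RB i d d' u,
    line RX c c' d & line RX c c' d'].
Proof.
move=> Xc Xc' Bu nXu [/(am_lineX Xc Xc')//|[j [d [d' [Xd Xd' h Ld Ld']]]]].
have [_ _ Bj] := am_sB3 h; have e := am_disj D Bu Bj nXu; subst j.
by exists d, d'.
Qed.

(** Two different lines of the base through [u] would meet in [u] inside the factor [B i], and
    closedness of the base in that factor would put [u] into [X]. *)
Lemma am_on_uniq i u d d' e e' : ~ X u -> X d -> X d' -> X e -> X e' ->
  RB i d d' u -> RB i e e' u -> line RX d d' = line RX e e'.
Proof.
move=> nXu Xd Xd' Xe Xe' hd he.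
have [Bd Bd' Bu] := am_sB3 hd; have [Be Be' _] := am_sB3 he.
have [dd' du d'u] := matroid_neq (mB i) hd.
have [ee' eu e'u] := matroid_neq (mB i) he.
have Le : line (RB i) d d' e.
  apply: contrapT => h; apply: nXu.
  by have [] : (X `&` B i) u by apply: (am_clB D) (And3 hd he h).
have eq1 : line (RB i) e u = line (RB i) d d'.
  by apply: (line_eq (mB i)) => //; right.
have eq2 : line (RB i) e u = line (RB i) e e'.
  by apply: (line_eq (mB i)) => //; [exact: line_l|right].
have Le' : line (RB i) d d' e' by rewrite -eq1 eq2; exact: line_r.
symmetry; apply: (line_eq mX) => //.
  exact/(am_line_agree Xd Xd' Xe Bd Bd' Be).
exact/(am_line_agree Xd Xd' Xe' Bd Bd' Be').
Qed.

Lemma am_on_new_eq u c c' e e' : ~ X u -> X c -> X c' -> c <> c' -> X e -> X e' ->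
  e <> e' -> am_on (line RX c c') u -> am_on (line RX e e') u ->
  line RX c c' = line RX e e'.
Proof.
move=> nXu Xc Xc' cc' Xe Xe' ee' h h'.
case: (h) => [/(am_lineX Xc Xc')//|[i [d [d' [Xd Xd' hd Ld Ld']]]]].
have [_ _ Bu] := am_sB3 hd; have [dd' _ _] := matroid_neq (mB i) hd.
have [f [f' [Xf Xf' hf Lf Lf']]] := am_on_new Xe Xe' Bu nXu h'.
have [ff' _ _] := matroid_neq (mB i) hf.
rewrite -(line_eq mX cc' dd' Ld Ld') -(line_eq mX ee' ff' Lf Lf').
exact: (am_on_uniq nXu Xd Xd' Xf Xf' hd hf).
Qed.

Lemma am_on_line c c' i d d' v : X c -> X c' -> c <> c' -> d <> d' ->
  X d -> X d' -> B i d -> B i d' -> line RX c c' d -> line RX c c' d' ->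
  B i v -> am_on (line RX c c') v <-> line (RB i) d d' v.
Proof.
move=> Xc Xc' cc' dd' Xd Xd' Bd Bd' Ld Ld' Bv; split; last first.
  by case=> [[->|->]|h]; [left|left|right; exists i, d, d'].
have [Xv|nXv] := pselect (X v).
  move=> /(am_on_X Xc Xc' cc' Xv).
  by rewrite -(line_eq mX cc' dd' Ld Ld') (am_line_agree Xd Xd' Xv Bd Bd' Bv).
move=> /(am_on_new Xc Xc' Bv nXv)[e [e' [Xe Xe' he]]].
have [Be Be' _] := am_sB3 he; have [ee' _ _] := matroid_neq (mB i) he.
rewrite -(line_eq mX cc' dd' Ld Ld').
rewrite (am_line_agree Xd Xd' Xe Bd Bd' Be) (am_line_agree Xd Xd' Xe' Bd Bd' Be').
by move=> l l'; rewrite -(line_eq (mB i) dd' ee' l l'); right.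
Qed.

(** The lines of the amalgam. A factor line with two points in [X] is left out of the second kind:
    it is contained in an extended line of [X], and keeping both would break uniqueness. *)
Definition am_blk (L : set T) : Prop :=
  (exists c c', [/\ X c, X c', c <> c' & L = am_on (line RX c c')]) \/
  (exists i x y, [/\ B i x, B i y, x <> y, L = line (RB i) x y &
     forall d d', X d -> X d' -> L d -> L d' -> d = d']).

(** A base line whose extension has two points in [B i] already has two base points there: the ones
    witnessing a new point, or [u] and [v] themselves. Its trace on [B i] is then a factor line with
    two points in [X], against the hypothesis on [x] and [y]. *)
Lemma am_blk_mixed c c' i x y u v : X c -> X c' -> c <> c' ->
  B i x -> B i y -> x <> y ->
  (forall d d', X d -> X d' -> line (RB i) x y d -> line (RB i) x y d' -> d = d') ->
  u <> v -> am_on (line RX c c') u -> am_on (line RX c c') v ->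
  line (RB i) x y u -> line (RB i) x y v -> False.
Proof.
move=> Xc Xc' cc' Bx By xy one uv cu cv lu lv.
have [Bu Bv] := conj (am_lineB Bx By lu) (am_lineB Bx By lv).
suff [d [d' [Xd Xd' dd' [Bd Bd' Ld Ld']]]] : exists d d', [/\ X d, X d', d <> d' &
    [/\ B i d, B i d', line RX c c' d & line RX c c' d']].
  have lin := am_on_line Xc Xc' cc' dd' Xd Xd' Bd Bd' Ld Ld'.
  have e1 := line_eq (mB i) dd' uv (iffLR (lin _ Bu) cu) (iffLR (lin _ Bv) cv).
  have e2 := line_eq (mB i) xy uv lu lv.
  apply: dd'; apply: one => //; rewrite -e2 e1; [exact: line_l|exact: line_r].
have [Xu|nXu] := pselect (X u); last first.
  have [d [d' [Xd Xd' h Ld Ld']]] := am_on_new Xc Xc' Bu nXu cu.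
  have [Bd Bd' _] := am_sB3 h; have [dd' _ _] := matroid_neq (mB i) h.
  by exists d, d'.
have [Xv|nXv] := pselect (X v); last first.
  have [d [d' [Xd Xd' h Ld Ld']]] := am_on_new Xc Xc' Bv nXv cv.
  have [Bd Bd' _] := am_sB3 h; have [dd' _ _] := matroid_neq (mB i) h.
  by exists d, d'.
exists u, v; split=> //; split=> //; exact: am_on_X.
Qed.

Lemma am_blk_uniq L L' u v : am_blk L -> am_blk L' -> u <> v ->
  L u -> L v -> L' u -> L' v -> L = L'.
Proof.
case=> [[c [c' [Xc Xc' cc' ->]]]|[i [x [y [Bx By xy -> one]]]]];
case=> [[e [e' [Xe Xe' ee' ->]]]|[j [z [t [Bz Bt zt -> one']]]]] uv Lu Lv L'u L'v.
- have [Xu|nXu] := pselect (X u); last by congr am_on; apply: am_on_new_eq Lu L'u.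
  have [Xv|nXv] := pselect (X v); last by congr am_on; apply: am_on_new_eq Lv L'v.
  rewrite -(line_eq mX cc' uv (am_on_X Xc Xc' cc' Xu Lu) (am_on_X Xc Xc' cc' Xv Lv)).
  by rewrite -(line_eq mX ee' uv (am_on_X Xe Xe' ee' Xu L'u) (am_on_X Xe Xe' ee' Xv L'v)).
- by have := am_blk_mixed Xc Xc' cc' Bz Bt zt one' uv Lu Lv L'u L'v.
- by have := am_blk_mixed Xe Xe' ee' Bx By xy one uv L'u L'v Lu Lv.
have [Bu Bv] := conj (am_lineB Bx By Lu) (am_lineB Bx By Lv).
have [B'u B'v] := conj (am_lineB Bz Bt L'u) (am_lineB Bz Bt L'v).
(* A common point outside [X] forces [i = j]; two common points inside [X] are excluded by [one]. *)
have ij : i = j.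
  have [Xu|nXu] := pselect (X u); last exact: (am_disj D) nXu.
  have [Xv|nXv] := pselect (X v); last exact: (am_disj D) nXv.
  by case: uv; exact: one.
subst j; rewrite -(line_eq (mB i) xy uv Lu Lv).
exact: (line_eq (mB i) zt uv L'u L'v).
Qed.

Lemma am_relE : am_rel = blk_rel am_blk.
Proof.
apply/funext => u; apply/funext => v; apply/funext => w; apply/propext.
split=> -[duvw h]; (split=> //); last first.
  have [L [[[c [c' [Xc Xc' cc' ->]]]|[i [x [y [Bx By xy -> one]]]]] Lu Lv Lw]] := h.
    by left; exists c, c'.
  by right; exists i; apply: (line_rel3 (mB i) xy duvw).
case: h => [[c [c' [Xc Xc' cc' cu [cv cw]]]]|[i h]].
  by exists (am_on (line RX c c')); split=> //; left; exists c, c'.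
have [Bu Bv Bw] := am_sB3 h; have [uv uw vw] := duvw.
(* A factor line with two points in [X] is replaced by the extended line of [X] that they span. *)
have [one|] := pselect (forall d d', X d -> X d' -> line (RB i) u v d ->
    line (RB i) u v d' -> d = d').
  exists (line (RB i) u v); split; [|exact: line_l|exact: line_r|by right].
  by right; exists i, u, v.
move=> /existsNP[d /existsNP[d' /not_implyP[Xd /not_implyP[Xd' /not_implyP[
  ld /not_implyP[ld' dd']]]]]].
have [Bd Bd'] := conj (am_lineB Bu Bv ld) (am_lineB Bu Bv ld').
have e := line_eq (mB i) uv dd' ld ld'.
have lin t (Bt : B i t) := am_on_line Xd Xd' dd' dd' Xd Xd' Bd Bd'
  (line_l _ _ _) (line_r _ _ _) Bt.
exists (am_on (line RX d d')); split; first by left; exists d, d'.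
- by apply/lin => //; rewrite e; exact: line_l.
- by apply/lin => //; rewrite e; exact: line_r.
- by apply/lin => //; rewrite e; right.
Qed.

Lemma am_rel_matroid : matroid am_rel.
Proof. rewrite am_relE; apply: blk_rel_matroid; exact: am_blk_uniq. Qed.

Lemma am_rel_supp u v w : am_rel u v w -> X u \/ exists i, B i u.
Proof.
move=> [_ [[c [c' [Xc Xc' cc' [/(am_lineX Xc Xc')|] ]]]|[i /am_sB3[]]]].
- by left.
- by move=> [i [d [d' [_ _ /am_sB3[_ _ Bu] _ _]]]] _; right; exists i.
- by right; exists i.
Qed.

Lemma am_rel_X u v w : X u -> X v -> X w -> am_rel u v w <-> RX u v w.
Proof.
move=> Xu Xv Xw; split=> [[[uv uw vw] [[c [c' [Xc Xc' cc' cu [cv cw]]]]|[i h]]]|h].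
- by apply: (line_rel3 mX cc') => //; exact: am_on_X.
- by have [Bu Bv Bw] := am_sB3 h; apply/(am_agree D Xu Xv Xw Bu Bv Bw).
have [uv uw vw] := matroid_neq mX h.
split=> //; left; exists u, v; split=> //; first by left; exact: line_l.
by split; left; [exact: line_r|right].
Qed.

(** A line of another factor through [u] and [v] would have both in [X], hence would not be a block.
    An extended base line through them has two base points in [B i], and there it traces a line of
    the factor. *)
Lemma am_rel_B i u v w : B i u -> B i v -> B i w -> am_rel u v w <-> RB i u v w.
Proof.
move=> Bu Bv Bw; split=> [|h]; last first.
  by have [uv uw vw] := matroid_neq (mB i) h; split=> //; right; exists i.
rewrite am_relE => -[duvw [L [bL Lu Lv Lw]]]; have [uv uw vw] := duvw.
have [[x [y [Bx By xy one]]]|nB] := pselect (exists x y, [/\ B i x, B i y, x <> y &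
    L = line (RB i) x y]).
  by subst L; apply: (line_rel3 (mB i) xy duvw).
case: bL => [[c [c' [Xc Xc' cc' eL]]]|[j [x [y [Bx By xy eL one]]]]]; last first.
  subst L; have [Bju Bjv] := conj (am_lineB Bx By Lu) (am_lineB Bx By Lv).
  have [Xu Xv] : X u /\ X v.
    split; apply: contrapT => nX; apply: nB.
      by have e := am_disj D Bu Bju nX; subst j; exists x, y.
    by have e := am_disj D Bv Bjv nX; subst j; exists x, y.
  by case: uv; exact: one.
subst L; have on t : am_on (line RX c c') t -> X t -> line RX c c' t.
  by move=> /[swap] Xt; exact: am_on_X.
have two d d' : d <> d' -> X d -> X d' -> B i d -> B i d' -> line RX c c' d ->
    line RX c c' d' -> RB i u v w.
  move=> dd' Xd Xd' Bd Bd' Ld Ld'.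
  have lin := am_on_line Xc Xc' cc' dd' Xd Xd' Bd Bd' Ld Ld'.
  by apply: (line_rel3 (mB i) dd' duvw); apply/lin.
have [Xu|nXu] := pselect (X u); last first.
  have [d [d' [Xd Xd' h Ld Ld']]] := am_on_new Xc Xc' Bu nXu Lu.
  have [Bd Bd' _] := am_sB3 h; have [dd' _ _] := matroid_neq (mB i) h.
  exact: (two d d').
have [Xv|nXv] := pselect (X v); last first.
  have [d [d' [Xd Xd' h Ld Ld']]] := am_on_new Xc Xc' Bv nXv Lv.
  have [Bd Bd' _] := am_sB3 h; have [dd' _ _] := matroid_neq (mB i) h.
  exact: (two d d').
by apply: (two u v) => //; exact: on.
Qed.

(** As [v] is outside [B i], no factor accounts for the collinearity; it comes from a base line,
    which the new point [u] sees through two base points of its own factor. *)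
Lemma am_rel_mixed i u v w : B i u -> ~ X u -> ~ B i v -> am_rel u v w ->
  exists d d', [/\ X d, X d', RB i d d' u, am_on (line RX d d') v &
    am_on (line RX d d') w].
Proof.
move=> Bu nXu nBv [_ [[c [c' [Xc Xc' cc' cu [cv cw]]]]|[j h]]]; last first.
  by have [Bju Bjv _] := am_sB3 h; case: nBv; rewrite (am_disj D Bu Bju nXu).
have [d [d' [Xd Xd' h Ld Ld']]] := am_on_new Xc Xc' Bu nXu cu.
have [dd' _ _] := matroid_neq (mB i) h.
by exists d, d'; split=> //; rewrite (line_eq mX cc' dd' Ld Ld').
Qed.

(** With [J] empty and [X0 = X] this says that [X] is closed in the amalgam; with one index and its
    trace on [X], that a factor is. A meeting point outside the set lies on two distinct extended
    lines, both spanned in [X0]; it cannot be new, since a new point is on only one, so it is in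
    [X], and [X0] is closed. *)
Lemma am_closed (X0 : set T) (J : set I) : X0 `<=` X -> meet_closed RX X0 ->
  (forall j, J j -> X `&` B j `<=` X0) ->
  meet_closed am_rel (X0 `|` [set u | exists2 j, J j & B j u]).
Proof.
move=> sX0 cX0 sJ; set S := (X in meet_closed _ X) => u v w z p Su Sv Sw Sz.
have SX t : S t -> X t -> X0 t by move=> [//|[j Jj Bj] Xt]; apply: (sJ j).
have SB t j : S t -> B j t -> ~ J j -> X t.
  move=> [/sX0//|[k Jk Bk] Bj nJ]; apply: contrapT => nX.
  by apply: nJ; rewrite -(am_disj D Bk Bj nX).
rewrite am_relE => -[[[uv up vp] [L [bL Lu Lv Lp]]]
  [[wz wp zp] [L' [bL' Lw Lz Lp']]] nl].
have LL' : L <> L'.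
  move=> e; subst L'; apply: nl; have [->|wu] := pselect (w = u); first exact: line_l.
  have [->|wv] := pselect (w = v); first exact: line_r.
  by right; split; [split=> //; exact: nesym|exists L].
(* A line with two points in [S] and a point outside [S] is the extension of a line spanned in
   [X0]. *)
have type1 K a b : am_blk K -> S a -> S b -> a <> b -> K a -> K b -> K p -> ~ S p ->
    exists c c', [/\ X0 c, X0 c', c <> c' & K = am_on (line RX c c')].
  move=> [[c [c' [Xc Xc' cc' ->]]]|[i [x [y [Bx By xy -> one]]]]] Sa Sb ab Ka Kb Kp nSp;
    last first.
    have [Bp Ba Bb] := And3 (am_lineB Bx By Kp) (am_lineB Bx By Ka) (am_lineB Bx By Kb).
    have [Ji|nJi] := pselect (J i); first by case: nSp; right; exists i.
    by case: ab; apply: one => //; [exact: SB Ba nJi|exact: SB Bb nJi].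
  suff [e [e' [Xe Xe' ee' Le Le']]] : exists e e', [/\ X0 e, X0 e', e <> e',
      line RX c c' e & line RX c c' e'].
    by exists e, e'; split=> //; rewrite (line_eq mX cc' ee').
  have new t : S t -> ~ X t -> am_on (line RX c c') t -> exists e e',
      [/\ X0 e, X0 e', e <> e', line RX c c' e & line RX c c' e'].
    move=> [/sX0//|[j Jj Bj] nX /(am_on_new Xc Xc' Bj nX)[d [d' [Xd Xd' h Ld Ld']]]].
    have [Bd Bd' _] := am_sB3 h; have [dd' _ _] := matroid_neq (mB j) h.
    by exists d, d'; split=> //; apply: (sJ j).
  have [Xa|nXa] := pselect (X a); last exact: new nXa Ka.
  have [Xb|nXb] := pselect (X b); last exact: new nXb Kb.
  exists a, b; split=> //; [exact: SX|exact: SX|exact: am_on_X|exact: am_on_X].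
apply: contrapT => nSp.
have [c [c' [Xc Xc' cc' eL]]] := type1 L u v bL Su Sv uv Lu Lv Lp nSp.
have [e [e' [Xe Xe' ee' eL']]] := type1 L' w z bL' Sw Sz wz Lw Lz Lp' nSp.
have [[Yc Yc'] [Ye Ye']] :=
  conj (conj (sX0 _ Xc) (sX0 _ Xc')) (conj (sX0 _ Xe) (sX0 _ Xe')).
subst L L'.
have [Xp|nXp] := pselect (X p); last by apply: LL'; congr am_on; apply: am_on_new_eq Lp Lp'.
have [lp lp'] := conj (am_on_X Yc Yc' cc' Xp Lp) (am_on_X Ye Ye' ee' Xp Lp').
have nX0 : ~ X0 p by move=> h; apply: nSp; left.
have nin t : X0 t -> t <> p by move=> h e1; apply: nX0; rewrite -e1.
apply: nX0; apply: (cX0 c c' e e') => //; split.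
- by apply: line_rel => //; exact: nin.
- by apply: line_rel => //; exact: nin.
move=> le; apply: LL'; congr am_on.
have ep := nin _ Xe.
rewrite -(line_eq mX cc' ep le lp) -(line_eq mX ee' ep) //; exact: line_l.
Qed.

(** A copy of the plane has a point [p] that is new in some [B i] and a point [q] outside [B i];
    then [q] is on the extension of the only base line [m] through [p]. A point [r] off the line
    [pq] must lie in [B i], otherwise [pr] would come from [m] too. It must also lie in [X],
    otherwise [q] would be the meeting point of [m] with the base line of [r], hence a point of
    [B i]. So a second line through [p] has two points in the base, and it is [m] again: a
    contradiction. *)
Lemma am_omits P : omits P RX X -> (forall i, omits P (RB i) (B i)) ->
  omits P am_rel (X `|` [set u | exists i, B i u]).
Proof.
move=> oX oB [f [fI fX fR]].
have [p nXp] : exists p, ~ X (f p).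
  apply: contrapT => h; apply: oX; exists f.
  have Xf x : X (f x) by apply: contrapT => nX; apply: h; exists x.
  by split=> // x y z; rewrite fR am_rel_X.
have [i Bp] : exists i, B i (f p) by have [//|[i h]] := fX p; exists i.
have [q nBq] : exists q, ~ B i (f q).
  apply: contrapT => h; apply: (oB i); exists f.
  have Bf x : B i (f x) by apply: contrapT => nB; apply: h; exists x.
  by split=> // x y z; rewrite fR (@am_rel_B i).
have pq : p <> q by move=> e; apply: nBq; rewrite -e.
have [s /fR hs] := plane_third_point pq.
have [d [d' [Xd Xd' hd dq ds]]] := am_rel_mixed Bp nXp nBq hs.
have [Bd Bd' _] := am_sB3 hd; have [dd' dp d'p] := matroid_neq (mB i) hd.
have onp : am_on (line RX d d') (f p).
  by right; exists i, d, d'; split=> //; [exact: line_l|exact: line_r].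
(* the unique [X]-line through [f p] is [line RX d d'], and [f q] lies on it *)
have off r : p <> r -> q <> r -> ~ plane_Rel p q r -> ~ am_on (line RX d d') (f r).
  move=> pr qr nR h; apply: nR; apply/fR; split.
    by split=> /fI.
  by left; exists d, d'.
have offX r : p <> r -> q <> r -> ~ plane_Rel p q r -> X (f r) /\ B i (f r).
  move=> pr qr nR; have nr := off _ pr qr nR.
  have Br : B i (f r).
    apply: contrapT => nBr; have [t /fR ht] := plane_third_point pr.
    have [e [e' [Xe Xe' he er et]]] := am_rel_mixed Bp nXp nBr ht.
    by apply: nr; rewrite (am_on_uniq nXp Xd Xd' Xe Xe' hd he).
  split=> //; apply: contrapT => nXr.
  have rq : r <> q by move=> e; exact: qr.
  have [t /fR ht] := plane_third_point rq.
  have [e [e' [Xe Xe' he eq et]]] := am_rel_mixed Br nXr nBq ht.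
  have [Be Be' _] := am_sB3 he; have [ee' _ _] := matroid_neq (mB i) he.
  have onr : am_on (line RX e e') (f r).
    by right; exists i, e, e'; split=> //; [exact: line_l|exact: line_r].
  have nle : line RX d d' <> line RX e e' by move=> E; apply: nr; rewrite E.
  have [Xq|nXq] := pselect (X (f q)); last by apply: nle; exact: am_on_new_eq dq eq.
  have [lq lq'] := conj (am_on_X Xd Xd' dd' Xq dq) (am_on_X Xe Xe' ee' Xq eq).
  have nin t' : B i t' -> t' <> f q by move=> h e1; apply: nBq; rewrite -e1.
  apply: nBq; suff [] : (X `&` B i) (f q) by [].
  apply: (am_clX D (a := d) (b := d') (c := e) (d := e')) => //; split.
  - by apply: line_rel => //; exact: nin.
  - by apply: line_rel => //; exact: nin.
  move=> le; apply: nle; have eq' := nin _ Be.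
  rewrite -(line_eq mX dd' eq' le lq) -(line_eq mX ee' eq') //; exact: line_l.
have [g [gR gN]] := plane_three_lines p.
have pg j : p <> g j by have [r [[]]] := gR j.
have [j [qg nR]] : exists j, q <> g j /\ ~ plane_Rel p q (g j).
  apply: contrapT => h.
  have on j : line (@plane_Rel P) p q (g j).
    have [->|qg] := pselect (g j = q); first exact: line_r.
    right; apply: contrapT => nR; apply: h; exists j; split=> //; exact: nesym.
  have ij : (ord0 : 'I_3) <> lift ord0 ord0 by discriminate.
  have [n1 n2] := gN _ _ ij; apply: n2.
  by apply: (line_rel3 (@plane_Rel_matroid P) pq); [split|exact: line_l| |].
have [r hr] := gR j; have [[_ pr gr] [l [pl gl rl]]] := hr.
have nRr : q <> r /\ ~ plane_Rel p q r.
  suff nq : ~ incident q l.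
    split=> [e|[_ [m [pm qm rm]]]]; first by apply: nq; rewrite e.
    by apply: nq; rewrite (plane_line_eq pr pl rl pm rm).
  by move=> ql; apply: nR; split=> //; exists l.
have [Xg Bg] := offX _ (pg j) qg nR; have [Xr Br] := offX _ pr nRr.1 nRr.2.
apply: (off _ (pg j) qg nR).
have h : RB i (f (g j)) (f r) (f p).
  apply/am_rel_B => //; apply/fR; split; last by exists l.
  by split=> //; exact: nesym.
by rewrite (am_on_uniq nXp Xd Xd' Xg Xr hd h); left; exact: line_l.
Qed.

End Amalgam.

(** * Structures and automorphisms *)

Lemma meets_uniq T (R : T -> T -> T -> Prop) a b c d p q : matroid R ->
  meets R a b c d p -> meets R a b c d q -> p = q.
Proof.
move=> mR [abp cdp nl] [abq cdq _]; apply: contrapT => pq; apply: nl.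
have [ab _ _] := matroid_neq mR abp; have [cd _ _] := matroid_neq mR cdp.
rewrite -(line_eq mR ab pq (rel_line abp) (rel_line abq)).
rewrite (line_eq mR cd pq (rel_line cdp) (rel_line cdq)); exact: line_l.
Qed.

Definition rel_structure T (R : T -> T -> T -> Prop) : structure :=
  @Structure T R (fun a b c d =>
    if pselect (exists p, meets R a b c d p) is left h then projT1 (cid h) else a).

Lemma rel_structure_wedge T (R : T -> T -> T -> Prop) : matroid R ->
  wedge_matroid3 (rel_structure R).
Proof.
move=> mR; split=> [|a b c d p|a b c d]; first exact/matroid_simple.
  move=> /(lines_meet_atP _ _ _ _ _ mR) h /=; case: pselect => [h'|]; last by case; exists p.
  exact: (meets_uniq mR) (projT2 (cid h')) h.
move=> h /=; case: pselect => // -[p hp]; case: h; exists p.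
exact/(lines_meet_atP _ _ _ _ _ mR).
Qed.

Lemma sval_inj T (X : set T) : injective (fun x : {x | X x} => sval x).
Proof.
by move=> [x hx] [y hy] /= e; subst y; congr exist; exact: Prop_irrelevance.
Qed.

Definition set_rel T (R : T -> T -> T -> Prop) (X : set T) (x y z : {x | X x}) : Prop :=
  R (sval x) (sval y) (sval z).

Lemma set_rel_matroid T (R : T -> T -> T -> Prop) (X : set T) : matroid R ->
  matroid (@set_rel T R X).
Proof.
have sI (x y : {x | X x}) : x <> y -> sval x <> sval y by move=> xy /sval_inj.
move=> mR; have [h1 h2 h3] := mR; split=> [a b c /h1[ab ac bc]|a b c /h2//|a b c d] /=.
  by split=> e; subst.
by move=> Rc Rd /sI cd; exact: h3 Rc Rd cd.
Qed.

Section WedgeMatroid.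
Variable M : structure.
Hypothesis wM : wedge_matroid3 M.

Lemma wedge_matroidW : matroid (@Rel M).
Proof. by apply/matroid_simple; case: wM. Qed.

Lemma wedge_meets (a b c d p : M) : meets (@Rel M) a b c d p -> wedge a b c d = p.
Proof. by case: wM => _ h _ /(lines_meet_atP _ _ _ _ _ wedge_matroidW)/h. Qed.

Lemma wedge_cases (a b c d : M) :
  meets (@Rel M) a b c d (wedge a b c d) \/ wedge a b c d = a.
Proof.
have [[p hp]|h] := pselect (exists p, meets (@Rel M) a b c d p).
  by left; rewrite (wedge_meets hp).
right; case: wM => _ _; apply=> -[p hp]; apply: h; exists p.
exact/(lines_meet_atP _ _ _ _ _ wedge_matroidW).
Qed.

Lemma substructureP (S : set M) : substructure S <-> meet_closed (@Rel M) S.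
Proof.
split=> h a b c d; last by move=> Sa Sb Sc Sd; case: (wedge_cases a b c d) => [/h|->] //; exact.
by move=> p Sa Sb Sc Sd /wedge_meets <-; exact: h.
Qed.

End WedgeMatroid.

(** The hypotheses concern only the five points, because [f] is often injective and
    relation-preserving on a finite set alone. *)
Lemma meets_iff T T' (R : T -> T -> T -> Prop) (R' : T' -> T' -> T' -> Prop)
    (f : T -> T') a b c d p :
  (f c = f a -> c = a) -> (f c = f b -> c = b) ->
  (R a b p <-> R' (f a) (f b) (f p)) -> (R c d p <-> R' (f c) (f d) (f p)) ->
  (R a b c <-> R' (f a) (f b) (f c)) ->
  meets R a b c d p <-> meets R' (f a) (f b) (f c) (f d) (f p).
Proof.
move=> ca cb /propext h1 /propext h2 h3; rewrite /meets h1 h2.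
split=> -[? ? nl]; split=> // -[[e|e]|/h3 h]; apply: nl.
- by left; left; exact: ca.
- by left; right; exact: cb.
- by right.
- by left; left; rewrite e.
- by left; right; rewrite e.
- by right.
Qed.

(** Were the image not closed, two lines could acquire a meeting point in [B] while the wedge in [A]
    returned its first argument. *)
Lemma embedding_wedge (A B : structure) (f : A -> B) (X : set A) :
  wedge_matroid3 A -> wedge_matroid3 B -> meet_closed (@Rel A) X ->
  (forall x y, X x -> X y -> f x = f y -> x = y) ->
  (forall x y z, X x -> X y -> X z -> Rel x y z <-> Rel (f x) (f y) (f z)) ->
  meet_closed (@Rel B) (f @` X) ->
  forall a b c d, X a -> X b -> X c -> X d ->
    f (wedge a b c d) = wedge (f a) (f b) (f c) (f d).
Proof.
move=> wA wB cX fI fR cf a b c d Xa Xb Xc Xd.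
have mf p : X p -> meets (@Rel A) a b c d p <-> meets (@Rel B) (f a) (f b) (f c) (f d) (f p).
  by move=> Xp; apply: meets_iff; (try exact: fI); (try exact: fR).
have [[p hp]|h] := pselect (exists p, meets (@Rel A) a b c d p).
  have Xp : X p by exact: cX hp.
  by rewrite (wedge_meets wA hp) (wedge_meets wB (iffLR (mf _ Xp) hp)).
case: (wedge_cases wA a b c d) => [hw|->]; first by case: h; eexists; exact: hw.
case: (wedge_cases wB (f a) (f b) (f c) (f d)) => [hw|-> //].
have [x Xx xe] : (f @` X) (wedge (f a) (f b) (f c) (f d)).
  by apply: cf hw; [exists a|exists b|exists c|exists d].
by case: h; exists x; apply/(mf _ Xx); rewrite xe.
Qed.

Lemma embedding_closed (A B : structure) (f : A -> B) :
  wedge_matroid3 B -> embedding f -> meet_closed (@Rel B) (range f).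
Proof.
move=> wB [fI fR fW] _ _ _ _ p [a _ <-] [b _ <-] [c _ <-] [d _ <-] h.
by exists (wedge a b c d) => //; rewrite fW (wedge_meets wB h).
Qed.

Section Substructure.
Variables (M : structure) (X : set M) (sX : substructure X).

Definition substr : structure :=
  @Structure {x | X x} (fun x y z => Rel (sval x) (sval y) (sval z))
    (fun a b c d => exist _ (wedge (sval a) (sval b) (sval c) (sval d))
       (sX (svalP a) (svalP b) (svalP c) (svalP d))).

Lemma sval_embedding : @embedding substr M (fun x => sval x).
Proof.
by split=> [x y|x y z|a b c d] //; exact: sval_inj.
Qed.

End Substructure.

Lemma gen_substructure (M : structure) (F : set M) : substructure (gen F).
Proof.
move=> a b c d ga gb gc gd Y hY; have [sY _] := hY.
exact: (sY _ _ _ _ (ga Y hY) (gb Y hY) (gc Y hY) (gd Y hY)).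
Qed.

Lemma sub_gen (M : structure) (F : set M) : F `<=` gen F.
Proof. exact: sub_gen_smallest. Qed.

Lemma gen_min (M : structure) (F X : set M) : substructure X -> F `<=` X ->
  gen F `<=` X.
Proof. by move=> sX FX; exact: smallest_sub. Qed.

Lemma gen_id (M : structure) (X : set M) : substructure X -> gen X = X.
Proof.
move=> sX; apply/seteqP; split; last exact: sub_gen.
by apply: gen_min.
Qed.

Lemma age_substr (M : structure) (X : set M) (sX : substructure X) :
  fg_substructure X -> age M (substr sX).
Proof.
move=> [F finF eX]; split; last by exists (fun x => sval x); exact: sval_embedding.
exists [set x : substr sX | F (sval x)].
  apply: (@finite_preimage _ _ F (fun x : substr sX => sval x)) => // x y _ _.
  exact: sval_inj.
apply/seteqP; split=> // -[x Xx] _ Y [sY FY].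
pose Z := [set y : M | exists2 y' : substr sX, Y y' & sval y' = y].
have [] : Z x; last first.
  by move=> y Yy e; have <- : y = exist X x Xx by exact: sval_inj.
have /(_ x) : gen F `<=` Z; last by rewrite -eX; exact.
apply: gen_min => [_ _ _ _ [a Ya <-] [b Yb <-] [c Yc <-] [d Yd <-]|y Fy].
  by exists (@wedge (substr sX) a b c d) => //; exact: sY.
have Xy : X y by rewrite eX; exact: sub_gen.
by exists (exist X y Xy) => //; exact: FY.
Qed.

Section AutLemmas.
Variable M : structure.
Implicit Types g h : aut M.

Lemma autM g h x : (g * h)%g x = g (h x). Proof. by []. Qed.
Lemma aut1 (x : M) : (1%g : aut M) x = x. Proof. by []. Qed.
Lemma autK g x : (g^-1)%g (g x) = x. Proof. exact: sym_funK. Qed.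
Lemma autKV g x : g ((g^-1)%g x) = x. Proof. exact: sym_invK. Qed.
Lemma aut_inj g : injective g. Proof. exact: can_inj (autK g). Qed.

Lemma aut_ext g h : (forall x, g x = h x) -> g = h.
Proof. by move=> e; apply: val_inj; exact: sym_ext. Qed.

Lemma aut_emb g : embedding g.
Proof. by apply/asboolP; exact: aut_embedding. Qed.

Lemma aut_rel g x y z : Rel x y z <-> Rel (g x) (g y) (g z).
Proof. by have [_ h _] := aut_emb g. Qed.

Lemma aut_relW g x y z : Rel x y z -> Rel (g x) (g y) (g z).
Proof. by rewrite -aut_rel. Qed.

Lemma aut_meets g a b c d p :
  meets (@Rel M) a b c d p <-> meets (@Rel M) (g a) (g b) (g c) (g d) (g p).
Proof. by apply: meets_iff; (try exact: aut_inj); exact: aut_rel. Qed.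

Lemma aut_closed g (S : set M) : meet_closed (@Rel M) S ->
  meet_closed (@Rel M) (g @` S).
Proof.
move=> cS _ _ _ _ p [a Sa <-] [b Sb <-] [c Sc <-] [d Sd <-].
rewrite -(autKV g p) => /(iffRL (aut_meets _ _ _ _ _ _)) h.
by exists ((g^-1)%g p) => //; exact: (cS a b c d).
Qed.

(** Surjectivity makes the image closed, so that preserving [Rel] is enough to preserve the
    wedge. *)
Lemma aut_ofP (f f' : M -> M) : wedge_matroid3 M -> cancel f f' -> cancel f' f ->
  (forall x y z, Rel x y z <-> Rel (f x) (f y) (f z)) ->
  exists g : aut M, forall x, g x = f x.
Proof.
move=> wM fK f'K fR.
have fe : embedding (Sym fK f'K).
  have fI := can_inj fK; split=> //= a b c d.
  apply: (@embedding_wedge _ _ f setT) => //; first by move=> x y _ _ /fI.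
  by move=> ? ? ? ? p _ _ _ _ _; exists (f' p).
by exists (Aut (introT (asboolP _) fe)).
Qed.

End AutLemmas.

(** * Fraisse limits of classes of matroids omitting planes *)

Definition K_omits (PP : projective_plane -> Prop) : struct_class := fun N =>
  K_all N /\ forall P, PP P -> omits P (@Rel N) setT.

Lemma omits_planeE P N : omits_plane P N <-> omits P (@Rel N) setT.
Proof.
split=> h [].
  move=> f [fI _ fR]; apply: h; exists (range f), f; split=> //.
  by split=> [x _|x y _ _ /fI|y [x _ <-]] //; exists x.
move=> X [f [[_ fI _] fR]]; apply: h; exists f; split=> // x y; apply: fI; exact: in_setT.
Qed.

Section Limit.
Variables (PP : projective_plane -> Prop) (M : structure).
Hypothesis fM : fraisse_limit (K_omits PP) M.

Lemma limit_gen_K (F : set M) : finite_set F -> K_omits PP (substr (@gen_substructure M F)).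
Proof.
by case: fM => _ _ hK finF; apply/hK; apply: age_substr; exists F.
Qed.

(** Each axiom speaks of at most five points, and the substructure that they generate belongs to the
    age. *)
Lemma limit_wedge : wedge_matroid3 M.
Proof.
have loc (s : seq M) : exists (X : set M) (sX : substructure X),
    [/\ wedge_matroid3 (substr sX) & forall x, x \in s -> X x].
  exists (gen [set` s]), (@gen_substructure M _); split.
    by case: (limit_gen_K (finite_seq s)) => -[].
  by move=> x xs; exact: sub_gen.
have mM : matroid (@Rel M).
  split=> [a b c|a b c|a b c d].
  - have [X [sX [/wedge_matroidW[h _ _] sub]]] := loc [:: a; b; c].
    have [Xa Xb Xc] : [/\ X a, X b & X c] by split; apply: sub; rewrite !inE eqxx ?orbT.
    move=> /(h (exist X a Xa) (exist X b Xb) (exist X c Xc))[ab ac bc].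
    by split=> e; [apply: ab|apply: ac|apply: bc]; exact: sval_inj.
  - have [X [sX [/wedge_matroidW[_ h _] sub]]] := loc [:: a; b; c].
    have [Xa Xb Xc] : [/\ X a, X b & X c] by split; apply: sub; rewrite !inE eqxx ?orbT.
    exact: (h (exist X a Xa) (exist X b Xb) (exist X c Xc)).
  - have [X [sX [/wedge_matroidW[_ _ h] sub]]] := loc [:: a; b; c; d].
    have [Xa Xb Xc Xd] : [/\ X a, X b, X c & X d].
      by split; apply: sub; rewrite !inE eqxx ?orbT.
    move=> Rc Rd cd; apply: (h (exist X a Xa) (exist X b Xb) (exist X c Xc)
      (exist X d Xd) Rc Rd) => e.
    by apply: cd; have := congr1 (fun x => sval x) e.
have sm (X : set M) (sX : substructure X) (a b c d p : substr sX) :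
    meets (@Rel (substr sX)) a b c d p <->
    meets (@Rel M) (sval a) (sval b) (sval c) (sval d) (sval p).
  by apply: meets_iff => //; exact: sval_inj.
split=> [|a b c d p|a b c d]; first exact/matroid_simple.
  move=> /(lines_meet_atP _ _ _ _ _ mM) hp.
  have [X [sX [wX sub]]] := loc [:: a; b; c; d; p].
  have [[Xa Xb] [Xc Xd Xp]] : (X a /\ X b) /\ [/\ X c, X d & X p].
    by split; split; apply: sub; rewrite !inE eqxx ?orbT.
  have := iffRL (sm X sX (exist X a Xa) (exist X b Xb) (exist X c Xc)
      (exist X d Xd) (exist X p Xp)) hp.
  by move=> /(wedge_meets wX)/(congr1 (fun x => sval x)).
move=> h; have [X [sX [wX sub]]] := loc [:: a; b; c; d].
have [Xa Xb Xc Xd] : [/\ X a, X b, X c & X d].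
  by split; apply: sub; rewrite !inE eqxx ?orbT.
case: (wedge_cases wX (exist X a Xa) (exist X b Xb) (exist X c Xc) (exist X d Xd)).
  move=> /sm /= hp; case: h; eexists; apply/(lines_meet_atP _ _ _ _ _ mM); exact: hp.
by move=> /(congr1 (fun x => sval x)).
Qed.

Definition limit_matroid : matroid (@Rel M) := wedge_matroidW limit_wedge.

Lemma limit_gen_finite (F : set M) : finite_set F -> finite_set (gen F).
Proof.
move=> /limit_gen_K[[+ _] _].
move=> /(finite_image (fun x : substr (@gen_substructure M F) => sval x)).
apply: sub_finite_set => x gx.
by exists (exist (gen F) x gx).
Qed.

Lemma limit_locally_finite (s : seq M) :
  exists t : seq M, {subset s <= t} /\ meet_closed (@Rel M) [set` t].
Proof.
have /finite_seqP[t et] := limit_gen_finite (finite_seq s).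
exists t; split=> [x xs|].
  by have : [set` t] x by rewrite -et; exact: sub_gen.
rewrite -et; apply/(substructureP limit_wedge); exact: gen_substructure.
Qed.

Lemma limit_omits P : PP P -> omits P (@Rel M) setT.
Proof.
move=> PPP [f [fI _ fR]].
have [t [st /(substructureP limit_wedge) ct]] := limit_locally_finite [seq f x | x : point P].
have ft x : [set` t] (f x) by apply: st; apply/mapP; exists x => //; rewrite mem_enum.
have fg : fg_substructure [set` t] by exists [set` t] => //; rewrite gen_id.
have := age_substr ct fg; case: fM => _ _ hK /hK[_ /(_ _ PPP)]; apply.
exists (fun x => exist [set` t] (f x) (ft x)); split=> // x y e.
by apply: fI; have := congr1 (fun x => sval x) e.
Qed.

Lemma fgP (X : set M) : fg_substructure X <-> finite_set X /\ meet_closed (@Rel M) X.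
Proof.
split=> [[F finF ->]|[finX /(substructureP limit_wedge) sX]].
  split; first exact: limit_gen_finite.
  by apply/(substructureP limit_wedge); exact: gen_substructure.
by exists X => //; rewrite gen_id.
Qed.

Lemma limit_universal_sig T (R : T -> T -> T -> Prop) (X : set T) : matroid R ->
  finite_set X -> (forall P, PP P -> omits P R X) ->
  exists f : {x | X x} -> M, [/\ injective f,
    forall x y z, R (sval x) (sval y) (sval z) <-> Rel (f x) (f y) (f z) &
    meet_closed (@Rel M) (range f)].
Proof.
move=> mR finX oX; pose N := rel_structure (@set_rel T R X).
have mN := @set_rel_matroid _ _ X mR.
have sI := @sval_inj T X.
have : K_omits PP N.
  split; first (split; last exact: rel_structure_wedge).
    apply: sub_finite_set (@finite_preimage {x | X x} T X (fun x => sval x) _ finX).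
      by move=> [x Xx].
    by move=> x y _ _; exact: sI.
  move=> P /oX; apply: (@omits_image P _ _ _ _ _ _ (fun x : {x | X x} => sval x)) => //.
    by move=> x y _ _; exact: sI.
  by move=> [x Xx].
case: fM => _ _ hK /hK[_ [f ef]]; have [fI fR _] := ef.
by exists f; split=> //; exact: embedding_closed limit_wedge ef.
Qed.

Lemma limit_nonempty : exists x : M, True.
Proof.
have [|||f _] := @limit_universal_sig unit (fun _ _ _ => False) setT.
- by split.
- exact: finite_finset.
- move=> P _ [f [fI _ _]]; have [a [b [c [d [[ab _ _] _ _ _ _]]]]] := plane_quadrangle P.
  by apply: ab; apply: fI; case: (f a); case: (f b).
by exists (f (exist setT tt I)).
Qed.

Lemma limit_universal T (R : T -> T -> T -> Prop) (X : set T) : matroid R ->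
  finite_set X -> (forall P, PP P -> omits P R X) ->
  exists f : T -> M, [/\ forall x y, X x -> X y -> f x = f y -> x = y,
    forall x y z, X x -> X y -> X z -> R x y z <-> Rel (f x) (f y) (f z) &
    meet_closed (@Rel M) (f @` X)].
Proof.
move=> mR finX oX; have [f [fI fR fC]] := limit_universal_sig mR finX oX.
have [m0 _] := limit_nonempty.
pose g x := if pselect (X x) is left h then f (exist X x h) else m0.
have gE x (h : X x) : g x = f (exist X x h).
  by rewrite /g; case: pselect => // h'; congr f; congr exist; exact: Prop_irrelevance.
exists g; split=> [x y hx hy|x y z hx hy hz|].
- by rewrite !gE => /fI e; have := congr1 (fun x => sval x) e.
- by rewrite !gE -fR.
have -> // : g @` X = range f.
apply/seteqP; split=> [_ [x hx <-]|_ [[x hx] _ <-]].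
  by exists (exist X x hx) => //; rewrite gE.
by exists x => //; rewrite gE.
Qed.

Lemma limit_homogeneous (s : seq M) (f : M -> M) :
  meet_closed (@Rel M) [set` s] -> {in s &, injective f} ->
  (forall x y z, x \in s -> y \in s -> z \in s -> Rel x y z <-> Rel (f x) (f y) (f z)) ->
  meet_closed (@Rel M) (f @` [set` s]) ->
  exists g : aut M, forall x, x \in s -> g x = f x.
Proof.
move=> cs fI fR cf; case: fM => _ hom _.
have [||| g hg] := hom [set` s] (f @` [set` s]) f; [exact/fgP| | |by exists g].
  by apply/fgP; split=> //; exact: finite_image.
split=> //.
  by split=> [x xs|x y|y [x xs <-]]; [exists x|rewrite !inE; exact: fI|exists x].
exact: (embedding_wedge limit_wedge limit_wedge cs).
Qed.

(** Universality puts a copy of [X] somewhere in [M], and homogeneity brings the copy of [s] back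
    onto [s]. The last hypothesis, that the image of [s] is closed in [X], is what makes this last
    move a partial isomorphism. *)
Lemma limit_extend (s : seq M) T (R : T -> T -> T -> Prop) (X : set T) (q : M -> T) :
  meet_closed (@Rel M) [set` s] -> matroid R -> finite_set X ->
  (forall P, PP P -> omits P R X) ->
  (forall x, x \in s -> X (q x)) -> {in s &, injective q} ->
  (forall x y z, x \in s -> y \in s -> z \in s -> Rel x y z <-> R (q x) (q y) (q z)) ->
  (forall a b c d p, a \in s -> b \in s -> c \in s -> d \in s -> X p ->
     meets R (q a) (q b) (q c) (q d) p -> exists2 x, x \in s & p = q x) ->
  exists f : T -> M, [/\ forall x y, X x -> X y -> f x = f y -> x = y,
    forall x y z, X x -> X y -> X z -> R x y z <-> Rel (f x) (f y) (f z),
    meet_closed (@Rel M) (f @` X) & forall x, x \in s -> f (q x) = x].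
Proof.
move=> cs mR finX oX qX qI qR qC; have [f [fI fR fC]] := limit_universal mR finX oX.
have mf a b c d p : X a -> X b -> X c -> X d -> X p ->
    meets R a b c d p <-> meets (@Rel M) (f a) (f b) (f c) (f d) (f p).
  by move=> *; apply: meets_iff; (try exact: fI); (try exact: fR).
have [||||g hg] := @limit_homogeneous s (f \o q).
- exact: cs.
- by move=> x y xs ys /= /fI e; apply: qI => //; apply: e; exact: qX.
- by move=> x y z xs ys zs /=; rewrite -fR ?qR //; exact: qX.
- move=> _ _ _ _ p [a sa <-] [b sb <-] [c sc <-] [d sd <-] /= h.
  have [t Xt te] : (f @` X) p.
    by apply: fC h; [exists (q a)|exists (q b)|exists (q c)|exists (q d)] => //; exact: qX.
  subst p; move: h => /mf h.
  have [|x sx e] := qC a b c d t sa sb sc sd Xt; first by apply: h => //; exact: qX.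
  by exists x => //=; rewrite e.
exists (fun x => (g^-1)%g (f x)); split=> [x y Xx Xy|x y z Xx Xy Xz||x xs].
- by move=> /(@aut_inj _ (g^-1)%g)/fI; exact.
- by rewrite -aut_rel -fR.
- by rewrite -(image_comp f (g^-1)%g); exact: aut_closed.
by rewrite -[f (q x)]/((f \o q) x) -hg // autK.
Qed.

End Limit.

(** * The stationary independence relation *)

(** Cut down to [S] because the relations of an amalgam must live inside their own sets. *)
Definition pull_rel T T' (R : T' -> T' -> T' -> Prop) (S : set T) (f : T -> T')
    (u v w : T) : Prop := [/\ S u, S v, S w & R (f u) (f v) (f w)].

Section PullRel.
Variables (T T' : Type) (R : T' -> T' -> T' -> Prop) (S : set T) (f : T -> T').
Hypothesis fI : forall x y, S x -> S y -> f x = f y -> x = y.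

Lemma pull_rel_matroid : matroid R -> matroid (pull_rel R S f).
Proof.
move=> mR; split=> [a b c [Sa Sb Sc h]|a b c [Sa Sb Sc h]|a b c d].
- by have [ab ac bc] := matroid_neq mR h; split=> e; subst.
- by split; split=> //; [exact: matroid_C12|exact: matroid_C23].
move=> [Sa Sb Sc hc] [_ _ Sd hd] cd; split=> //; case: mR => _ _ h; apply: h hc hd _.
by move=> /(fI Sc Sd).
Qed.

Lemma pull_rel_meets a b c d p : S a -> S b -> S c -> S d ->
  meets (pull_rel R S f) a b c d p -> S p /\ meets R (f a) (f b) (f c) (f d) (f p).
Proof.
move=> Sa Sb Sc Sd [[_ _ Sp h1] [_ _ _ h2] nl]; split=> //; split=> // -[[e|e]|h].
- by apply: nl; left; left; exact: fI.
- by apply: nl; left; right; exact: fI.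
- by apply: nl; right.
Qed.

End PullRel.

(** * Free position of two subsets over a third *)

Section Free.
Variable M : structure.

(** The free amalgam seen from inside [M]. The third clause is the content of [am_rel_mixed]: a
    third point on a line joining the two sides forces that line to be spanned in the base. *)
Definition free (D A B : set M) : Prop :=
  [/\ D `&` B `<=` A, meet_closed (@Rel M) (D `|` B) &
   forall a b x, D a -> B b -> ~ A a -> ~ A b -> (D `|` B) x -> Rel a b x ->
     exists c d, [/\ A c, A d, Rel c d a & Rel c d b]].

Lemma free_sym D A B : matroid (@Rel M) -> free D A B -> free B A D.
Proof.
move=> mM [DB cDB mix]; split=> [x [Bx Dx]||a b x Ba Db nAa nAb h Rabx].
- exact: DB.
- by rewrite setUC.
have [||c [d [Ac Ad h1 h2]]] := mix b a x Db Ba nAb nAa.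
- by rewrite setUC.
- exact: matroid_C12.
by exists c, d.
Qed.

Lemma free_aut (g : aut M) D A B : free D A B -> free (g @` D) (g @` A) (g @` B).
Proof.
move=> [DB cDB mix]; split.
- by move=> _ [[x Dx <-] [y By /aut_inj e]]; subst y; exists x => //; exact: DB.
- by rewrite -image_setU; exact: aut_closed.
move=> _ _ z [a Da <-] [b Bb <-] nAa nAb; rewrite -image_setU => -[x DBx <-].
move=> /(iffRL (aut_rel _ _ _ _)) h.
have [||c [d [Ac Ad h1 h2]]] := mix a b x Da Bb _ _ DBx h.
- by move=> Aa; apply: nAa; exists a.
- by move=> Ab; apply: nAb; exists b.
by exists (g c), (g d); split; [exists c|exists d|exact: aut_relW|exact: aut_relW].
Qed.

(** Gives Monotonicity: enlarging the base inside [B] leaves only pairs that were mixed before. *)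
Lemma free_widen D A B A' : A `<=` A' -> A' `<=` B -> free D A B ->
  free (D `|` A') A' B.
Proof.
move=> AA' A'B [DB cDB mix].
have e : D `|` A' `|` B = D `|` B.
  apply/seteqP; split=> x; last by move=> [Dx|Bx]; [left; left|right].
  by move=> [[Dx|/A'B Bx]|Bx]; [left|right|right].
split=> [x [[Dx|//] Bx]||a b x [Da|//] Bb nAa nAb]; rewrite ?e //.
  exact/AA'/DB.
move=> DBx h; have [||c [d [Ac Ad h1 h2]]] := mix a b x Da Bb _ _ DBx h.
- by move=> /AA'.
- by move=> /AA'.
by exists c, d; split=> //; exact: AA'.
Qed.

(** A mixed line is spanned by two points of [A], where [u] and [v] agree; its points on either side
    are therefore sent to one and the same line. *)
Lemma free_glue_rel (D A B : set M) (u v : aut M) (f : M -> M) :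
  matroid (@Rel M) -> A `<=` D -> A `<=` B -> free D A B ->
  (forall x, A x -> u x = v x) -> (forall x, D x -> f x = u x) ->
  (forall x, B x -> f x = v x) ->
  (forall x y, (D `|` B) x -> (D `|` B) y -> f x = f y -> x = y) ->
  forall x y z, (D `|` B) x -> (D `|` B) y -> (D `|` B) z ->
    Rel x y z -> Rel (f x) (f y) (f z).
Proof.
move=> mM AD AB [DB _ mix] uv fD fB fI.
have key a b t : D a -> B b -> ~ A a -> ~ A b -> (D `|` B) t -> Rel a b t ->
    Rel (f a) (f b) (f t).
  move=> Da Bb nAa nAb DBt h; have [c [d [Ac Ad ha hb]]] := mix _ _ _ Da Bb nAa nAb DBt h.
  have [ab at' bt] := matroid_neq mM h; have [cd _ _] := matroid_neq mM ha.
  have [uc ud] : u c <> u d /\ v c <> v d by split=> /aut_inj.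
  have lt : line (@Rel M) c d t.
    by rewrite -(line_eq mM cd ab (rel_line ha) (rel_line hb)); right.
  apply: (line_rel3 mM uc).
  - have [DBa DBb] : (D `|` B) a /\ (D `|` B) b by split; [left|right].
    by split=> e; [apply: ab|apply: at'|apply: bt]; exact: fI e.
  - by rewrite fD //; right; exact: aut_relW.
  - by rewrite fB // (uv c) // (uv d) //; right; exact: aut_relW.
  case: lt => [[->|->]|h']; first by rewrite (fD c (AD _ Ac)); exact: line_l.
    by rewrite (fD d (AD _ Ad)); exact: line_r.
  case: DBt => [Dt|Bt]; first by rewrite fD //; right; exact: aut_relW.
  by rewrite fB // (uv c) // (uv d) //; right; exact: aut_relW.
(* Up to the order of its points, a triple is on one side or contains a mixed pair. *)
have sort3 x y z : (D `|` B) x -> (D `|` B) y -> (D `|` B) z -> Rel x y z ->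
    [\/ D x /\ D y /\ D z, B x /\ B y /\ B z |
     (exists2 p : M * M, [/\ D p.1, B p.2, ~ A p.1 & ~ A p.2] &
      [\/ x = p.1 /\ y = p.2, x = p.2 /\ y = p.1, x = p.1 /\ z = p.2 |
          [\/ x = p.2 /\ z = p.1, y = p.1 /\ z = p.2 | y = p.2 /\ z = p.1]])].
  have cl t : (D `|` B) t -> [\/ A t, D t /\ ~ A t | B t /\ ~ A t].
    have [At|nAt] := pselect (A t); first by move=> _; constructor 1.
    by case=> ?; [constructor 2|constructor 3].
  move=> /cl hx /cl hy /cl hz _.
  case: hx => [hx|[hx nx]|[hx nx]]; case: hy => [hy|[hy ny]|[hy ny]];
  case: hz => [hz|[hz nz]|[hz nz]];
  try (by constructor 1; do !split; auto); try (by constructor 2; do !split; auto);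
  constructor 3;
  first [by exists (x, y); [split|constructor 1] | by exists (y, x); [split|constructor 2]
   | by exists (x, z); [split|constructor 3]
   | by exists (z, x); [split|constructor 4; constructor 1]
   | by exists (y, z); [split|constructor 4; constructor 2]
   | by exists (z, y); [split|constructor 4; constructor 3]].
have C12 := matroid_C12 mM; have C23 := matroid_C23 mM.
move=> x y z DBx DBy DBz h; case: (sort3 _ _ _ DBx DBy DBz h).
- by move=> [? [? ?]]; rewrite !fD //; exact: aut_relW.
- by move=> [? [? ?]]; rewrite !fB //; exact: aut_relW.
move=> [[a b] /= [Da Bb nAa nAb]].
by move=> [[e1 e2]|[e1 e2]|[e1 e2]|[[e1 e2]|[e1 e2]|[e1 e2]]]; subst;
  have k := key a b _ Da Bb nAa nAb; eauto 8.
Qed.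

End Free.

Section Independence.
Variables (PP : projective_plane -> Prop) (M : structure).
Hypothesis fM : fraisse_limit (K_omits PP) M.

Let wM := limit_wedge fM.
Let mM := limit_matroid fM.

(** [free_glue_rel] applies to the union of the maps and also to the union of their inverses, so
    this union is a partial isomorphism, and homogeneity extends it. Stationarity and the gluing of
    tuples of automorphisms both rest on this. *)
Lemma free_glue (D A B : set M) (u v : aut M) :
  finite_set D -> finite_set B -> A `<=` D -> A `<=` B ->
  free D A B -> free (u @` D) (u @` A) (v @` B) -> (forall x, A x -> u x = v x) ->
  exists w : aut M, (forall x, D x -> w x = u x) /\ (forall x, B x -> w x = v x).
Proof.
move=> finD finB AD AB F F' uv.
have [[DB cDB _] [DB' cDB' _]] := conj F F'.
pose f x := if pselect (D x) then u x else v x.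
pose f' x := if pselect ((u @` D) x) then (u^-1)%g x else (v^-1)%g x.
have fD x : D x -> f x = u x by rewrite /f; case: pselect.
have fB x : B x -> f x = v x.
  by move=> Bx; rewrite /f; case: pselect => // Dx; apply: uv; exact: DB.
have f'D x : (u @` D) x -> f' x = (u^-1)%g x by rewrite /f'; case: pselect.
have f'B x : (v @` B) x -> f' x = (v^-1)%g x.
  rewrite /f'; case: pselect => // Dx Bx; have [a Aa ea] := DB' _ (conj Dx Bx).
  by change ((u^-1)%g x = (v^-1)%g x); rewrite -ea autK uv // autK.
have fK x : (D `|` B) x -> f' (f x) = x.
  move=> [Dx|Bx]; first by rewrite fD // f'D ?autK //; exists x.
  by rewrite fB // f'B ?autK //; exists x.
have fI x y : (D `|` B) x -> (D `|` B) y -> f x = f y -> x = y.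
  by move=> hx hy e; rewrite -(fK x) // -(fK y) // e.
have fim : f @` (D `|` B) = u @` D `|` v @` B.
  rewrite image_setU; congr (_ `|` _); apply/seteqP; split=> _ [x hx <-]; exists x => //.
  - by rewrite fD. - by rewrite fD. - by rewrite fB. - by rewrite fB.
have fim' x : (D `|` B) x -> (u @` D `|` v @` B) (f x) by move=> h; rewrite -fim; exists x.
have /finite_seqP[s es] : finite_set (D `|` B) by rewrite finite_setU.
have ins x : (x \in s) = `[< (D `|` B) x >].
  by apply/idP/asboolP; rewrite es.
have [||||w hw] := @limit_homogeneous _ _ fM s f.
- by rewrite -es.
- by move=> x y; rewrite !ins => /asboolP hx /asboolP hy; exact: fI.
- move=> x y z; rewrite !ins => /asboolP hx /asboolP hy /asboolP hz; split.
    exact: (free_glue_rel mM AD AB F uv fD fB fI).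
  have A'D : u @` A `<=` u @` D by move=> _ [t ? <-]; exists t => //; exact: AD.
  have A'B : u @` A `<=` v @` B.
    by move=> _ [t ? <-]; exists t; [exact: AB|rewrite uv].
  move=> h; rewrite -(fK x) // -(fK y) // -(fK z) //.
  apply: (free_glue_rel mM A'D A'B F' (u := (u^-1)%g) (v := (v^-1)%g)) h; (try exact: fim') => //.
  + by move=> _ [t At <-]; rewrite autK uv // autK.
  + by move=> x' y'; rewrite -fim => -[x1 h1 <-] [y1 h2 <-]; rewrite !fK // => ->.
- by rewrite -es fim.
have DBs x : (D `|` B) x -> x \in s by move=> h; rewrite ins; exact/asboolP.
exists w; split=> x hx; first by rewrite hw ?fD //; apply: DBs; left.
by rewrite hw ?fB //; apply: DBs; right.
Qed.

(** The amalgam is built on [M * bool], both relations being pulled back along the first projection,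
    and is embedded in [M] over [D]. Homogeneity then carries [B] onto its copy. *)
Lemma free_exists (D A B : set M) : finite_set D -> finite_set B ->
  meet_closed (@Rel M) D -> meet_closed (@Rel M) B -> meet_closed (@Rel M) A ->
  A `<=` D -> A `<=` B ->
  exists g : aut M, (forall x, A x -> g x = x) /\ free D A (g @` B).
Proof.
move=> finD finB cD cB cA AD AB.
pose X : set (M * bool) := [set t | D t.1 /\ t.2 = false].
(* [B] may meet [D] outside [A]; the flag keeps such points apart. *)
pose iB (x : M) : M * bool := if pselect (A x) then (x, false) else (x, true).
pose Y : set (M * bool) := iB @` B.
have iBA x : A x -> iB x = (x, false) by rewrite /iB; case: pselect.
have iBN x : ~ A x -> iB x = (x, true) by rewrite /iB; case: pselect.
have iB1 x : (iB x).1 = x by rewrite /iB; case: pselect.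
have XI t t' : X t -> X t' -> t.1 = t'.1 -> t = t'.
  by case: t t' => [x b] [x' b'] [/= _ ->] [/= _ ->] ->.
have YI t t' : Y t -> Y t' -> t.1 = t'.1 -> t = t'.
  by move=> [x Bx <-] [y By <-]; rewrite !iB1 => ->.
have XY t : X t -> Y t -> A t.1.
  move=> [_ e] [x Bx ex]; subst t; rewrite iB1; apply: contrapT => nA.
  by rewrite iBN in e.
have AX x : A x -> X (x, false) by move=> Ax; split=> //; exact: AD.
have AY x : A x -> Y (x, false) by move=> Ax; exists x; [exact: AB|rewrite iBA].
pose RX := pull_rel (@Rel M) X fst; pose RY := pull_rel (@Rel M) Y fst.
have XYE t : A t.1 -> X t \/ Y t -> (X `&` Y) t.
  case: t => x b /= Ax [h|h]; split=> //.
  - by have -> : (x, b) = (x, false) by [apply: XI => //; exact: AX]; exact: AY.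
  - by have -> : (x, b) = (x, false) by [apply: YI => //; exact: AY]; exact: AX.
have data : amalgam_data X RX (fun _ : unit => Y) (fun _ => RY).
  split=> //.
  - exact: pull_rel_matroid.
  - by move=> _; exact: pull_rel_matroid.
  - by move=> a b c [].
  - by move=> _ a b c [].
  - by move=> _ a b c Xa Xb Xc Ya Yb Yc; split=> -[_ _ _ h]; split.
  - by move=> [] [].
  - move=> _ a b c d p [Xa Ya] [Xb Yb] [Xc Yc] [Xd Yd].
    move=> /(pull_rel_meets YI Ya Yb Yc Yd)[Yp h]; apply: XYE; last by right.
    by apply: cA h; exact: XY.
  - move=> _ a b c d p [Xa Ya] [Xb Yb] [Xc Yc] [Xd Yd].
    move=> /(pull_rel_meets XI Xa Xb Xc Xd)[Xp h]; apply: XYE; last by left.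
    by apply: cA h; exact: XY.
pose R' := am_rel X RX (fun _ : unit => RY); have mR' := am_rel_matroid data.
pose Z := X `|` [set u | exists i : unit, Y u].
have ZX t : X t -> Z t by left.
have ZY t : Y t -> Z t by move=> h; right; exists tt.
have finZ : finite_set Z.
  rewrite finite_setU; split; last first.
    by apply: sub_finite_set (finite_image iB finB) => t [].
  by apply: sub_finite_set (finite_image (fun x => (x, false)) finD) => -[x b] [/= Dx ->]; exists x.
have oZ P : PP P -> omits P R' Z.
  move=> /(limit_omits fM) oM; apply: (am_omits data).
    apply: (omits_image (g := fst)) oM => // [t t'|x y z Xx Xy Xz].
      by rewrite !inE; exact: XI.
    by split=> [[]|].
  move=> _; apply: (omits_image (g := fst)) oM => // [t t'|x y z Xx Xy Xz].
    by rewrite !inE; exact: YI.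
  by split=> [[]|].
have [s es] := iffLR (finite_seqP _) finD.
have ins x : x \in s -> D x by rewrite es.
have [|||||f [fI fR fC fs]] := @limit_extend _ _ fM s _ R' Z (fun x => (x, false)) _ mR' finZ oZ.
- by rewrite -es.
- by move=> x /ins Dx; apply: ZX.
- by move=> x y _ _ [].
- move=> x y z /ins Dx /ins Dy /ins Dz; have D' t : D t -> X (t, false) by split.
  rewrite /R' (am_rel_X data); [|exact: D'..].
  by split=> [h|[]//]; split=> //; exact: D'.
- move=> a b c d p /ins Da /ins Db /ins Dc /ins Dd Zp h.
  have D' t : D t -> X (t, false) by split.
  have clX : meet_closed RX X.
    by move=> ? ? ? ? ? Xa Xb Xc Xd /(pull_rel_meets XI Xa Xb Xc Xd)[].
  have cl := @am_closed _ _ _ _ _ _ data X set0 (fun _ h => h) clX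
    (fun j (h : set0 j) => match h with end).
  have [[Dp p2]|[j []]] := cl _ _ _ _ _ (or_introl (D' _ Da)) (or_introl (D' _ Db))
    (or_introl (D' _ Dc)) (or_introl (D' _ Dd)) h.
  by exists p.1; [rewrite es in Dp|case: (p) p2 => ? ? /= ->].
have fD x : D x -> f (x, false) = x by rewrite es => /fs.
have mf a b c d p : Z a -> Z b -> Z c -> Z d -> Z p ->
    meets R' a b c d p <-> meets (@Rel M) (f a) (f b) (f c) (f d) (f p).
  by move=> *; apply: meets_iff; (try exact: fI); (try exact: fR).
have ZB x : B x -> Z (iB x) by move=> Bx; apply: ZY; exists x.
have YB x : B x -> Y (iB x) by exists x.
have [sB esB] := iffLR (finite_seqP _) finB.
have insB x : x \in sB -> B x by rewrite esB.
(* Homogeneity can carry [B] onto its copy only because a factor is closed in the amalgam. *)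
have fYC : meet_closed (@Rel M) (f @` Y).
  move=> _ _ _ _ p [a Ya <-] [b Yb <-] [c Yc <-] [d Yd <-] h.
  have [t Zt te] : (f @` Z) p.
    by apply: fC h; [exists a|exists b|exists c|exists d] => //; exact: ZY.
  subst p; have {}h := iffRL (mf _ _ _ _ _ (ZY _ Ya) (ZY _ Yb) (ZY _ Yc) (ZY _ Yd) Zt) h.
  pose X0 := X `&` Y.
  have Y0 y : Y y -> (X0 `|` [set u | exists2 j : unit, setT j & Y u]) y.
    by move=> Yy; right; exists tt.
  have [[_ Yt]|[_ _ Yt]] := @am_closed _ _ _ _ _ _ data X0 setT (@subIsetl _ _ _)
    (@am_clX _ _ _ _ _ _ data tt) (fun j _ => fun _ h => h) _ _ _ _ _ (Y0 _ Ya) (Y0 _ Yb) (Y0 _ Yc)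
    (Y0 _ Yd) h; by exists t.
have [||||g hg] := @limit_homogeneous _ _ fM sB (f \o iB).
- by rewrite -esB.
- move=> x y /insB Bx /insB By /= e.
  by have := fI _ _ (ZB _ Bx) (ZB _ By) e; move=> /(congr1 fst); rewrite !iB1.
- move=> x y z /insB Bx /insB By /insB Bz /=.
  rewrite -fR; [|exact: ZB..].
  rewrite /R' (@am_rel_B _ _ _ _ _ _ data tt); [|exact: YB..].
  split=> [h|[_ _ _]]; last by rewrite !iB1.
  by split; [exact: YB|exact: YB|exact: YB|rewrite !iB1].
- by rewrite -esB -image_comp.
have gB x : B x -> g x = f (iB x) by rewrite esB => /hg.
have gA x : A x -> g x = x by move=> Ax; rewrite (gB _ (AB _ Ax)) iBA // (fD _ (AD _ Ax)).
exists g; split=> //.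
have gBE : g @` B = f @` Y.
  by rewrite /Y image_comp; apply/seteqP; split=> _ [x Bx <-]; exists x => //=; rewrite gB.
have DE : D = f @` X.
  apply/seteqP; split=> [x Dx|_ [[x b] [/= Dx ->] <-]]; last by rewrite fD.
  by exists (x, false); [split|exact: fD].
have YZE : [set u | exists i : unit, Y u] = Y by apply/seteqP; split=> [t []|t] //; exists tt.
split.
- move=> x [Dx [y By]]; rewrite gB // => e.
  have Xx : X (x, false) by split.
  have := fI (iB y) (x, false) (ZB _ By) (ZX _ Xx); rewrite fD // => /(_ e).
  by rewrite /iB; case: pselect => // Ay [<-].
- by rewrite gBE DE -image_setU -YZE.
move=> a _ x Da [b Bb <-] nAa nAb; rewrite gBE DE -image_setU => -[t XYt <-] h.
have nAb' : ~ A b by move=> Ab; apply: nAb; rewrite gA.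
have Zt : Z t by case: XYt; [exact: ZX|exact: ZY].
have Xa : X (a, false) by split.
have {}h : R' (a, false) (iB b) t.
  apply/fR => //; [exact: ZX|exact: ZB|]; by rewrite fD // -gB.
have nYa : ~ Y (a, false) by move=> /(XY _ Xa).
have nXb : ~ X (iB b) by rewrite iBN // => -[].
have [c [d [Xc Xd hb ha _]]] :=
  @am_rel_mixed _ _ _ _ _ _ data tt _ _ _ (YB _ Bb) nXb nYa (matroid_C12 mR' h).
have [Yc Yd _ _] := hb; have [cd cb db] := matroid_neq (am_mB data tt) hb.
have [ca da] : c <> (a, false) /\ d <> (a, false).
  by split=> e; apply: nYa; rewrite -e.
have {}ha := line_rel ca da (am_on_X data Xc Xd cd Xa ha).
have fX t' : X t' -> f t' = t'.1 by case: t' => y e [/= Dy ->]; rewrite fD.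
exists c.1, d.1; split; [exact: XY|exact: XY|by case: ha|].
rewrite -(fX c) // -(fX d) // gB //; apply/fR; (try exact: ZX); first exact: ZB.
by apply/(@am_rel_B _ _ _ _ _ _ data tt) => //; exact: YB.
Qed.

Definition indep (A C B : set M) : Prop := free (gen (A `|` C)) C (gen (B `|` C)).

Lemma gen_aut (g : aut M) (F : set M) : gen (g @` F) = g @` gen F.
Proof.
have sub (h : aut M) (G : set M) : gen (h @` G) `<=` h @` gen G.
  apply: gen_min; last by move=> _ [x Gx <-]; exists x => //; exact: sub_gen.
  move=> _ _ _ _ [a Ga <-] [b Gb <-] [c Gc <-] [d Gd <-].
  have [_ _ hW] := aut_emb h; rewrite -hW; exists (wedge a b c d) => //.
  exact: gen_substructure.
apply/seteqP; split=> [|_ [x Gx <-]]; first exact: sub.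
have /(_ x) : gen F `<=` (g^-1)%g @` gen (g @` F).
  have {1}-> : F = (g^-1)%g @` (g @` F).
    rewrite image_comp; apply/seteqP; split=> y; last by move=> [z Fz <-]; rewrite /comp autK.
    by move=> Fy; exists y => //; rewrite /comp autK.
  exact: sub.
by move=> /(_ Gx)[y gy <-]; rewrite autKV.
Qed.

Lemma gen_closed (F : set M) : meet_closed (@Rel M) (gen F).
Proof. by apply/(substructureP wM); exact: gen_substructure. Qed.

Lemma fg_gen2 (A B : set M) : fg_substructure A -> fg_substructure B ->
  finite_set (gen (A `|` B)).
Proof.
move=> /(fgP fM)[fA _] /(fgP fM)[fB _]; apply: (limit_gen_finite fM).
by rewrite finite_setU.
Qed.

Lemma subUgen (A C : set M) : C `<=` gen (A `|` C).
Proof. by move=> x Cx; apply: sub_gen; right. Qed.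

Lemma indep_stationary : stationary_independence indep.
Proof.
split.
- move=> g A B C _ _ _; rewrite /indep -!image_setU !gen_aut; exact: free_aut.
- by move=> A B C _ _ _; exact: free_sym.
- move=> A B C D _ _ _ _; rewrite /indep => F F'.
  have CF : C `<=` gen (B `|` C) by exact: subUgen.
  (* By [F'] the union on the right is closed, hence nothing more is generated. *)
  have eA : gen (A `|` gen (B `|` C)) = gen (A `|` C) `|` gen (B `|` C).
    apply/seteqP; split.
      apply: gen_min; first by apply/(substructureP wM); case: F'.
      by move=> x [Ax|h]; [left; apply: sub_gen; left|right].
    move=> x [|h]; last by apply: sub_gen; right.
    apply: gen_min; first exact: gen_substructure.
    by move=> y [Ay|/CF Fy]; apply: sub_gen; [left|right].
  have eE : gen (D `|` gen (B `|` C)) = gen (gen (B `|` D) `|` C).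
    apply/seteqP; split; apply: gen_min; (try exact: gen_substructure) => x.
      move=> [Dx|]; first by apply: sub_gen; left; apply: sub_gen; right.
      apply: gen_min; first exact: gen_substructure.
      by move=> y [By|Cy]; apply: sub_gen; [left; apply: sub_gen; left|right].
    move=> [|/CF Cx]; last by apply: sub_gen; right.
    apply: gen_min; first exact: gen_substructure.
    by move=> y [By|Dy]; apply: sub_gen; [right; apply: sub_gen; left|left].
  rewrite eA eE; apply: free_widen F => //.
  by rewrite -eE; move=> x h; apply: sub_gen; right.
- move=> I a B C fa fB fC.
  have [|||||||g [gB gF]] := @free_exists (gen (C `|` B)) B (gen (range a `|` B));
    (try exact: fg_gen2); (try exact: gen_closed); (try exact: subUgen).
    by case/(fgP fM): fB.
  exists (g \o a); split.
    exists (g^-1)%g; split=> [x Bx|i]; last exact: autK.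
    by rewrite -{1}(gB x) // autK.
  rewrite /indep; have -> : range (g \o a) `|` B = g @` (range a `|` B).
    rewrite image_setU image_comp; congr (_ `|` _); apply/seteqP; split=> x.
      by move=> Bx; exists x => //; exact: gB.
    by move=> [y By <-]; rewrite gB.
  by rewrite gen_aut; exact: free_sym.
move=> I a a' B C fa fa' fB fC [g [gC ga]] F F'.
have E : gen (range a' `|` C) = g @` gen (range a `|` C).
  rewrite -gen_aut image_setU; congr gen; congr (_ `|` _); apply/seteqP; split=> x.
  - by move=> [i _ <-]; exists (a i); [exists i|exact: ga].
  - by move=> [_ [i _ <-] <-]; exists i.
  - by move=> Cx; exists x => //; exact: gC.
  - by move=> [y Cy <-]; rewrite gC.
have gCE : g @` C = C.
  by apply/seteqP; split=> [_ [x Cx <-]|x Cx]; [rewrite gC|exists x => //; exact: gC].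
have [||||||| w [wa wB]] := @free_glue (gen (range a `|` C)) C (gen (B `|` C)) g 1%g;
  (try exact: fg_gen2); (try exact: subUgen) => //.
- rewrite -E gCE; have -> // : (1%g : aut M) @` gen (B `|` C) = gen (B `|` C).
  by apply/seteqP; split=> [_ [x h <-]|x h]; [|exists x].
exists w; split=> [x|i]; first exact: wB.
by rewrite wa // ; apply: sub_gen; left; exists i.
Qed.

End Independence.

(** * Generic tuples of automorphisms *)

Lemma chain_mono S (D : nat -> set S) m k x :
  (forall m x, D m x -> D m.+1 x) -> m <= k -> D m x -> D k x.
Proof.
by move=> Dm /subnK <- Dx; elim: (k - m)%N => [//|j]; rewrite addSn; exact: Dm.
Qed.

Lemma chain_limit S T (f : nat -> S -> T) (D : nat -> set S) :
  (forall m x, D m x -> D m.+1 x) -> (forall m x, D m x -> f m.+1 x = f m x) ->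
  exists f' : S -> T, forall m x, D m x -> f' x = f m x.
Proof.
move=> Dm fm.
have fk m k x : m <= k -> D m x -> f k x = f m x.
  move=> /subnK <- Dx; elim: (k - m)%N => [//|j IH]; rewrite addSn fm //.
  by apply: chain_mono Dx => //; exact: leq_addl.
exists (fun x => if pselect (exists m, D m x) is left h then f (projT1 (cid h)) x else f 0 x).
move=> m x Dx; case: pselect => [h|]; last by case; exists m.
case: (cid h) => k /= Dk; have [mk|/ltnW km] := leqP m k; first exact: fk.
by rewrite (fk _ _ _ km Dk).
Qed.

(** * Limits of automorphisms, Baire category and generic tuples *)

Section Approximation.
Variable M : structure.
Hypothesis wM : wedge_matroid3 M.
Implicit Types (g : aut M) (s t : seq M).

Definition agree s (g h : aut M) : Prop := forall x, x \in s -> g x = h x.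

Definition flat s : Prop := meet_closed (@Rel M) [set` s].

Lemma set_map g s : [set` map g s] = g @` [set` s].
Proof.
apply/seteqP; split=> [x /mapP[y ys ->]|_ [y ys <-]]; first by exists y.
exact: map_f.
Qed.

Lemma flat_map g s : flat s -> flat (map g s).
Proof. by rewrite /flat set_map; exact: aut_closed. Qed.

Lemma mem_map_aut g s x : (g x \in map g s) = (x \in s).
Proof. by rewrite mem_map //; exact: aut_inj. Qed.

(** The covering hypothesis on images makes the limit surjective; without it one would only get an
    embedding. *)
Lemma aut_limit (g : nat -> aut M) (D : nat -> seq M) :
  (forall m, {subset D m <= D m.+1}) -> (forall m, agree (D m) (g m.+1) (g m)) ->
  (forall x, exists m, x \in D m) -> (forall y, exists m, y \in map (g m) (D m)) ->
  exists g' : aut M, forall m, agree (D m) g' (g m).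
Proof.
move=> Dm gm cov cov'.
have [f fE] := chain_limit (f := g) (D := fun m => [set` D m]) Dm gm.
have mono m k x : m <= k -> x \in D m -> x \in D k.
  exact: (@chain_mono _ (fun m => [set` D m])).
have cov2 x y : exists m, x \in D m /\ y \in D m.
  have [[m xm] [k yk]] := conj (cov x) (cov y); exists (maxn m k).
  by split; [apply: mono xm; exact: leq_maxl|apply: mono yk; exact: leq_maxr].
have cov3 x y z : exists m, [/\ x \in D m, y \in D m & z \in D m].
  have [[m [xm ym]] [k zk]] := conj (cov2 x y) (cov z); exists (maxn m k).
  by split; [apply: mono xm; exact: leq_maxl|apply: mono ym; exact: leq_maxl|
             apply: mono zk; exact: leq_maxr].
have fI : injective f.
  by move=> x y; have [m [xm ym]] := cov2 x y; rewrite !(fE m) //; exact: aut_inj.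
have /choice[f' fK] : forall y, exists x, f x = y.
  by move=> y; have [m /mapP[x xm ->]] := cov' y; exists x; exact: fE.
have [|||g' g'E] := @aut_ofP M f f' wM.
- by move=> x; apply: fI; rewrite fK.
- exact: fK.
- by move=> x y z; have [m [xm ym zm]] := cov3 x y z; rewrite !(fE m) //; exact: aut_rel.
by exists g' => m x xm; rewrite g'E; exact: fE.
Qed.

Definition near I s (h k : I -> aut M) : Prop := forall i, agree s (k i) (h i).

(** Open and dense sets are handled through agreement on finite lists; the actual topology enters
    only with [copen_open] and [cdense_dense]. *)
Definition copen I (U : set (I -> aut M)) : Prop :=
  forall h, U h -> exists s, forall k, near s h k -> U k.

Definition cdense I (U : set (I -> aut M)) : Prop :=
  forall h s, exists2 k, near s h k & U k.

Lemma baire (e : nat -> M) (I : finType) (U : nat -> set (I -> aut M)) :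
  (forall x, exists n, e n = x) -> (forall n, copen (U n) /\ cdense (U n)) ->
  forall h s, exists2 k, near s h k & forall n, U n k.
Proof.
move=> eS UU h0 s0.
have step (p : nat * ((I -> aut M) * seq M)) : exists q : (I -> aut M) * seq M,
    [/\ near p.2.2 p.2.1 q.1, {subset p.2.2 <= q.2}, forall k, near q.2 q.1 k -> U p.1 k,
      e p.1 \in q.2 & forall i, e p.1 \in map (q.1 i) q.2].
  case: p => n [h s] /=; have [oU dU] := UU n.
  have [k hk Uk] := dU h s; have [t tU] := oU _ Uk.
  (* Adding [e n] and its preimages under all [k i] makes the limit maps total and onto. *)
  exists (k, e n :: [seq ((k i)^-1)%g (e n) | i : I] ++ s ++ t); split=> //.
  - by move=> x xs; rewrite inE !mem_cat xs !orbT.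
  - move=> l kl; apply: tU => i x xt; apply: kl.
    by rewrite inE !mem_cat xt !orbT.
  - by rewrite inE eqxx.
  move=> i; apply/mapP; exists (((k i)^-1)%g (e n)); last exact/esym/autKV.
  by rewrite inE mem_cat; apply/orP; right; apply/orP; left;
    apply/mapP; exists i; rewrite ?mem_enum.
have [F FP] := choice step.
pose st := fix st n := if n is m.+1 then F (m, st m) else (h0, s0).
have stP n := FP (n, st n).
have stm n : {subset (st n).2 <= (st n.+1).2} by have [] := stP n.
have stc n : near (st n).2 (st n).1 (st n.+1).1 by have [] := stP n.
have lim i : exists g, forall m, agree (st m).2 g ((st m).1 i).
  apply: (@aut_limit (fun m => (st m).1 i)) => // [m|x|y].
  - exact: stc.
  - by have [n <-] := eS x; exists n.+1; have [] := stP n.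
  - by have [n <-] := eS y; exists n.+1; have [_ _ _ _ +] := stP n; apply.
have [k kP] := choice lim; exists k => [i|n]; first exact: (kP i 0).
have [_ _ + _ _] := stP n; apply=> i; exact: (kP i n.+1).
Qed.

Definition invariant_under I (h : I -> aut M) s : Prop := forall i x, x \in s -> h i x \in s.

(* [(M, h)] is the Fraisse limit of the finite substructures of [M] with an [I]-tuple
   of automorphisms. *)
Definition generic I (h : I -> aut M) : Prop :=
  (forall s, exists t, [/\ {subset s <= t}, flat t & invariant_under h t]) /\
  forall (A B : seq M) (f : I -> aut M), {subset A <= B} -> flat A -> flat B ->
    invariant_under f A -> invariant_under f B -> near A f h ->
    exists2 e : aut M, agree A e 1%g & forall i b, b \in B -> h i (e b) = e (f i b).

(** The tuple [h] on [D'] is transported by [g] to a tuple extending [k] on the image of [D]; the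
    extension property of [k] realizes it, and [g] is corrected by the resulting [e]. *)
Lemma generic_forth I (h k : I -> aut M) (D : seq M) (g : aut M) s :
  generic h -> generic k -> flat D -> invariant_under h D ->
  (forall i x, x \in D -> g (h i x) = k i (g x)) ->
  exists (D' : seq M) (g' : aut M), [/\ {subset D <= D'}, {subset s <= D'}, flat D',
    invariant_under h D' & agree D g' g /\
    forall i x, x \in D' -> g' (h i x) = k i (g' x)].
Proof.
move=> [ah _] [_ bk] cD iD gD.
have [D' [sD' cD' iD']] := ah (D ++ s).
have sD : {subset D <= D'} by move=> x xD; apply: sD'; rewrite mem_cat xD.
pose f i := (g * h i * g^-1)%g.
have fE i x : f i (g x) = g (h i x) by rewrite /f !autM autK.
have fi E : invariant_under h E -> invariant_under f (map g E).
  by move=> iE i _ /mapP[x xE ->]; rewrite fE mem_map_aut; exact: iE.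
have [|||||| e eA eB] := bk (map g D) (map g D') f.
- by move=> _ /mapP[x xD ->]; rewrite mem_map_aut; exact: sD.
- exact: flat_map.
- exact: flat_map.
- exact: fi.
- exact: fi.
- by move=> i _ /mapP[x xD ->]; rewrite fE gD.
exists D', (e * g)%g; split=> //; first by move=> x xs; apply: sD'; rewrite mem_cat xs orbT.
split=> [x xD|i x xD]; first by rewrite autM eA ?mem_map_aut // aut1.
by rewrite !autM eB ?mem_map_aut // fE.
Qed.

(** That the conjugator fixes [A] pointwise is what lets [generic_split] produce conjugators close
    to the identity. *)
Lemma generic_conj (e : nat -> M) I (h k : I -> aut M) (A : seq M) :
  (forall x, exists n, e n = x) ->
  generic h -> generic k -> flat A -> invariant_under h A -> near A h k ->
  exists2 g : aut M, agree A g 1%g & forall i, (g * h i * g^-1)%g = k i.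
Proof.
move=> eS gh gk cA iA hk.
pose good (p : seq M * aut M) := [/\ flat p.1, invariant_under h p.1 &
  forall i x, x \in p.1 -> p.2 (h i x) = k i (p.2 x)].
have step (p : nat * (seq M * aut M)) : exists q : seq M * aut M, good p.2 ->
    [/\ good q, {subset p.2.1 <= q.1}, agree p.2.1 q.2 p.2.2, e p.1 \in q.1 &
        e p.1 \in map q.2 q.1].
  have [|ng] := pselect (good p.2); last by exists p.2.
  case: p => n [D g] /= gp; have [cD iD gD] := gp; move: cD iD gD => /= cD iD gD.
  have [D1 [g1 [sD1 en1 cD1 iD1 [ag1 gD1]]]] := generic_forth [:: e n] gh gk cD iD gD.
  have iK : invariant_under k (map g1 D1).
    by move=> i _ /mapP[x xD ->]; rewrite -gD1 // mem_map_aut; exact: iD1.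
  have gK i x : x \in map g1 D1 -> (g1^-1)%g (k i x) = h i ((g1^-1)%g x).
    by move=> /mapP[y yD ->]; rewrite -gD1 // !autK.
  have [D2 [g2 [sD2 en2 cD2 iD2 [ag2 gD2]]]] :=
    generic_forth [:: e n] gk gh (flat_map (g := g1) cD1) iK gK.
  have D12 x : x \in D1 -> x = g2 (g1 x) /\ g1 x \in D2.
    move=> xD; have xm : g1 x \in map g1 D1 by rewrite mem_map_aut.
    by split; [rewrite ag2 // autK|exact: sD2].
  (* The second extension runs from [k] to [h]; the new map is its inverse, defined on its image. *)
  exists (map g2 D2, (g2^-1)%g) => _; rewrite /good; cbn [fst snd]; split=> //.
  - split; first exact: flat_map.
      by move=> i _ /mapP[x xD ->]; rewrite -gD2 // mem_map_aut; exact: iD2.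
    by move=> i _ /mapP[x xD ->]; rewrite -gD2 // !autK.
  - by move=> x /sD1/D12[e1 m1]; rewrite e1 mem_map_aut.
  - move=> x xD; have [e1 _] := D12 _ (sD1 _ xD).
    by rewrite {1}e1 autK ag1.
  - by have [|e1 m1] := D12 (e n); [apply: en1; rewrite inE|rewrite e1 mem_map_aut].
  - rewrite -map_comp; apply/mapP; exists (e n); last by rewrite /= sym_funK.
    by apply: en2; rewrite inE.
have [F FP] := choice step.
pose st := fix st n := if n is m.+1 then F (m, st m) else (A, 1%g : aut M).
have stg n : good (st n).
  elim: n => [|n IH]; last by have [] := FP (n, st n) IH.
  by split=> //= i x xA; rewrite hk.
have stP n := FP (n, st n) (stg n).
have [||||g gP] := @aut_limit (fun n => (st n).2) (fun n => (st n).1).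
- by move=> n; have [] := stP n.
- by move=> n; have [] := stP n.
- by move=> x; have [n <-] := eS x; exists n.+1; have [] := stP n.
- by move=> x; have [n <-] := eS x; exists n.+1; have [] := stP n.
exists g => [|i]; first exact: (gP 0).
apply: aut_ext => y; rewrite -{2}(autKV g y) !autM; move: ((g^-1)%g y) => x.
have [n en] := eS x; have [[_ iD gD] _ _ xD _] := stP n.
rewrite /= en in xD; rewrite (gP n.+1 x) // (gP n.+1 (h i x)); last exact: iD.
exact: gD.
Qed.

End Approximation.

(** * Generic extensions of a generic tuple are comeager *)

Section GenericLimit.
Variables (PP : projective_plane -> Prop) (M : structure).
Hypothesis fM : fraisse_limit (K_omits PP) M.

Let wM := limit_wedge fM.

Lemma limit_enum : exists e : nat -> M, forall x, exists n, e n = x.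
Proof.
have [m0 _] := limit_nonempty fM; case: fM => /countable_injP[f fI] _ _.
exists (fun n => if pselect (exists x, f x = n) is left h then projT1 (cid h) else m0).
move=> x; exists (f x); case: pselect => [h|]; last by case; exists x.
by apply: fI; rewrite ?inE //; case: (cid h).
Qed.

Lemma invariant_image (g : aut M) (s : seq M) : (forall x, x \in s -> g x \in s) ->
  g @` [set` s] = [set` s].
Proof.
move=> gs; apply/seteqP; split=> [_ [x xs <-]|y ys]; first exact: gs.
have us : uniq (map g (undup s)) by rewrite map_inj_uniq ?undup_uniq //; exact: aut_inj.
have sub : {subset map g (undup s) <= undup s}.
  by move=> _ /mapP[x + ->]; rewrite !mem_undup; exact: gs.
have [|_ e] := uniq_min_size us sub; first by rewrite size_map.
have : y \in map g (undup s) by rewrite e mem_undup.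
by move=> /mapP[x + ->]; rewrite mem_undup => xs; exists x.
Qed.

(** One finite [B] extends all partial isomorphisms of [D], so the family indexed by [K] is
    arbitrary. A copy of [B] is placed in [M] over [D], and homogeneity extends the automorphisms of
    that copy to [M]. *)
Lemma eppa_limit (K : Type) (D : seq M) (u : K -> aut M) (S : K -> seq M) :
  EPPA (age M) -> flat D -> (forall k, {subset S k <= D}) -> (forall k, flat (S k)) ->
  (forall k x, x \in S k -> u k x \in D) ->
  exists (C : seq M) (w : K -> aut M), [/\ {subset D <= C}, flat C,
    invariant_under w C & forall k, agree (S k) (w k) (u k)].
Proof.
move=> eppa cD SD cS uD.
have sD : substructure [set` D] by apply/(substructureP wM).
have fgD : fg_substructure [set` D] by apply/(fgP fM).
have [B [e [KB eE ext]]] := eppa _ (age_substr sD fgD).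
pose A := substr sD.
have /choice[g gE] : forall k, exists g : aut B, forall x y : A, sval x \in S k ->
    sval y = u k (sval x) -> g (e x) = e y.
  move=> k; pose X := [set x : A | sval x \in S k].
  pose f (x : A) : A := if pselect ([set` D] (u k (sval x))) is left h then
    exist [set` D] _ h else x.
  have fE x : X x -> sval (f x) = u k (sval x).
    by move=> Xx; rewrite /f; case: pselect => // h; case: h; exact: uD.
  have sX : substructure X.
    have /(substructureP wM) sS := cS k; move=> a b c d; exact: sS.
  have [_ _ uW] := aut_emb (u k).
  have fW a b c d : X a -> X b -> X c -> X d ->
      f (wedge a b c d) = wedge (f a) (f b) (f c) (f d).
    move=> Xa Xb Xc Xd; apply: sval_inj; rewrite fE; last exact: sX.
    by rewrite [LHS]uW -!fE.
  have [||h hE] := ext X (f @` X) f sX.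
  - move=> _ _ _ _ [a Xa <-] [b Xb <-] [c Xc <-] [d Xd <-].
    by rewrite -fW //; exists (wedge a b c d) => //; exact: sX.
  - split=> //; last first.
      by move=> x y z Xx Xy Xz; rewrite /= !fE //; exact: aut_rel.
    split=> [x Xx|x y|_ [x Xx <-]]; [by exists x| |by exists x].
    rewrite !inE => Xx Xy /(congr1 (fun t : A => sval t)); rewrite !fE // => /aut_inj.
    exact: sval_inj.
  exists h => x y Xx ey; rewrite hE //; congr e; apply: sval_inj.
  by rewrite fE // ey.
have [[finB wB] oB] : K_omits PP B by case: fM => _ _ hK; apply/hK.
have [f [fI fR fC]] := limit_universal fM (wedge_matroidW wB) finB oB.
have mf a b c d p : meets (@Rel B) a b c d p <->
    meets (@Rel M) (f a) (f b) (f c) (f d) (f p).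
  by apply: meets_iff; (try exact: fI); (try exact: fR).
pose F x := if pselect ([set` D] x) is left h then f (e (exist [set` D] x h)) else x.
have FE (x : A) : F (sval x) = f (e x).
  rewrite /F; case: pselect => [h|]; last by case; exact: (svalP x).
  by congr (f (e _)); exact: sval_inj.
have inD x (h : x \in D) : F x = f (e (exist [set` D] x h)).
  exact: (FE (exist [set` D] x h)).
have [eI eR eW] := eE.
have [||||c cE] := @limit_homogeneous _ _ fM D F.
- exact: cD.
- move=> x y xD yD; rewrite !inD => /(fI _ _ I I)/eI.
  by move=> /(congr1 (fun t : A => sval t)).
- by move=> x y z xD yD zD; rewrite !inD -fR // -eR.
- have -> : F @` [set` D] = f @` range e.
    apply/seteqP; split=> [_ [x xD <-]|_ [_ [x _ <-] <-]].
      exists (e (exist [set` D] x xD)); last by rewrite inD.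
      by exists (exist [set` D] x xD).
    by exists (sval x); [exact: (svalP x)|rewrite FE].
  move=> _ _ _ _ p [a ea <-] [b eb <-] [a' ea' <-] [b' eb' <-] h.
  have [t _ te] : (f @` setT) p by apply: fC h; [exists a|exists b|exists a'|exists b'].
  subst p; exists t => //.
  exact: (embedding_closed wB eE) ea eb ea' eb' (iffRL (mf _ _ _ _ _) h).
pose phi b := (c^-1)%g (f b).
have phiI b b' : phi b = phi b' -> b = b' by move=> /(@aut_inj _ (c^-1)%g)/fI; exact.
have phiR x y z : Rel x y z <-> Rel (phi x) (phi y) (phi z).
  by rewrite /phi -aut_rel -fR.
have phie (x : A) : phi (e x) = sval x.
  rewrite /phi -FE -cE ?autK //; exact: (svalP x).
have [C CE] := iffLR (finite_seqP _) (finite_image phi finB).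
have Cphi b : phi b \in C by have : [set` C] (phi b) by rewrite -CE; exists b.
have cC : flat C.
  by rewrite /flat -CE -(image_comp f (c^-1)%g); exact: aut_closed.
have /choice[w wE] : forall k, exists w : aut M, forall b, w (phi b) = phi (g k b).
  move=> k; pose W y := if pselect (exists b, phi b = y) is left h then
    phi (g k (projT1 (cid h))) else y.
  have WE b : W (phi b) = phi (g k b).
    rewrite /W; case: pselect => [h|]; last by case; exists b.
    by case: (cid h) => b' /= /phiI ->.
  have inC y : y \in C -> exists b, y = phi b.
    move=> yC; have : [set` C] y by []; rewrite -CE => -[b _ <-]; by exists b.
  have [||||w wE] := @limit_homogeneous _ _ fM C W.
  - exact: cC.
  - by move=> x y /inC[b ->] /inC[b' ->]; rewrite !WE => /phiI/aut_inj ->.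
  - move=> x y z /inC[b1 ->] /inC[b2 ->] /inC[b3 ->].
    by rewrite !WE -!phiR; exact: aut_rel.
  - suff -> : W @` [set` C] = [set` C] by exact: cC.
    apply/seteqP; split=> [_ [y /inC[b ->] <-]|y /inC[b ->]]; first by rewrite WE; exact: Cphi.
    by exists (phi ((g k)^-1%g b)); [exact: Cphi|rewrite WE autKV].
  by exists w => b; rewrite wE // WE.
exists C, w; split=> //.
- by move=> x xD; rewrite -[x]/(sval (exist [set` D] x xD)) -phie.
- move=> k y yC; have : [set` C] y by []; rewrite -CE => -[b _ <-].
  by rewrite wE.
move=> k x xS; have [xD uxD] := conj (SD k _ xS) (uD k _ xS).
pose x' : A := exist [set` D] x xD; pose y' : A := exist [set` D] _ uxD.
by rewrite -[x in LHS](phie x') wE (gE k x' y') // phie.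
Qed.

Definition cat_aut I J (x : I -> aut M) (y : J -> aut M) (o : I + J) : aut M :=
  match o with inl i => x i | inr j => y j end.

Section Extend.
Variables (I J : finType) (x : I -> aut M).
Hypotheses (eppa : EPPA (age M)) (gx : generic x).

Definition gen_closure (s : seq M) : set (J -> aut M) :=
  [set y | exists t, [/\ {subset s <= t}, flat t & invariant_under (cat_aut x y) t]].

(** [D] is closed under [x] and contains the values of [y] on [t]. EPPA gives a finite [C] on which
    the maps extend to automorphisms; genericity of [x] then moves [C] over [D] to a place where its
    [I]-part is [x] itself, and the [J]-part is carried along by conjugation. *)
Lemma gen_closure_dense s : cdense (gen_closure s).
Proof.
move=> y F; have [ax bx] := gx.
have [t [Ft ct]] := limit_locally_finite fM F.
have [D [sD cD iD]] := ax (s ++ t ++ flatten [seq map (y j) t | j : J]).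
have tD : {subset t <= D} by move=> z zt; apply: sD; rewrite !mem_cat zt orbT.
have ytD j z : z \in t -> y j z \in D.
  move=> zt; apply: sD; rewrite !mem_cat; apply/orP; right; apply/orP; right.
  apply/flattenP; exists (map (y j) t); first by apply/mapP; exists j; rewrite ?mem_enum.
  exact: map_f.
have [|||C [w [DC cC iC wE]]] := @eppa_limit (I + J) D (cat_aut x y)
    (fun o => if o is inl _ then D else t) eppa cD.
- by move=> [i|j] z //; exact: tD.
- by case.
- by move=> [i|j] z; [exact: iD|exact: ytD].
have [|||e eD eC] := bx D C (w \o inl) DC cD cC.
- by move=> i z zD; rewrite /comp (wE (inl i)) //; exact: iD.
- by move=> i; exact: iC.
- by move=> i z zD; rewrite /comp (wE (inl i)).
have {}eD z : z \in D -> e z = z by exact: eD.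
have eVD z : z \in D -> (e^-1)%g z = z by move=> zD; rewrite -{1}(eD z) // autK.
exists (fun j => (e * w (inr j) * e^-1)%g) => [j z zF|].
  rewrite !autM eVD; last exact/tD/Ft.
  by rewrite (wE (inr j)) ?eD //; [exact/ytD/Ft|exact: Ft].
exists (map e C); split.
- move=> z zs; have zD : z \in D by apply: sD; rewrite mem_cat zs.
  by rewrite -(eD z) // mem_map_aut; exact: DC.
- exact: flat_map.
move=> [i|j] _ /mapP[z zC ->] /=; first by rewrite eC // mem_map_aut; exact: iC.
by rewrite sym_funK; apply: map_f; exact: iC.
Qed.

Lemma gen_closure_open s : copen (gen_closure s).
Proof.
move=> y [t [st ct it]]; exists t => k yk; exists t; split=> // -[i|j] z zt.
  exact: (it (inl i)).
by rewrite /= yk //; exact: (it (inr j)).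
Qed.

(** One instance of the extension property. Only the values of [f] on [B] count; recording them in
    the lists [F o] leaves countably many instances. *)
Definition gen_extension (A B : seq M) (F : I + J -> seq M) : set (J -> aut M) :=
  [set y | forall f : I + J -> aut M, (forall o, map (f o) B = F o) ->
    {subset A <= B} -> flat A -> flat B ->
    invariant_under f A -> invariant_under f B -> near A f (cat_aut x y) ->
    exists2 e : aut M, agree A e 1%g &
      forall o b, b \in B -> cat_aut x y o (e b) = e (f o b)].

Lemma gen_extension_open A B F : copen (gen_extension A B F).
Proof.
move=> y Uy.
have [[f [fF AB cA [cB iA] [iB fA]]]|h] := pselect (exists f : I + J -> aut M,
  [/\ forall o, map (f o) B = F o, {subset A <= B}, flat A, flat B /\
    invariant_under f A & invariant_under f B /\ near A f (cat_aut x y)]); last first.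
  exists A => k yk f fF AB cA cB iA iB fA; case: h; exists f; do !split=> //.
  by move=> [i|j] z zA; [exact: (fA (inl i))|rewrite /= -yk //; exact: (fA (inr j))].
have [e eA eB] := Uy f fF AB cA cB iA iB fA.
exists (map e B) => k yk f' f'F _ _ _ _ _ _; exists e => // o b bB.
have -> : f' o b = f o b.
  have /eq_in_map : map (f' o) B = map (f o) B by rewrite f'F fF.
  exact.
rewrite -eB //; case: o => [i //|j] /=; apply: yk; exact: map_f.
Qed.

(** After [y] is changed so that a finite [D] containing [A] is invariant, [B] is put in free
    position to [D] over [A], and the tuples on the two sides are glued. Genericity of [x] realizes
    the result over [D], so [y] changes only outside [D]. *)
Lemma gen_extension_dense A B F : cdense (gen_extension A B F).
Proof.
move=> y s; have [ax bx] := gx.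
have [y1 yy1 [D [sD cD iD]]] := gen_closure_dense (s ++ A) y s.
have [[f [fF AB cA [cB iA] [iB fA]]]|h] := pselect (exists f : I + J -> aut M,
  [/\ forall o, map (f o) B = F o, {subset A <= B}, flat A, flat B /\
    invariant_under f A & invariant_under f B /\ near A f (cat_aut x y1)]); last first.
  by exists y1 => // f fF AB cA cB iA iB fA; case: h; exists f; do !split.
have AD : {subset A <= D} by move=> z zA; apply: sD; rewrite mem_cat zA orbT.
have [g [gA Fr]] := free_exists fM (finite_seq D) (finite_seq B) cD cB cA AD AB.
pose f' o := (g * f o * g^-1)%g.
have f'E o z : f' o (g z) = g (f o z) by rewrite /f' !autM autK.
have f'B o : f' o @` (g @` [set` B]) = g @` [set` B].
  rewrite -set_map; apply: invariant_image => _ /mapP[z zB ->].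
  by rewrite f'E mem_map_aut; exact: iB.
have f'A o z : z \in A -> f' o z = f o z.
  by move=> zA; rewrite -{1}(gA z) // f'E gA //; exact: iA.
have /choice[w wE] : forall o, exists w : aut M,
    (forall z, z \in D -> w z = cat_aut x y1 o z) /\
    forall z, z \in B -> w (g z) = g (f o z).
  move=> o; have [|||||||w [wD wB]] := @free_glue _ _ fM [set` D] [set` A] (g @` [set` B])
      (cat_aut x y1 o) (f' o) => //.
  - exact: finite_image.
  - by move=> z zA; exists z; [exact: AB|exact: gA].
  - rewrite f'B (invariant_image (iD o)).
    suff -> : cat_aut x y1 o @` [set` A] = [set` A] by [].
    by apply: invariant_image => z zA; rewrite fA //; exact: iA.
  - by move=> z zA; rewrite f'A // fA.
  by exists w; split=> // z zB; rewrite wB ?f'E //; exists z.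
pose C := D ++ map g B.
have CE : [set` C] = [set` D] `|` g @` [set` B].
  rewrite -set_map; apply/seteqP; split=> z /=; rewrite /C mem_cat; first by move/orP.
  by move=> h; apply/orP.
have iC : invariant_under w C.
  move=> o z; rewrite /C !mem_cat => /orP[zD|/mapP[b bB ->]]; have [wD wB] := wE o.
    by rewrite wD // iD.
  by rewrite wB // mem_map_aut iB ?orbT.
have [||||||e eD eC] := bx D C (w \o inl) => //.
- by move=> z zD; rewrite mem_cat zD.
- by rewrite /flat CE; case: Fr.
- by move=> i z zD; have [wD _] := wE (inl i); rewrite /comp wD //; exact: (iD (inl i)).
- by move=> i; exact: iC.
- by move=> i z zD; have [wD _] := wE (inl i); rewrite /comp wD.
have {}eD z : z \in D -> e z = z by exact: eD.
have eVD z : z \in D -> (e^-1)%g z = z by move=> zD; rewrite -{1}(eD z) // autK.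
pose y' j := (e * w (inr j) * e^-1)%g.
have y'D j z : z \in D -> y' j z = y1 j z.
  move=> zD; have [wD _] := wE (inr j).
  by rewrite /y' !autM eVD // wD // eD //; exact: (iD (inr j)).
exists y' => [j z zs|].
  rewrite y'D; first exact: yy1.
  by apply: sD; rewrite mem_cat zs.
move=> f2 f2F _ _ _ _ _ _; exists (e * g)%g => [z zA|o b bB].
  by rewrite autM gA // eD //; exact: AD.
have -> : f2 o b = f o b.
  have /eq_in_map : map (f2 o) B = map (f o) B by rewrite f2F fF.
  exact.
have gbC : g b \in C by rewrite mem_cat mem_map_aut bB orbT.
have [_ wB] := wE o; rewrite !autM -wB //.
by case: o wB => [i|j] wB; rewrite /cat_aut; [rewrite eC|rewrite /y' !autM autK].
Qed.

Lemma generic_comeager : exists U : nat -> set (J -> aut M),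
  (forall n, copen (U n) /\ cdense (U n)) /\
  forall y, (forall n, U n y) -> generic (cat_aut x y).
Proof.
have [e eS] := limit_enum; have [e' eK] := choice eS.
pose code : countType := (seq nat + seq nat * seq nat * {ffun I + J -> seq nat})%type.
pose V (c : code) : set (J -> aut M) := match c with
  | inl s => gen_closure (map e s)
  | inr (a, b, F) => gen_extension (map e a) (map e b) (fun o => map e (F o)) end.
pose U n := if unpickle n is Some c then V c else setT.
have UV c y : (forall n, U n y) -> V c y by move=> /(_ (pickle c)); rewrite /U pickleK.
have eKs (s : seq M) : map e (map e' s) = s.
  by rewrite -map_comp -[RHS]map_id; apply: eq_map => z /=.
exists U; split=> [n|y Uy].
  rewrite /U; case: unpickle => [[s|[[a b] F]]|]; first by
      split; [exact: gen_closure_open|exact: gen_closure_dense].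
    by split; [exact: gen_extension_open|exact: gen_extension_dense].
  by split=> [h _|h s]; [exists [::]|exists h].
split=> [s|A B f AB cA cB iA iB fA].
  by have := UV (inl (map e' s)) y Uy; rewrite /V eKs.
have := UV (inr (map e' A, map e' B, [ffun o => map e' (map (f o) B)])) y Uy.
rewrite /V !eKs; apply=> // o; by rewrite ffunE eKs.
Qed.

End Extend.

Lemma generic_void (x : void -> aut M) : generic x.
Proof.
split=> [s|A B f _ _ _ _ _ _]; last by exists 1%g => [z|[]].
have [t [st ct]] := limit_locally_finite fM s.
by exists t; split=> // -[].
Qed.

End GenericLimit.

(** * Ample generics and the small index property *)

Lemma prod_topology_cvg (I : Type) (T : I -> topologicalType)
    (F : set_system (prod_topology T)) (h : prod_topology T) : Filter F ->
  (forall i (A : set (T i)), nbhs (h i) A -> F [set k | A (k i)]) -> F --> h.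
Proof.
move=> FF hF; apply/cvg_sup => i A /=.
move=> [B [[V oV eB] Bh] BA]; apply: (@filterS _ F FF B) => //.
rewrite -eB in Bh *; apply: (hF i V); exact: open_nbhs_nbhs.
Qed.

(** * Pointwise convergence in terms of finite lists *)

Section AutTopology.
Variable M : structure.

Lemma agree_catl (s t : seq M) (g h : aut M) : agree (s ++ t) g h -> agree s g h.
Proof. by move=> a x xs; apply: a; rewrite mem_cat xs. Qed.

Lemma agree_catr (s t : seq M) (g h : aut M) : agree (s ++ t) g h -> agree t g h.
Proof. by move=> a x xs; apply: a; rewrite mem_cat xs orbT. Qed.

Lemma nbhs_agree (g : aut M) (s : seq M) : nbhs g [set k : aut M | agree s k g].
Proof.
elim: s => [|x s IH]; first by apply: filterS filterT => k _ x.
have : nbhs g [set k : aut M | k x = g x].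
  have H : nbhs (@aut_eval M g) [set k : prod_topology (fun _ : M => discrete_topology M) |
      k x = g x].
    apply: (@proj_continuous M (fun _ => discrete_topology M) x (@aut_eval M g) [set g x]).
    exact: (@discrete_set1 (discrete_topology M)).
  exact: (@initial_continuous _ _ (@aut_eval M) g _ H).
move=> /filterI /(_ IH); apply: filterS => k [kx ks] y; rewrite inE => /orP[/eqP ->//|].
exact: ks.
Qed.

Lemma agree_nbhs (g : aut M) (A : set (aut M)) : nbhs g A ->
  exists s : seq M, forall k : aut M, agree s k g -> A k.
Proof.
rewrite nbhsE => -[B [[V oV <-] Vg] BA].
pose F : set_system (prod_topology (fun _ : M => discrete_topology M)) :=
  [set W | exists s : seq M, forall k : M -> M, (forall x, x \in s -> k x = g x) -> W k].
have FF : Filter F.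
  split=> [|P Q [s sP] [t tQ]|P Q PQ [s sP]]; first by exists [::].
    exists (s ++ t) => k kst; split; [apply: sP|apply: tQ] => x xs; apply: kst;
    by rewrite mem_cat xs ?orbT.
  by exists s => k /sP/PQ.
have : F V.
  have cF : F --> (@aut_eval M g).
    apply: prod_topology_cvg => x U /nbhs_singleton Ux; exists [:: x] => k kx.
    by rewrite /= kx ?inE.
  by apply: cF; exact: open_nbhs_nbhs.
by move=> [s sV]; exists s => k ks; apply: BA; exact: sV.
Qed.

Lemma agree_open (U : set (aut M)) :
  (forall g, U g -> exists s : seq M, forall k, agree s k g -> U k) -> open U.
Proof.
by move=> h; rewrite openE => g /h[s sU]; apply: filterS (nbhs_agree g s) => k /sU.
Qed.

Section Prod.
Variable I : finType.
Let G := prod_topology (fun _ : I => aut M).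

Lemma copen_open (U : set G) : copen U -> open U.
Proof.
move=> oU; rewrite openE => h /oU[s sU].
have H : nbhs h [set k : G | forall i, agree s (k i) (h i)].
  apply: (@filter_forall G I (fun i k => agree s (k i) (h i)) _ (@nbhs_filter G h)) => i.
  exact: (@proj_continuous I (fun _ => aut M) i h _ (nbhs_agree (h i) s)).
by apply: filterS H => k ks; apply: sU.
Qed.

Lemma cdense_dense (U : set G) : cdense U -> dense U.
Proof.
move=> dU O [h Oh] oO.
pose F : set_system G := [set W | exists s : seq M, forall k, near s h k -> W k].
have FF : Filter F.
  split=> [|P Q [s sP] [t tQ]|P Q PQ [s sP]]; first by exists [::].
    exists (s ++ t) => k kst; split; [apply: sP|apply: tQ] => i x xs; apply: kst;
    by rewrite mem_cat xs ?orbT.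
  by exists s => k /sP/PQ.
have [s sO] : F O.
  have cF : F --> h.
    apply: prod_topology_cvg => i A /agree_nbhs[s sA]; exists s => k hk.
    exact: sA (hk i).
  by apply: cF; exact: open_nbhs_nbhs.
by have [k hk Uk] := dU h s; exists k; split=> //; exact: sO.
Qed.

End Prod.
End AutTopology.

Section Ample.
Variables (PP : projective_plane -> Prop) (M : structure).
Hypothesis fM : fraisse_limit (K_omits PP) M.
Hypothesis eppa : EPPA (age M).

Let wM := limit_wedge fM.

Lemma limit_ample : ample_generics (aut M).
Proof.
move=> n _; have [e eS] := limit_enum fM.
pose x0 (i : void) : aut M := match i with end.
have [U [UP Ug]] := generic_comeager fM 'I_n eppa (generic_void fM x0).
have [h _ hU] := baire wM eS UP (fun _ => 1%g) [::].
exists h, U; split=> [m|k kU].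
  by have [o d] := UP m; split; [exact: copen_open|exact: cdense_dense].
have [|||||g _ gE] := @generic_conj M wM e _ (cat_aut x0 h) (cat_aut x0 k) [::] eS.
- exact: Ug.
- by apply: Ug => m; exact: kU.
- by [].
- by [].
- by [].
by exists g => i; have := gE (inr i).
Qed.

End Ample.

Section Subgroup.
Variables (G : groupType) (H : set G).
Hypothesis sH : subgroup H.

Lemma subgroupV x : H x -> H (x^-1)%g.
Proof. by case: sH => H1 HD Hx; rewrite -(monoid.mul1g (x^-1)%g); exact: HD. Qed.

Lemma subgroupM x y : H x -> H y -> H (x * y)%g.
Proof.
by case: sH => H1 HD Hx Hy; rewrite -(monoid.invgK y); apply: HD => //; exact: subgroupV.
Qed.

Lemma perfect_index (k : (nat -> bool) -> G) :
  (forall a b, a <> b -> ~ H ((k a)^-1 * k b)%g) ->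
  ([set: set nat] #<= left_cosets H)%card.
Proof.
move=> kH; pose c (X : set nat) n := `[< X n >].
have [|f] := iffRL (@injfunPex _ _ [set: set nat] (left_cosets H)); last exact: inj_card_le f.
exists (fun X => [set (k (c X) * h)%g | h in H]); first by move=> X _; exists (k (c X)).
move=> X Y _ _ e; apply: contrapT => XY.
have cXY : c X <> c Y.
  move=> E; apply: XY; apply/seteqP; split=> n hn; apply/asboolP.
    by rewrite -[`[< _ >]]/(c Y n) -E; exact/asboolP.
  by rewrite -[`[< _ >]]/(c X n) E; exact/asboolP.
apply: (kH _ _ cXY); have [H1 _] := sH.
have : [set (k (c X) * h)%g | h in H] (k (c Y)).
  by rewrite e; exists 1%g => //; rewrite monoid.mulg1.
by move=> [h Hh <-]; rewrite monoid.mulKg.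
Qed.

End Subgroup.

(** * The small index property *)

Section SmallIndex.
Variables (PP : projective_plane -> Prop) (M : structure).
Hypothesis fM : fraisse_limit (K_omits PP) M.
Hypothesis eppa : EPPA (age M).

Let wM := limit_wedge fM.
Implicit Types (U : nat -> set (aut M)) (H : set (aut M)).

Definition gopen (U : set (aut M)) : Prop :=
  forall g, U g -> exists s : seq M, forall k, agree s k g -> U k.

Definition gdense (U : set (aut M)) : Prop :=
  forall g (s : seq M), exists2 k, agree s k g & U k.

Definition gcomeager U : Prop := forall n, gopen (U n) /\ gdense (U n).

Lemma gbaire U : gcomeager U ->
  forall g s, exists2 k, agree s k g & forall n, U n k.
Proof.
move=> cU g s; have [e eS] := limit_enum fM.
have [|k ks kU] := @baire _ wM e _ (fun n => [set h : unit -> aut M | U n (h tt)]) eS _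
    (fun _ => g) s; last by exists (k tt) => //; exact: ks.
move=> n; have [oU dU] := cU n; split=> [h /oU[t tU]|h t].
  by exists t => k hk; apply: tU; exact: hk.
by have [k ks kU] := dU (h tt) t; exists (fun _ => k) => // -[].
Qed.

Lemma agree_trans (s : seq M) (g h k : aut M) : agree s g h -> agree s h k -> agree s g k.
Proof. by move=> gh hk x xs; rewrite gh // hk. Qed.

Lemma agree_sub (s t : seq M) (g h : aut M) : {subset s <= t} -> agree t g h -> agree s g h.
Proof. by move=> st gh x xs; apply: gh; exact: st. Qed.

(** One level of a Mycielski construction: the pairs are treated one at a time, [g t] being replaced
    by [g s * w] with [w] in [U j] close to the old quotient. *)
Lemma separate_pairs U (L : seq (seq bool * seq bool * nat)) (g : seq bool -> aut M)
    (F : seq M) : gcomeager U ->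
  exists (g' : seq bool -> aut M) (F' : seq M), [/\ {subset F <= F'},
    forall s, agree F (g' s) (g s) &
    forall s t j, (s, t, j) \in L -> s <> t -> forall u v : aut M,
      agree F' u (g' s) -> agree F' v (g' t) -> U j (u^-1 * v)%g].
Proof.
move=> cU; elim: L => [|[[s t] j] L [g1 [F1 [FF1 gg1 sep]]]]; first by exists g, F; split.
have [st|st] := pselect (s = t).
  exists g1, F1; split=> // s' t' j'; rewrite inE => /orP[/eqP[-> -> _]|]; first by [].
  exact: sep.
have [oU dU] := cU j; have [w ws wU] := dU ((g1 s)^-1 * g1 t)%g F1.
have [F0 F0U] := oU _ wU; pose v1 := (g1 s * w)%g.
pose g2 r := if r == t then v1 else g1 r.
have g2s : g2 s = g1 s by rewrite /g2; case: eqP.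
have g2t : g2 t = v1 by rewrite /g2 eqxx.
have g2F r : agree F1 (g2 r) (g1 r).
  move=> x xF; rewrite /g2; case: eqP => [->|//].
  by rewrite /v1 autM ws // autM autKV.
(* Agreement on [F0] for [v] and on [map w F0] for [u] ensures that the quotient of [u] and [v]
   agrees with [w] on [F0]. *)
exists g2, (F1 ++ F0 ++ map w F0); split.
- by move=> x /FF1 xF; rewrite mem_cat xF.
- by move=> r; apply: agree_trans (gg1 r); apply: agree_sub (g2F r).
move=> s' t' j'; rewrite inE => /orP[/eqP[-> -> ->] _|inL st'] u v.
  rewrite g2s g2t => /agree_catr/agree_catr us /agree_catr/agree_catl vt; apply: F0U => x xF.
  rewrite autM vt // /v1 autM -us ?autK //; exact: map_f.
move=> /agree_catl us /agree_catl vt; apply: sep inL st' _ _ _ _.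
  exact: agree_trans us (g2F _).
exact: agree_trans vt (g2F _).
Qed.

(** Automorphisms are indexed by finite binary words, and level [n] puts the quotients of distinct
    words of length [n.+1] into [U 0], ..., [U n]. Two branches that differ once differ at all later
    levels, so every [U j] is reached. *)
Lemma perfect_set U : gcomeager U -> exists k : (nat -> bool) -> aut M,
  forall a b, a <> b -> forall j, U j ((k a)^-1 * k b)%g.
Proof.
move=> cU; have [e eS] := limit_enum fM.
pose bs n : seq (seq bool) := [seq tval t | t <- enum {: n.-tuple bool}].
have bsP n s : size s = n -> s \in bs n.
  move=> /eqP sn; apply/mapP; exists (Tuple sn) => //; exact: mem_enum.
pose L n := [seq (p, j) | p <- [seq (s, t) | s <- bs n.+1, t <- bs n.+1], j <- iota 0 n.+1].
have step (p : nat * ((seq bool -> aut M) * seq M)) :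
    exists q : (seq bool -> aut M) * seq M,
    [/\ {subset p.2.2 <= q.2}, forall s, agree p.2.2 (q.1 s) (p.2.1 (take p.1 s)),
      forall s t j, (s, t, j) \in L p.1 -> s <> t -> forall u v : aut M,
        agree q.2 u (q.1 s) -> agree q.2 v (q.1 t) -> U j (u^-1 * v)%g,
      e p.1 \in q.2 & forall s, size s = p.1.+1 -> e p.1 \in map (q.1 s) q.2].
  case: p => n [g F]; cbn [fst snd].
  have [g' [F' [FF' gg' sep]]] := separate_pairs (L n) (fun s => g (take n s)) F cU.
  exists (g', F' ++ e n :: [seq ((g' s)^-1)%g (e n) | s <- bs n.+1]); cbn [fst snd].
  split=> //.
  - by move=> x /FF' xF; rewrite mem_cat xF.
  - move=> s t j inL st u v /agree_catl us /agree_catl vt; exact: sep inL st _ _ us vt.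
  - by rewrite mem_cat inE eqxx orbT.
  move=> s /bsP sb; apply/mapP; exists (((g' s)^-1)%g (e n)); last exact/esym/autKV.
  rewrite mem_cat inE; apply/orP; right; apply/orP; right.
  exact: (map_f (fun s => ((g' s)^-1)%g (e n))).
have [F FP] := choice step.
pose st := fix st n :=
  if n is m.+1 then F (m, st m) else ((fun _ => 1%g) : seq bool -> aut M, [::]).
have stP n := FP (n, st n).
have take_mk (a : nat -> bool) n : take n (mkseq a n.+1) = mkseq a n.
  by rewrite /mkseq -map_take take_iota; congr map; congr iota; apply/minn_idPl.
have lim a : exists g : aut M, forall n, agree (st n).2 g ((st n).1 (mkseq a n)).
  apply: (@aut_limit M wM (fun n => (st n).1 (mkseq a n))) => [n|n|x|x].
  - by have [] := stP n.
  - have [_ h _ _ _] := stP n; have := h (mkseq a n.+1).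
    by rewrite [(n, st n).1]/= take_mk.
  - by have [n <-] := eS x; exists n.+1; have [] := stP n.
  - have [n <-] := eS x; exists n.+1; have [_ _ _ _ h] := stP n.
    by apply: h; rewrite size_mkseq.
have [k kP] := choice lim; exists k => a b ab j.
have [i abi] : exists i, a i <> b i.
  apply: contrapT => h; apply: ab; apply/funext => i.
  by apply: contrapT => abi; apply: h; exists i.
pose n := maxn i j; have [_ _ sep _ _] := stP n.
apply: (sep (mkseq a n.+1) (mkseq b n.+1) j) => //.
- apply: allpairs_f; last by rewrite mem_iota /= ltnS leq_maxr.
  by apply: allpairs_f; apply: bsP; rewrite size_mkseq.
- move=> E; apply: abi; have := congr1 (fun s => nth false s i) E.
  by rewrite !nth_mkseq // ltnS leq_maxl.
- exact: (kP a n.+1).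
- exact: (kP b n.+1).
Qed.

(** If [H] avoided the intersection of the [U n], the quotients of a perfect set would all lie
    outside [H] and yield continuum many cosets. *)
Lemma small_index_meets U H : gcomeager U -> subgroup H ->
  ~ ([set: set nat] #<= left_cosets H)%card -> exists2 g, H g & forall n, U n g.
Proof.
move=> cU sH; apply: contra_notP => h; have [k kU] := perfect_set cU.
apply: (perfect_index (k := k) sH) => a b ab Hab; apply: h.
by exists ((k a)^-1 * k b)%g => // n; exact: kU.
Qed.

(* Pettis: if [H] contains a comeager part of a coset of the stabilizer of [A], then
   it contains that stabilizer. *)
Lemma not_open_meets U H : gcomeager U -> subgroup H -> ~ open H ->
  forall y (A : seq M), exists z, [/\ agree A z y, ~ H z & forall n, U n z].
Proof.
move=> cU sH nH y A; apply: contrapT => h; apply: nH.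
have AH z : agree A z y -> (forall n, U n z) -> H z.
  by move=> zy zU; apply: contrapT => nz; apply: h; exists z.
suff stab u : agree A u 1%g -> H u.
  apply: agree_open => g Hg; exists A => k kg.
  rewrite -(monoid.mulVKg g k); apply: (subgroupM sH) => //; apply: stab => x xA.
  by rewrite autM kg // autK.
move=> uA.
(* Even terms put the conditions on [z], odd terms put them on [z * u]. *)
pose V n : set (aut M) := if odd n then [set z | U n./2 (z * u)%g] else U n./2.
have cV : gcomeager V.
  move=> n; rewrite /V; have [oU dU] := cU n./2; case: odd => //; split=> [z /= /oU[s sU]|z s].
    exists (map u s) => k kz; apply: sU => x xs; rewrite !autM; apply: kz; exact: map_f.
  have [w wz wU] := dU (z * u)%g (map (u^-1)%g s).
  exists (w * u^-1)%g => [x xs|]; last by rewrite /= monoid.mulgVK.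
  by rewrite autM wz ?map_f // autM autKV.
have [z zy zV] := gbaire cV y A.
have Hz : H z by apply: AH => // n; have := zV n.*2; rewrite /V odd_double doubleK.
have Hzu : H (z * u)%g.
  apply: AH => [x xA|n]; first by rewrite autM uA // aut1 zy.
  by have := zV n.*2.+1; rewrite /V /= odd_double uphalf_double.
by rewrite -(monoid.mulKg z u); apply: (subgroupM sH) => //; exact: (subgroupV sH).
Qed.

(** Small index gives a generic [y0] inside [H], and non-openness a generic [y1] outside [H] that
    agrees with it on a closed invariant list containing [F]. The two extended tuples are therefore
    conjugate by an [h] fixing [F] and commuting with [x]. *)
Lemma generic_split H (I : finType) (x : I -> aut M) (F : seq M) :
  subgroup H -> ~ ([set: set nat] #<= left_cosets H)%card -> ~ open H -> generic x ->
  exists t : aut M * aut M * aut M, let: (y0, y1, h) := t in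
    [/\ H y0, ~ H y1, generic (cat_aut x (fun _ : unit => y0)) /\
       generic (cat_aut x (fun _ : unit => y1)), agree F h 1%g &
      (forall i, h * x i = x i * h)%g /\ (h * y1 = y0 * h)%g].
Proof.
move=> sH iH nH gx; have [V [VP Vg]] := generic_comeager fM unit eppa gx.
have [e eS] := limit_enum fM.
pose U n : set (aut M) := [set g | V n (fun _ => g)].
have eta (y : unit -> aut M) : y = fun _ => y tt by apply/funext => -[].
have cU : gcomeager U.
  move=> n; have [oV dV] := VP n; split=> [g /= /oV[s sV]|g s].
    by exists s => k ks; apply: sV.
  by have [k ks kV] := dV (fun _ => g) s; exists (k tt); [exact: ks|rewrite /U /= -eta].
have [y0 Hy0 Uy0] := small_index_meets cU sH iH; have gy0 := Vg _ Uy0.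
have [A [FA cA iA]] := gy0.1 F.
have [y1 [y1A nHy1 Uy1]] := not_open_meets cU sH nH y0 A; have gy1 := Vg _ Uy1.
have [||g gA gE] := generic_conj wM eS gy1 gy0 cA.
- by move=> [i|j] z zA /=; [exact: (iA (inl i))|rewrite y1A //; exact: (iA (inr j))].
- by move=> [i|j] z zA //=; rewrite y1A.
exists (y0, y1, g); split=> //; first exact: agree_sub gA.
split=> [i|]; last by have := gE (inr tt) => /= <-; rewrite monoid.mulgVK.
by have := gE (inl i) => /= {2}<-; rewrite monoid.mulgVK.
Qed.

(** An index set of [n] elements in the shape that [cat_aut] produces, so that each level extends
    the previous one by a single coordinate. *)
Fixpoint idx n : finType := if n is m.+1 then (idx m + unit)%type else void.

(** A node carries a tuple [x] and a partial conjugator [g]. One branch adjoins [y0] and keeps [g];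
    the other adjoins [y1] and passes to [g * h]. Where the branches [a] and [b] separate, [k a]
    conjugates [y0] to the same element as [k b] does [y1]; so their quotient conjugates a
    non-member of [H] to a member and is not in [H]. *)
Lemma limit_small_index : small_index_property (aut M).
Proof.
move=> H sH [_ iH]; apply: contrapT => nH; apply: iH; apply: contrapT => iH.
have [e eS] := limit_enum fM.
have split_ex n (x : idx n -> aut M) (F : seq M) : exists t : aut M * aut M * aut M,
    generic x -> let: (y0, y1, h) := t in
    [/\ H y0, ~ H y1, generic (cat_aut x (fun _ : unit => y0)) /\
       generic (cat_aut x (fun _ : unit => y1)), agree F h 1%g &
      (forall i, h * x i = x i * h)%g /\ (h * y1 = y0 * h)%g].
  have [gx|] := pselect (generic x); last by exists (1%g, 1%g, 1%g).
  by have [t tP] := generic_split F sH iH nH gx; exists t.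
pose T n x F := projT1 (cid (@split_ex n x F)).
have TP n x F : generic x -> let: (y0, y1, h) := T n x F in
    [/\ H y0, ~ H y1, generic (cat_aut x (fun _ : unit => y0)) /\
       generic (cat_aut x (fun _ : unit => y1)), agree F h 1%g &
      (forall i, h * x i = x i * h)%g /\ (h * y1 = y0 * h)%g].
  exact: projT2 (cid (@split_ex n x F)).
pose ext (F : seq M) (g : aut M) n : seq M := e n :: (g^-1)%g (e n) :: F.
pose st (a : nat -> bool) := fix st n : (idx n -> aut M) * aut M * seq M :=
  match n return (idx n -> aut M) * aut M * seq M with
  | 0 => ((fun i : void => match i with end), 1%g, [::])
  | m.+1 => let: (x, g, F) := st m in let: (y0, y1, h) := T m x F in
      if a m then (cat_aut x (fun _ : unit => y1), g * h, ext F (g * h)%g m)%g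
      else (cat_aut x (fun _ : unit => y0), g, ext F g m) end.
have gst a n : generic (st a n).1.1.
  elim: n => [|n] /=; first exact: (generic_void fM).
  case: (st a n) => [[x g] F] /= gx; have := TP n x F gx.
  by case: (T n x F) => [[y0 y1] h] [_ _ [g0 g1] _ _]; case: (a n).
have st_F a n : [/\ {subset (st a n).2 <= (st a n.+1).2},
    agree (st a n).2 (st a n.+1).1.2 (st a n).1.2, e n \in (st a n.+1).2 &
    e n \in map (st a n.+1).1.2 (st a n.+1).2].
  have := gst a n => /=; case: (st a n) => [[x g] F] /= gx; have := TP n x F gx.
  case: (T n x F) => [[y0 y1] h] [_ _ _ hF _].
  have extP k : [/\ {subset F <= ext F k n}, e n \in ext F k n & e n \in map k (ext F k n)].
    split; first by move=> z zF; rewrite !inE zF !orbT.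
      by rewrite inE eqxx.
    apply/mapP; exists ((k^-1)%g (e n)); last exact/esym/autKV.
    by rewrite !inE eqxx orbT.
  case: (a n); cbn [fst snd]; first by have [? ? ?] := extP (g * h)%g;
    split=> // z zF; rewrite autM hF.
  by have [? ? ?] := extP g; split.
(* The new factor [h] commutes with the coordinates already present, so their conjugates by the
   partial conjugator are final. *)
have st_conj a n y : (exists i, (st a n).1.1 i = y) ->
    (exists i, (st a n.+1).1.1 i = y) /\
    ((st a n.+1).1.2 * y * (st a n.+1).1.2^-1 =
     (st a n).1.2 * y * (st a n).1.2^-1)%g.
  have := gst a n => /=; case: (st a n) => [[x g] F] /= gx; have := TP n x F gx.
  case: (T n x F) => [[y0 y1] h] [_ _ _ _ [hx _]] [i <-].
  case: (a n) => /=; split; try by exists (inl i).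
    rewrite -(monoid.mulgA g h) hx monoid.invgM !monoid.mulgA.
    by rewrite monoid.mulgK.
  by [].
have lim a : exists k : aut M, forall n, agree (st a n).2 k (st a n).1.2.
  apply: (@aut_limit M wM (fun n => (st a n).1.2)) => [n|n|z|z].
  - by have [] := st_F a n.
  - by have [] := st_F a n.
  - by have [n <-] := eS z; exists n.+1; have [] := st_F a n.
  - by have [n <-] := eS z; exists n.+1; have [] := st_F a n.
have [k kP] := choice lim.
have mono a m n z : m <= n -> z \in (st a m).2 -> z \in (st a n).2.
  apply: (@chain_mono _ (fun n => [set` (st a n).2])) => n' z' /=.
  by have [h _ _ _] := st_F a n'; exact: h.
have k_conj a n y : (exists i, (st a n).1.1 i = y) ->
    (k a * y = (st a n).1.2 * y * (st a n).1.2^-1 * k a)%g.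
  move=> yn; apply: aut_ext => z.
  have conj_n m : n <= m -> (exists i, (st a m).1.1 i = y) /\
      ((st a m).1.2 * y * (st a m).1.2^-1 = (st a n).1.2 * y * (st a n).1.2^-1)%g.
    move=> /subnK <-; elim: (m - n)%N => [//|j [IH1 IH2]]; rewrite addSn.
    by have [h1 h2] := st_conj _ _ _ IH1; rewrite h2.
  have [[m1 e1] [m2 e2]] := conj (eS z) (eS (y z)).
  pose m := maxn n (maxn m1.+1 m2.+1).
  have zm : z \in (st a m).2.
    apply: (@mono a m1.+1); first by rewrite /m !leq_max leqnn ?orbT.
    by rewrite -e1; have [] := st_F a m1.
  have yzm : y z \in (st a m).2.
    apply: (@mono a m2.+1); first by rewrite /m !leq_max leqnn ?orbT.
    by rewrite -e2; have [] := st_F a m2.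
  have [_ E] := conj_n m (leq_maxl _ _); rewrite -E.
  by rewrite !autM (kP a m) // (kP a m z) // autK.
have main a b n : (forall m, m < n -> a m = b m) -> a n = false -> b n = true ->
    ~ H ((k a)^-1 * k b)%g /\ ~ H ((k b)^-1 * k a)%g.
  move=> pre an bn.
  have eqst : st a n = st b n.
    elim: n pre {an bn} => [//|n IH] pre /=; rewrite IH.
      by rewrite pre.
    by move=> m mn; apply: pre; exact: leqW.
  suff nab : ~ H ((k a)^-1 * k b)%g.
    by split=> // /(subgroupV sH); rewrite monoid.invgM monoid.invgK.
  have [y0 [y1 [h [Hy0 nHy1 hy [[iy0 g0] [iy1 g1]]]]]] : exists y0 y1 h : aut M,
      [/\ H y0, ~ H y1, (h * y1 = y0 * h)%g &
       ((exists i, (st a n.+1).1.1 i = y0) /\ (st a n.+1).1.2 = (st a n).1.2) /\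
       ((exists i, (st b n.+1).1.1 i = y1) /\ (st b n.+1).1.2 = ((st a n).1.2 * h)%g)].
    have := gst a n => /=; rewrite -eqst an bn.
    case: (st a n) => [[x g] F] /= gx; have := TP n x F gx.
    case: (T n x F) => [[y0 y1] h] [Hy0 nHy1 _ _ [_ hy]].
    by exists y0, y1, h; split=> //; split; split=> //; exists (inr tt).
  have ka := k_conj _ _ _ iy0; have kb := k_conj _ _ _ iy1.
  rewrite g0 in ka; rewrite g1 in kb; set g := (st a n).1.2 in ka kb.
  have {}kb : (k b * y1 = g * y0 * g^-1 * k b)%g.
    rewrite kb; congr (_ * _)%g; rewrite -(monoid.mulgA g h) hy monoid.invgM !monoid.mulgA.
    by rewrite monoid.mulgK.
  set u := ((k a)^-1 * k b)%g => Hu; apply: nHy1.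
  have -> : y1 = (u^-1 * (y0 * u))%g.
    apply: (@monoid.mulgI _ u); rewrite monoid.mulVKg /u -monoid.mulgA kb.
    apply: (@monoid.mulgI _ (k a)); rewrite monoid.mulVKg.
    by rewrite !(monoid.mulgA (k a)) ka !monoid.mulgA monoid.mulgK.
  by apply: (subgroupM sH); [exact: (subgroupV sH)|exact: (subgroupM sH)].
apply: iH; apply: (perfect_index (k := k) sH) => a b ab.
have exn : exists n, a n != b n.
  apply: contrapT => h; apply: ab; apply/funext => n; apply/eqP.
  by apply: contrapT => /negP hn; apply: h; exists n.
have [pre abn] : (forall m, m < ex_minn exn -> a m = b m) /\
    a (ex_minn exn) != b (ex_minn exn).
  case: ex_minnP => n hn hmin; split=> // m mn; apply/eqP; apply: contraTT mn => hm.
  by rewrite -leqNgt; exact: hmin.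
case ea : (a (ex_minn exn)) abn => /=; case eb : (b (ex_minn exn)) => //= _.
  by have [] := main b a _ (fun m mn => esym (pre m mn)) eb ea.
by have [] := main a b _ pre ea eb.
Qed.

End SmallIndex.

(** * A copy of the limit on which [Sym(nat)] acts *)

(* [Ext n b s x] is the point [x] of the finite matroid listed by [b], glued at stage
   [n] along the identification of the list [s] with an initial segment of [b]. *)
Inductive pt (T : Type) : Type := Base of nat | Ext of nat & seq T & seq (pt T) & T.
Arguments Base {T}.

HB.instance Definition _ T := gen_eqMixin (pt T).
HB.instance Definition _ T := gen_choiceMixin (pt T).

Section Points.
Variable T : Type.

(** The recursive occurrences are nested in a list, so the hypothesis has to range over its
    members. *)
Lemma pt_nested_ind (P : pt T -> Prop) : (forall k, P (Base k)) ->
  (forall n b s x, (forall u, u \in s -> P u) -> P (Ext n b s x)) -> forall u, P u.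
Proof.
move=> PB PE; fix IH 1 => -[k|n b s x]; first exact: PB.
apply: PE; elim: s => [u|v s IHs u]; first by rewrite in_nil; discriminate.
by rewrite inE => /orP[/eqP ->|]; [exact (IH v)|exact (IHs u)].
Qed.

(** Only the leaves move: the list [b] and its point [x] do not depend on the place where they are
    glued. *)
Fixpoint act (f : nat -> nat) (u : pt T) : pt T :=
  match u with Base k => Base (f k) | Ext n b s x => Ext n b (map (act f) s) x end.

Lemma act_comp f g u : act f (act g u) = act (f \o g) u.
Proof.
elim/pt_nested_ind: u => [//|n b s x IH] /=; rewrite -map_comp; congr Ext.
exact/eq_in_map.
Qed.

Lemma act_id f u : f =1 id -> act f u = u.
Proof.
move=> fid; elim/pt_nested_ind: u => [k|n b s x IH] /=; first by rewrite fid.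
by congr Ext; rewrite -[RHS]map_id; exact/eq_in_map.
Qed.

Lemma actK f g : cancel f g -> cancel (act f) (act g).
Proof. by move=> fK u; rewrite act_comp act_id. Qed.

Definition stage_of (u : pt T) : nat := if u is Ext n _ _ _ then n.+1 else 0.

Lemma pt_enum : countable [set: T] -> exists e : nat -> pt T, forall u, exists n, e n = u.
Proof.
move=> /countable_injP[i iI].
pose enc := fix enc (u : pt T) : GenTree.tree nat := match u with
  | Base k => GenTree.Leaf k
  | Ext n b s x => GenTree.Node n
      (GenTree.Leaf (pickle (map i b)) :: GenTree.Leaf (i x) :: map enc s) end.
have {}iI : injective i by move=> x y; apply: iI; rewrite inE.
have encI : injective enc.
  move=> u; elim/pt_nested_ind: u => [k|n b s x IH] [k'|n' b' s' x'] //= [].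
    by move=> ->.
  move=> -> /(pcan_inj pickleK)/(inj_map iI) -> /iI -> es; congr Ext.
  elim: s s' IH es => [|u s IHs] [|v s'] //= IH [e1 e2]; congr cons.
    by apply: IH => //; rewrite inE eqxx.
  by apply: IHs => // w ws; apply: IH; rewrite inE ws orbT.
exists (fun n => if pselect (exists u, pickle (enc u) = n) is left h then projT1 (cid h)
  else Base 0).
move=> u; exists (pickle (enc u)); case: pselect => [h|]; last by case; exists u.
by case: (cid h) => v /= /(pcan_inj pickleK)/encI.
Qed.

End Points.

Section Stages.
Variables (PP : projective_plane -> Prop) (M : structure).
Hypothesis fM : fraisse_limit (K_omits PP) M.
Variable m0 : M.

Let wM := limit_wedge fM.
Let mM := limit_matroid fM.
Let U := pt M.
Let idt : Type := (seq M * seq U)%type.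

(** The identification of the glued piece with the finite matroid listed by [i.1]; [m0] is a
    default. *)
Definition lab (i : idt) (u : U) : M :=
  if u \in i.2 then nth m0 i.1 (index u i.2) else if u is Ext _ _ _ x then x else m0.

(** A valid extension problem [i = (b, s)]: [b] lists a closed finite set of [M], and matching [s]
    with an initial segment of [b] is an isomorphism between closed sets. *)
Record inst (X : set U) (R : U -> U -> U -> Prop) (i : idt) : Prop := {
  inst_ub : uniq i.1;
  inst_cb : flat i.1;
  inst_us : uniq i.2;
  inst_X : forall u, u \in i.2 -> X u;
  inst_cs : meet_closed R [set` i.2];
  inst_sz : size i.2 <= size i.1;
  inst_ct : flat (take (size i.2) i.1);
  inst_R : forall u v w, u \in i.2 -> v \in i.2 -> w \in i.2 ->
    R u v w <-> Rel (lab i u) (lab i v) (lab i w) }.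

Definition glue_list (n : nat) (i : idt) : seq U :=
  i.2 ++ [seq Ext n i.1 i.2 x | x <- drop (size i.2) i.1].

(** Empty when [i] is not valid, so that all pairs can serve as indices of the amalgam. *)
Definition glue (n : nat) (X : set U) (R : U -> U -> U -> Prop) (i : idt) : set U :=
  [set u | inst X R i /\ u \in glue_list n i].

Definition glue_rel n X R i := pull_rel (@Rel M) (glue n X R i) (lab i).

Fixpoint stage n : set U * (U -> U -> U -> Prop) :=
  if n is m.+1 then
    let: (X, R) := stage m in
    (X `|` [set u | exists i, glue m X R i u], am_rel X R (glue_rel m X R))
  else ([set u | exists k, u = Base k], fun _ _ _ => False).

Section Glue.
Variables (n : nat) (X : set U) (R : U -> U -> U -> Prop).
Hypothesis Xn : forall u, X u -> stage_of u <= n.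

Lemma lab_old i u : inst X R i -> u \in i.2 ->
  lab i u = nth m0 i.1 (index u i.2) /\ lab i u \in take (size i.2) i.1.
Proof.
move=> hi us; rewrite /lab us; split=> //.
have lt : index u i.2 < size i.2 by rewrite index_mem.
rewrite -(@nth_take (size i.2)) // mem_nth // size_take.
by case: ifP => // _; apply: leq_trans (inst_sz hi).
Qed.

Lemma lab_new i x : inst X R i -> lab i (Ext n i.1 i.2 x) = x.
Proof.
by move=> hi; rewrite /lab; case: ifP => // /(inst_X hi)/Xn; rewrite /= ltnn.
Qed.

Lemma glueP i u : glue n X R i u -> inst X R i /\
  ((u \in i.2 /\ lab i u \in take (size i.2) i.1) \/
   (u = Ext n i.1 i.2 (lab i u) /\ lab i u \in drop (size i.2) i.1)).
Proof.
move=> [hi]; rewrite mem_cat => /orP[us|/mapP[x xd ->]]; split=> //.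
  by left; split=> //; have [] := lab_old hi us.
by right; rewrite lab_new.
Qed.

Lemma take_drop_disj i x : inst X R i -> x \in take (size i.2) i.1 ->
  x \in drop (size i.2) i.1 -> False.
Proof.
move=> hi; have := inst_ub hi; rewrite -{1}(cat_take_drop (size i.2) i.1) cat_uniq.
by move=> /and3P[_ /hasPn h _] xt /h; rewrite /= xt.
Qed.

Lemma lab_inj i u v : glue n X R i u -> glue n X R i v -> lab i u = lab i v -> u = v.
Proof.
move=> /glueP[hi hu] /glueP[_ hv] e.
case: hu => -[hu tu]; case: hv => -[hv tv].
- have [eu _] := lab_old hi hu; have [ev _] := lab_old hi hv; rewrite eu ev in e.
  have lt w : w \in i.2 -> index w i.2 < size i.1.
    by move=> wi; apply: leq_trans (inst_sz hi); rewrite index_mem.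
  have /eqP := e; rewrite nth_uniq ?lt ?(inst_ub hi) // => /eqP e'.
  by rewrite -(nth_index (Base 0) hu) e' nth_index.
- by rewrite e in tu; case: (take_drop_disj hi tu tv).
- by rewrite -e in tv; case: (take_drop_disj hi tv tu).
- by rewrite hu hv e.
Qed.

(** The stage number stored in [Ext] keeps new points out of the earlier stages. *)
Lemma glue_old i u : glue n X R i u -> X u -> u \in i.2.
Proof. by move=> /glueP[_ [[]//|[-> _]]] /Xn; rewrite /= ltnn. Qed.

Hypothesis mR : matroid R.
Hypothesis sR : forall u v w, R u v w -> X u.

Lemma glue_data : amalgam_data X R (glue n X R) (glue_rel n X R).
Proof.
split=> //.
- by move=> i; apply: pull_rel_matroid => // u v; exact: lab_inj.
- by move=> i a b c [].
- move=> i a b c Xa Xb Xc Ba Bb Bc; have [hi _] := Ba.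
  rewrite (inst_R hi); [|exact: glue_old..].
  by split=> [h|[]].
(* A new point records the pair it comes from, so distinct pieces meet only in [X]. *)
- move=> [b s] [b' s'] u /glueP[hi hu] /glueP[hj hv] nX.
  case: hu => -[hu _]; first by case: nX; exact: (inst_X hi).
  case: hv => -[hv _]; first by case: nX; exact: (inst_X hj).
  by move: hu; rewrite hv => -[-> ->].
- move=> i a b c d p [Xa Ba] [Xb Bb] [Xc Bc] [Xd Bd].
  move=> /(pull_rel_meets (@lab_inj i) Ba Bb Bc Bd)[Bp h]; split=> //.
  have [hi [[pi _]|[_ pd]]] := glueP Bp; first exact: (inst_X hi).
  case: (take_drop_disj hi (x := lab i p)) => //.
  have old t : glue n X R i t -> X t -> lab i t \in take (size i.2) i.1.
    by move=> Bt Xt; have [] := lab_old hi (glue_old Bt Xt).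
  by apply: (inst_ct hi) h; exact: old.
move=> i a b c d p [Xa Ba] [Xb Bb] [Xc Bc] [Xd Bd] h; have [hi _] := Ba.
have pi : p \in i.2 by apply: (inst_cs hi) h; exact: glue_old.
by split; [exact: (inst_X hi)|split=> //; rewrite mem_cat pi].
Qed.

End Glue.

Definition stage_ok n (X : set U) (R : U -> U -> U -> Prop) : Prop :=
  [/\ matroid R, forall u v w, R u v w -> X u, forall u, X u -> stage_of u <= n,
    forall P, PP P -> omits P R X &
    forall s : seq U, (forall u, u \in s -> X u) -> exists t : seq U,
      [/\ {subset s <= t}, forall u, u \in t -> X u & meet_closed R [set` t]]].

Lemma stage_okS n : stage_ok n (stage n).1 (stage n).2.
Proof.
elim: n => [|n] /=.
  split=> //.
  - by move=> u [k ->].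
  - move=> P _ [f [_ _ fR]]; have [a [b [c [d [[ab _ _] _ _ _ _]]]]] := plane_quadrangle P.
    by have [r /fR] := plane_third_point ab.
  - by move=> s sX; exists s; split=> // a b c d p _ _ _ _ [].
case: (stage n) => X R /= [mR sR Xn oR lf].
have D := glue_data Xn mR sR.
split.
- exact: am_rel_matroid D.
- by move=> u v w /(am_rel_supp D).
- move=> u [/Xn/leqW //|[i /(glueP Xn)[hi [[/(inst_X hi)/Xn/leqW //]|[-> _]]]]].
  exact: leqnn.
- move=> P PPP; apply: (am_omits D); first exact: oR.
  move=> i; apply: (omits_image (g := lab i)) (limit_omits fM PPP) => //.
    by move=> u v; rewrite !inE; exact: lab_inj.
  by move=> u v w Bu Bv Bw; split=> [[]|].
move=> s sX.
(* Local finiteness: [s] is covered by finitely many old points and pieces. Closing the old points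
   and the bases of these pieces inside [X], and adding the pieces, gives a closed set by
   [am_closed]. *)
have [t0 [J [t0X hJ cov]]] : exists (t0 : seq U) (J : seq idt),
    [/\ forall u, u \in t0 -> X u, forall i, i \in J -> inst X R i &
      forall u, u \in s -> u \in t0 \/ exists2 i, i \in J & u \in glue_list n i].
  elim: s sX => [|u s IH] sX; first by exists [::], [::].
  have [|t0 [J [t0X hJ cov]]] := IH; first by move=> v vs; apply: sX; rewrite inE vs orbT.
  have [Xu|[i [hi ui]]] := sX u (mem_head _ _).
    exists (u :: t0), J; split=> // v; rewrite inE => /orP[/eqP ->|] //.
    - exact: t0X.
    - by left; exact: mem_head.
    - by move=> /cov[vt|]; [left; rewrite inE vt orbT|right].
  exists t0, (i :: J); split=> // v; rewrite inE => /orP[/eqP ->|] //.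
  - exact: hJ.
  - by right; exists i => //; exact: mem_head.
  - by move=> /cov[vt|[j jJ vj]]; [left|right; exists j => //; rewrite inE jJ orbT].
have [|t1 [st1 t1X ct1]] := lf (t0 ++ flatten [seq i.2 | i <- J]).
  move=> u; rewrite mem_cat => /orP[/t0X//|/flattenP[_ /mapP[i iJ ->]]].
  exact: (inst_X (hJ _ iJ)).
pose t := t1 ++ flatten [seq glue_list n i | i <- J].
have tE : [set` t] = [set` t1] `|` [set u | exists2 i, i \in J & glue n X R i u].
  apply/seteqP; split=> u /=; rewrite mem_cat.
    move=> /orP[ut|/flattenP[_ /mapP[i iJ ->] ui]]; [by left|right; exists i => //].
    by split=> //; exact: hJ.
  move=> [ut|[i iJ [_ ui]]]; apply/orP; [by left|right; apply/flattenP].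
  by exists (glue_list n i) => //; exact: map_f.
exists t; split=> [u us|u|].
- rewrite mem_cat; apply/orP; case: (cov u us) => [ut|[i iJ ui]].
    by left; apply: st1; rewrite mem_cat ut.
  by right; apply/flattenP; exists (glue_list n i) => //; exact: map_f.
- move=> ut; have : [set` t] u by []; rewrite tE.
  by move=> [/t1X|[i _ ui]]; [left|right; exists i].
rewrite tE; apply: (am_closed D) => // i iJ u [Xu Bu]; apply: st1.
rewrite mem_cat; apply/orP; right; apply/flattenP; exists i.2; first exact: map_f.
exact: (glue_old Xn Bu).
Qed.

Let sX n := (stage n).1.
Let sR n := (stage n).2.

Lemma stage_data n : amalgam_data (sX n) (sR n) (glue n (sX n) (sR n))
  (glue_rel n (sX n) (sR n)).
Proof. by have [mR supp lv _ _] := stage_okS n; exact: glue_data. Qed.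

Lemma stageS n : sX n.+1 = sX n `|` [set u | exists i, glue n (sX n) (sR n) i u] /\
  sR n.+1 = am_rel (sX n) (sR n) (glue_rel n (sX n) (sR n)).
Proof. by rewrite /sX /sR /=; case: (stage n). Qed.

Lemma stage_sub m n u : m <= n -> sX m u -> sX n u.
Proof.
apply: (@chain_mono _ sX) => k v vX.
by rewrite (stageS k).1; left.
Qed.

Lemma stage_supp n u v w : sR n u v w -> [/\ sX n u, sX n v & sX n w].
Proof.
have [mR supp _ _ _] := stage_okS n => h; split; apply: supp; first exact: h.
  exact: (matroid_C12 mR h).
exact: (matroid_C12 mR (matroid_C23 mR h)).
Qed.

Lemma stage_rel m n u v w : m <= n -> sX m u -> sX m v -> sX m w ->
  sR n u v w <-> sR m u v w.
Proof.
move=> /subnK <- Xu Xv Xw; elim: (n - m)%N => [//|k IH]; rewrite addSn -IH.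
have le : m <= k + m by exact: leq_addl.
rewrite (stageS (k + m)).2; apply: (am_rel_X (stage_data _)); exact: stage_sub le _.
Qed.

Definition ptX : set U := [set u | exists n, sX n u].
Definition ptR (u v w : U) : Prop := exists n, sR n u v w.

Lemma ptR_stage n u v w : sX n u -> sX n v -> sX n w -> ptR u v w <-> sR n u v w.
Proof.
move=> Xu Xv Xw; split=> [[m h]|h]; last by exists n.
have [Yu Yv Yw] := stage_supp h; have [mn|/ltnW nm] := leqP m n.
  by rewrite (stage_rel mn).
by rewrite -(stage_rel nm).
Qed.

Lemma ptX_seq (s : seq U) : (forall u, u \in s -> ptX u) ->
  exists n, forall u, u \in s -> sX n u.
Proof.
elim: s => [|u s IH] h; first by exists 0.
have [n nu] := h u (mem_head _ _).
have [|m ms] := IH; first by move=> v vs; apply: h; rewrite inE vs orbT.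
exists (maxn n m) => v; rewrite inE => /orP[/eqP ->|/ms h'].
  exact: stage_sub (leq_maxl _ _) nu.
exact: stage_sub (leq_maxr _ _) h'.
Qed.

Lemma ptR_supp u v w : ptR u v w -> [/\ ptX u, ptX v & ptX w].
Proof. by move=> [n /stage_supp[]]; split; exists n. Qed.

Lemma ptR_matroid : matroid ptR.
Proof.
split=> [a b c [n]|a b c [n]|a b c d hc hd cd].
- by have [mR _ _ _ _] := stage_okS n => /(matroid_neq mR)[].
- by have [mR _ _ _ _] := stage_okS n => h; split; exists n;
    [exact: matroid_C12|exact: matroid_C23].
have [[Xa Xb Xc] [_ _ Xd]] := conj (ptR_supp hc) (ptR_supp hd).
have [n ns] : exists n, forall u, u \in [:: a; b; c; d] -> sX n u.
  by apply: ptX_seq => u; rewrite !inE => /or4P[] /eqP ->.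
have [Ya Yb Yc Yd] : [/\ sX n a, sX n b, sX n c & sX n d].
  by split; apply: ns; rewrite !inE eqxx ?orbT.
have [[_ _ tr] _ _ _ _] := stage_okS n; exists n.
exact: (tr _ _ _ _ (iffLR (ptR_stage Ya Yb Yc) hc) (iffLR (ptR_stage Ya Yb Yd) hd) cd).
Qed.

(** No stage adds a meeting point to lines of an earlier one, since [X] is closed in each amalgam;
    so [p] descends to stage [n] step by step. *)
Lemma stage_closed n (S : set U) : S `<=` sX n -> meet_closed (sR n) S ->
  meet_closed ptR S.
Proof.
move=> SX cS a b c d p Sa Sb Sc Sd h.
have [Xa Xb Xc Xd] : [/\ sX n a, sX n b, sX n c & sX n d] by split; exact: SX.
have [m pm] : ptX p by have [/ptR_supp[]] := h.
have meets_stage k : n <= k -> sX k p -> meets (sR k) a b c d p.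
  move=> nk Xp; have st t : sX n t -> sX k t by exact: stage_sub.
  apply: (iffLR (@meets_iff _ _ ptR (sR k) id a b c d p _ _ _ _ _)) h => //;
    by apply: ptR_stage => //; exact: st.
suff: sX n p.
  by move=> pn; apply: (cS a b c d) => //; exact: (meets_stage n (leqnn n) pn).
have : sX (m - n + n) p by apply: stage_sub pm; rewrite addnC -leq_subLR.
elim: (m - n)%N => [//|k IH]; rewrite addSn => Xp; apply: IH.
have nk : n <= k + n by exact: leq_addl.
have := meets_stage _ (leqW nk) Xp; rewrite (stageS (k + n)).2 => hm.
have [mR supp _ _ _] := stage_okS (k + n).
have cX : meet_closed (sR (k + n)) (sX (k + n)).
  by move=> ? ? ? ? ? _ _ _ _ [/stage_supp[]].
have st t : sX n t -> (sX (k + n) `|` [set u | exists2 j, set0 j &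
    glue (k + n) (sX (k + n)) (sR (k + n)) j u]) t by left; exact: stage_sub nk _.
have [//|[j []]] := @am_closed _ _ _ _ _ _ (stage_data (k + n)) (sX (k + n)) set0
  (fun _ h => h) cX (fun j (h : set0 j) => match h with end) _ _ _ _ _
  (st _ Xa) (st _ Xb) (st _ Xc) (st _ Xd) hm.
Qed.

Lemma ptX_locally_finite (s : seq U) : (forall u, u \in s -> ptX u) ->
  exists t : seq U, [/\ {subset s <= t}, forall u, u \in t -> ptX u &
    meet_closed ptR [set` t]].
Proof.
move=> /ptX_seq[n ns]; have [_ _ _ _ lf] := stage_okS n.
have [t [st tX ct]] := lf s ns; exists t; split=> //.
  by move=> u /tX; exists n.
exact: (@stage_closed n).
Qed.

Lemma ptX_omits P (s : seq U) : PP P -> (forall u, u \in s -> ptX u) ->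
  omits P ptR [set` s].
Proof.
move=> PPP /ptX_seq[n ns]; have [_ _ _ oX _] := stage_okS n.
apply: (omits_image (g := id)) (oX P PPP) => // u v w us vs ws.
by apply: ptR_stage; exact: ns.
Qed.

(** * Equivariance of one gluing step *)

Section ActStep.
Variables (f f' : nat -> nat) (fK : cancel f f') (f'K : cancel f' f).
Variables (n : nat) (X : set U) (R : U -> U -> U -> Prop).
Hypothesis Xf : forall u, X u -> X (act f u).
Hypothesis Rf : forall u v w, R u v w -> R (act f u) (act f v) (act f w).
Hypothesis Rf' : forall u v w, R u v w -> R (act f' u) (act f' v) (act f' w).

Let aK := @actK M _ _ fK.
Let aK' := @actK M _ _ f'K.
Let aI := can_inj aK.
Let act_i (i : idt) : idt := (i.1, map (act f) i.2).

Lemma act_rel u v w : R u v w <-> R (act f u) (act f v) (act f w).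
Proof. by split=> [|/Rf']; [exact: Rf|rewrite !aK]. Qed.

Lemma lab_act i u : lab (act_i i) (act f u) = lab i u.
Proof. by rewrite /lab /= mem_map // index_map //; case: ifP => // _; case: u. Qed.

Lemma inst_act i : inst X R i -> inst X R (act_i i).
Proof.
move=> hi; split; rewrite /= ?size_map.
- exact: inst_ub hi.
- exact: inst_cb hi.
- by rewrite map_inj_uniq //; exact: inst_us hi.
- by move=> _ /mapP[u ui ->]; apply: Xf; exact: inst_X hi _ ui.
- move=> _ _ _ _ p /mapP[a ai ->] /mapP[b bi ->] /mapP[c ci ->] /mapP[d di ->] h.
  have : meets R a b c d (act f' p).
    apply: (iffRL (@meets_iff _ _ R R (act f) a b c d (act f' p) (@aI _ _) (@aI _ _)
      (act_rel _ _ _) (act_rel _ _ _) (act_rel _ _ _))).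
    by rewrite aK'.
  by move=> /(inst_cs hi ai bi ci di) pi; apply/mapP; exists (act f' p).
- exact: inst_sz hi.
- exact: inst_ct hi.
move=> _ _ _ /mapP[u ui ->] /mapP[v vi ->] /mapP[w wi ->].
by rewrite !lab_act -act_rel; exact: inst_R hi _ _ _ ui vi wi.
Qed.

Lemma glue_act i u : glue n X R i u -> glue n X R (act_i i) (act f u).
Proof.
move=> [hi ui]; split; first exact: inst_act.
have -> : glue_list n (act_i i) = map (act f) (glue_list n i).
  by rewrite /glue_list map_cat -map_comp /= size_map.
by rewrite mem_map.
Qed.

Lemma am_rel_act u v w : am_rel X R (glue_rel n X R) u v w ->
  am_rel X R (glue_rel n X R) (act f u) (act f v) (act f w).
Proof.
have ga i a b c : glue_rel n X R i a b c ->
    glue_rel n X R (act_i i) (act f a) (act f b) (act f c).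
  by move=> [ga gb gc h]; split; rewrite ?lab_act //; exact: glue_act.
have la c c' a : line R c c' a -> line R (act f c) (act f c') (act f a).
  by move=> [[->|->]|h]; [left; left|left; right|right; exact: Rf].
have oa c c' a : am_on X (glue_rel n X R) (line R c c') a ->
    am_on X (glue_rel n X R) (line R (act f c) (act f c')) (act f a).
  move=> [/la|[i [d [d' [Xd Xd' h Ld Ld']]]]]; first by left.
  right; exists (act_i i), (act f d), (act f d').
  by split; [exact: Xf|exact: Xf|exact: ga|exact: la|exact: la].
move=> [[uv uw vw] h]; split; first by split=> /aI.
case: h => [[c [c' [Xc Xc' cc' cu [cv cw]]]]|[i h]].
  left; exists (act f c), (act f c'); split; [exact: Xf|exact: Xf| |exact: oa|].
    by move=> /aI.
  by split; exact: oa.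
by right; exists (act_i i); exact: ga.
Qed.

End ActStep.

Lemma act_stage f f' n : cancel f f' -> cancel f' f ->
  (forall u, sX n u -> sX n (act f u)) /\
  forall u v w, sR n u v w -> sR n (act f u) (act f v) (act f w).
Proof.
elim: n f f' => [|n IH] f f' fK f'K; first by split=> // u [k ->]; exists (f k).
have [IHX IHR] := IH f f' fK f'K; have [_ IHR'] := IH f' f f'K fK.
have [eX eR] := stageS n; rewrite eX eR; split=> [u|u v w].
  move=> [/IHX|[i gi]]; first by left.
  right; exists (i.1, map (act f) i.2); exact: (glue_act fK f'K IHX IHR IHR').
exact: (am_rel_act fK f'K IHX IHR IHR').
Qed.

Lemma act_ptX f f' u : cancel f f' -> cancel f' f -> ptX u -> ptX (act f u).
Proof. by move=> fK f'K [n un]; exists n; have [h _] := act_stage n fK f'K; exact: h. Qed.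

Lemma act_ptR f f' u v w : cancel f f' -> cancel f' f ->
  ptR u v w <-> ptR (act f u) (act f v) (act f w).
Proof.
have sub g g' a b c : cancel g g' -> cancel g' g -> ptR a b c ->
    ptR (act g a) (act g b) (act g c).
  by move=> gK g'K [n h]; exists n; have [_ hR] := act_stage n gK g'K; exact: hR.
move=> fK f'K; split=> [|h]; first exact: sub fK f'K.
by have := sub _ _ _ _ _ f'K fK h; rewrite !(actK fK).
Qed.

Lemma image_seq (T T' : eqType) (f : T -> T') (s : seq T) :
  f @` [set` s] = [set` map f s].
Proof.
apply/seteqP; split=> [_ [y ys <-]|x /mapP[y ys ->]]; last by exists y.
exact: map_f.
Qed.

Definition pemb (D : seq U) (p : U -> M) : Prop :=
  [/\ forall u, u \in D -> ptX u, meet_closed ptR [set` D], {in D &, injective p},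
    forall u v w, u \in D -> v \in D -> w \in D -> ptR u v w <-> Rel (p u) (p v) (p w) &
    flat (map p D)].

(** Universality embeds a finite closed set containing [D] and [u]; homogeneity of [M] corrects this
    embedding so that it extends [p]. *)
Lemma pemb_forth D p u : pemb D p -> ptX u -> exists D' p',
  [/\ pemb D' p', {subset D <= D'}, u \in D' & {in D, p' =1 p}].
Proof.
move=> [DX cD pI pR pC] Xu.
have [t [st tX ct]] : exists t : seq U, [/\ {subset u :: D <= t},
    forall u, u \in t -> ptX u & meet_closed ptR [set` t]].
  by apply: ptX_locally_finite => v; rewrite inE => /orP[/eqP ->|/DX].
have Dt : {subset D <= t} by move=> v vD; apply: st; rewrite inE vD orbT.
have [||phi [phiI phiR phiC]] := @limit_universal _ _ fM _ ptR [set` t] ptR_matroid.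
- exact: finite_seq.
- by move=> P PPP; exact: ptX_omits.
have mphi a b c d q : a \in t -> b \in t -> c \in t -> d \in t -> q \in t ->
    meets ptR a b c d q <-> meets (@Rel M) (phi a) (phi b) (phi c) (phi d) (phi q).
  by move=> *; apply: meets_iff; (try exact: phiI); (try exact: phiR).
pose F y := if pselect (exists d, d \in D /\ p d = y) is left h then
  phi (projT1 (cid h)) else y.
have FE d : d \in D -> F (p d) = phi d.
  move=> dD; rewrite /F; case: pselect => [h|]; last by case; exists d.
  by case: (cid h) => d' [d'D e] /=; rewrite (pI _ _ d'D dD e).
have [||||g gE] := @limit_homogeneous _ _ fM (map p D) F.
- exact: pC.
- move=> _ _ /mapP[a aD ->] /mapP[b bD ->]; rewrite !FE // => e.
  by rewrite (phiI a b) //; exact: Dt.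
- move=> _ _ _ /mapP[a aD ->] /mapP[b bD ->] /mapP[c cD' ->].
  by rewrite !FE // -pR // phiR //; exact: Dt.
- move=> _ _ _ _ q [_ /mapP[a aD ->] <-] [_ /mapP[b bD ->] <-] [_ /mapP[c cD' ->] <-]
    [_ /mapP[d dD ->] <-]; rewrite !FE // => h.
  have [r rt re] : (phi @` [set` t]) q.
    by apply: phiC h; [exists a|exists b|exists c|exists d] => //; exact: Dt.
  subst q; have rD : r \in D.
    apply: (cD a b c d) => //.
    exact: (iffRL (mphi a b c d r (Dt _ aD) (Dt _ bD) (Dt _ cD') (Dt _ dD) rt) h).
  by exists (p r); [exact: map_f|exact: FE].
exists t, (fun v => (g^-1)%g (phi v)); split=> //.
- split=> // [a b at' bt|a b c at' bt ct'|].
  + by move=> /(@aut_inj _ (g^-1)%g)/phiI; exact.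
  + by rewrite -aut_rel -phiR.
  by rewrite /flat -image_seq -(image_comp phi (g^-1)%g); exact: aut_closed.
- by apply: st; rewrite inE eqxx.
by move=> d dD; rewrite -FE // -gE ?autK // map_f.
Qed.

(** A finite closed set containing [y] and the image of [p] is a valid extension problem over [D];
    its solution was glued at the stage following one that contains [D]. *)
Lemma pemb_back D p y : pemb D p -> exists D' p',
  [/\ pemb D' p', {subset D <= D'}, y \in map p' D' & {in D, p' =1 p}].
Proof.
move=> [DX cD pI pR pC].
have [E [sE cE]] := limit_locally_finite fM (y :: map p D).
(* The list [b] starts with the image of [s] in the same order, as [inst] demands. *)
pose s := undup D; pose b := map p s ++ [seq x <- undup E | x \notin map p s].
have sD : s =i D by exact: mem_undup.
have spD : map p s =i map p D by exact: eq_mem_map.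
have bE : b =i E.
  move=> x; rewrite mem_cat mem_filter mem_undup; case: (boolP (x \in map p s)) => //=.
  by rewrite spD => xD; apply/esym; apply: sE; rewrite inE xD orbT.
have setE (l l' : seq M) : l =i l' -> [set` l] = [set` l'].
  by move=> h; apply/seteqP; split=> x /=; rewrite h.
have [n ns] := ptX_seq DX.
pose i : idt := (b, s).
have tk : take (size s) b = map p s by rewrite /b take_size_cat // size_map.
have labE u : u \in D -> lab i u = p u.
  rewrite -sD => us; rewrite /lab /= us /b nth_cat size_map index_mem us.
  by rewrite (nth_map (Base 0)) ?index_mem // nth_index.
have hi : inst (sX n) (sR n) i.
  split=> /=.
  - rewrite cat_uniq filter_uniq ?undup_uniq // andbT map_inj_in_uniq ?undup_uniq //=.
      by apply/hasPn => x; rewrite mem_filter => /andP[].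
    by move=> u v; rewrite !sD; exact: pI.
  - by rewrite /flat (setE _ _ bE).
  - exact: undup_uniq.
  - by move=> u; rewrite sD; exact: ns.
  - move=> a1 b1 c1 d1 q; rewrite /= !sD => h1 h2 h3 h4 [q1 q2 nl].
    have [[X1 X2 X3] [X4 X5 _]] := conj (stage_supp q1) (stage_supp q2).
    apply: (cD a1 b1 c1 d1) => //; split; [by exists n|by exists n|].
    move=> hl; apply: nl; case: hl => [?|/(ptR_stage X1 X2 X4)]; by [left|right].
  - by rewrite /b size_cat size_map leq_addr.
  - by rewrite tk /flat (setE _ _ spD).
  - move=> u v w; rewrite !sD => ui vi wi; rewrite !labE // -pR //.
    by apply: iff_sym; apply: ptR_stage; exact: ns.
have [mR supp lv _ _] := stage_okS n.
have gl u : u \in glue_list n i -> glue n (sX n) (sR n) i u by [].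
have glX u : u \in glue_list n i -> sX n.+1 u.
  by move=> ui; rewrite (stageS n).1; right; exists i; exact: gl.
have im : map (lab i) (glue_list n i) = b.
  rewrite /glue_list map_cat -map_comp -[RHS](cat_take_drop (size s)) tk; congr cat.
    by apply/eq_in_map => u us; apply: labE; rewrite -sD.
  rewrite -[RHS]map_id; apply/eq_in_map => x _ /=; exact: (lab_new lv x hi).
exists (glue_list n i), (lab i); split=> //.
- split=> [u /glX|||u v w ui vi wi|]; first by exists n.+1.
  + apply: (@stage_closed n.+1); first by move=> u /glX.
    rewrite (stageS n).2.
    have := @am_closed _ _ _ _ _ _ (stage_data n) [set` s] [set i] _ (inst_cs hi).
    have -> : [set` s] `|` [set u | exists2 j, [set i] j & glue n (sX n) (sR n) j u] =
        [set` glue_list n i].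
      apply/seteqP; split=> u /=; last by move=> ui; right; exists i => //; exact: gl.
      by move=> [us|[j -> [_ h]]] //; rewrite mem_cat us.
    apply; first by move=> u us; exact: (inst_X hi).
    by move=> j -> u [Xu gu]; exact: (glue_old lv gu).
  + by move=> u v ui vi; apply: (lab_inj lv); exact: gl.
  + rewrite (@ptR_stage n.+1); [|exact: glX..]; rewrite (stageS n).2.
    rewrite (am_rel_B (stage_data n) (gl _ ui) (gl _ vi) (gl _ wi)).
    by split=> [[]|h] //; split.
  by rewrite im /flat (setE _ _ bE).
- by move=> u uD; rewrite mem_cat /= sD uD.
by rewrite im bE; apply: sE; rewrite inE eqxx.
Qed.

Lemma ptX_iso : exists theta : U -> M,
  [/\ forall u v, ptX u -> ptX v -> theta u = theta v -> u = v,
    forall u v w, ptX u -> ptX v -> ptX w -> ptR u v w <-> Rel (theta u) (theta v) (theta w) &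
    forall y, exists2 u, ptX u & theta u = y].
Proof.
have [e eS] := limit_enum fM.
have [eu euS] : exists e : nat -> U, forall u, exists n, e n = u.
  by apply: pt_enum; case: fM.
have step (q : nat * (seq U * (U -> M))) : exists r : seq U * (U -> M),
    pemb q.2.1 q.2.2 -> [/\ pemb r.1 r.2, {subset q.2.1 <= r.1}, {in q.2.1, r.2 =1 q.2.2},
      ptX (eu q.1) -> eu q.1 \in r.1 & e q.1 \in map r.2 r.1].
  case: q => n [D p] /=; have [hp|] := pselect (pemb D p); last by exists (D, p).
  have [D1 [p1 [h1 s1 a1 y1]]] := pemb_back (e n) hp.
  have [Xu|nX] := pselect (ptX (eu n)); last by exists (D1, p1).
  have [D2 [p2 [h2 s2 a2 y2]]] := pemb_forth h1 Xu.
  exists (D2, p2) => _; split=> //=.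
  - by move=> u /s1/s2.
  - by move=> u uD; rewrite y2 ?y1 //; exact: s1.
  by have /mapP[v vD ->] := a1; apply/mapP; exists v; [exact: s2|rewrite y2].
have [F FP] := choice step.
pose st := fix st n := if n is m.+1 then F (m, st m) else ([::] : seq U, fun _ : U => m0).
have stg n : pemb (st n).1 (st n).2.
  elim: n => [|n IH]; last by have [] := FP (n, st n) IH.
  by split.
have stP n := FP (n, st n) (stg n).
have [||theta tE] := @chain_limit U M (fun n => (st n).2) (fun n => [set` (st n).1]).
- by move=> n u; have [_ h _ _ _] := stP n; exact: h.
- by move=> n u; have [_ _ h _ _] := stP n; exact: h.
have cov u : ptX u -> exists n, u \in (st n).1.
  by move=> Xu; have [n en] := euS u; exists n.+1; have [_ _ _ h _] := stP n;
    rewrite -en; apply: h; rewrite /= en.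
have mono m n u : m <= n -> u \in (st m).1 -> u \in (st n).1.
  apply: (@chain_mono _ (fun n => [set` (st n).1])) => k v /=.
  by have [_ h _ _ _] := stP k; exact: h.
have cov3 u v w : ptX u -> ptX v -> ptX w ->
    exists n, [/\ u \in (st n).1, v \in (st n).1 & w \in (st n).1].
  move=> /cov[n un] /cov[m vm] /cov[k wk]; exists (maxn n (maxn m k)).
  by split; [apply: mono un|apply: mono vm|apply: mono wk]; rewrite !leq_max leqnn ?orbT.
exists theta; split=> [u v Xu Xv|u v w Xu Xv Xw|y].
- have [n [un vn _]] := cov3 u v v Xu Xv Xv; rewrite !(tE n) //.
  by have [_ _ h _ _] := stg n; exact: h.
- have [n [un vn wn]] := cov3 u v w Xu Xv Xw; rewrite !(tE n) //.
  by have [_ _ _ h _] := stg n; exact: h.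
have [n <-] := eS y; have [h _ _ _ /mapP[u un ->]] := stP n.
by exists u; [have [hX _ _ _ _] := h; exact: hX|exact: (tE n.+1)].
Qed.

Lemma limit_sym_embeds : group_embeds (sym nat) (aut M).
Proof.
have [theta [tI tR tS]] := ptX_iso.
have /choice[theta' tK] : forall y, exists u, ptX u /\ theta u = y.
  by move=> y; have [u] := tS y; exists u.
have tX y : ptX (theta' y) by have [] := tK y.
have tK1 y : theta (theta' y) = y by have [] := tK y.
have tK2 u : ptX u -> theta' (theta u) = u by move=> Xu; apply: tI.
have aX (f : sym nat) u : ptX u -> ptX (act f u).
  exact: act_ptX (sym_funK f) (sym_invK f).
have /choice[phi phiE] : forall f : sym nat, exists g : aut M,
    forall y, g y = theta (act f (theta' y)).
  move=> f; have fK := sym_funK f; have f'K := sym_invK f.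
  have aX' u : ptX u -> ptX (act (sym_inv f) u) by exact: act_ptX f'K fK.
  apply: (@aut_ofP M _ (fun y => theta (act (sym_inv f) (theta' y)))) => //.
  - by move=> y; rewrite tK2 ?(actK fK) //; apply: aX.
  - by move=> y; rewrite tK2 ?(actK f'K) //; apply: aX'.
  move=> x y z; rewrite -tR; [|exact: aX..].
  by rewrite -(act_ptR _ _ _ fK f'K) tR // !tK1.
exists phi; split=> [f g fg|f g].
  apply: sym_ext => k; have XB : ptX (Base k) by exists 0; exists k.
  have := congr1 (fun h : aut M => h (theta (Base k))) fg; rewrite /= !phiE tK2 //.
  by move=> /tI h; have [] : act f (Base k) = act g (Base k) :> U by apply: h; exact: aX.
apply: aut_ext => y; rewrite autM !phiE tK2; last exact: aX.
by rewrite act_comp.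
Qed.

End Stages.

(** * The independence property *)

Section Definable.

(** One formula for all structures, so that a property proved in [M] passes to every model of [Th M]
    without the formula being written out. *)
Definition definable n (P : forall N : structure, ('I_n -> N) -> Prop) : Prop :=
  exists phi : formula n, forall (N : structure) (v : 'I_n -> N), sat phi v <-> P N v.

Lemma definable_ext n (P Q : forall N : structure, ('I_n -> N) -> Prop) :
  (forall N v, P N v <-> Q N v) -> definable P -> definable Q.
Proof. by move=> PQ [phi h]; exists phi => N v; rewrite h. Qed.

Lemma definable_not n (P : forall N : structure, ('I_n -> N) -> Prop) :
  definable P -> definable (fun N v => ~ P N v).
Proof. by move=> [phi h]; exists (FImp phi (FFalse n)) => N v /=; rewrite h. Qed.

Lemma definable_true n : definable (fun (N : structure) (v : 'I_n -> N) => True).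
Proof. by exists (FImp (FFalse n) (FFalse n)) => N v; split=> //= _ []. Qed.

Lemma definable_and n (P Q : forall N : structure, ('I_n -> N) -> Prop) :
  definable P -> definable Q -> definable (fun N v => P N v /\ Q N v).
Proof.
move=> [phi h] [psi k].
exists (FImp (FImp phi (FImp psi (FFalse n))) (FFalse n)) => N v /=; rewrite h k.
by split=> [H|[p q]]; [split; apply: contrapT => np; apply: H|apply].
Qed.

Lemma definable_ex n (P : forall N : structure, ('I_n.+1 -> N) -> Prop) :
  definable P -> definable (fun N v => exists x, P N (extend x v)).
Proof.
move=> [phi h]; exists (FImp (FAll (FImp phi (FFalse _))) (FFalse n)) => N v /=.
split=> [H|[x px] H]; last by apply: (H x); rewrite h.
by apply: contrapT => nx; apply: H => x; rewrite h => px; apply: nx; exists x.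
Qed.

Lemma definable_fin n (I : finType) (P : I -> forall N : structure, ('I_n -> N) -> Prop) :
  (forall i, definable (P i)) -> definable (fun N v => forall i, P i N v).
Proof.
move=> dP.
suff [phi h] : definable (fun N v => forall i, i \in enum I -> P i N v).
  exists phi => N v; rewrite h; split=> H i; last by [].
  by apply: H; rewrite mem_enum.
elim: (enum I) => [|i s IH].
  by apply: definable_ext (definable_true n) => N v; split.
apply: definable_ext (definable_and (dP i) IH) => N v.
split=> [[pi ps] j|H]; first by rewrite inE => /orP[/eqP ->|/ps].
by split=> [|j js]; apply: H; rewrite inE ?eqxx ?js ?orbT.
Qed.

Lemma extend0 (N : structure) n (x : N) (v : 'I_n -> N) : extend x v ord0 = x.
Proof. by rewrite /extend unlift_none. Qed.

Lemma extend_lift (N : structure) n (x : N) (v : 'I_n -> N) i :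
  extend x v (lift ord0 i) = v i.
Proof. by rewrite /extend liftK. Qed.

Lemma definable_exs k n (P : forall N : structure, ('I_k -> N) -> ('I_n -> N) -> Prop) :
  definable (fun (N : structure) (u : 'I_(k + n) -> N) =>
    P N (fun i => u (lshift n i)) (fun j => u (rshift k j))) ->
  definable (fun N v => exists w, P N w v).
Proof.
elim: k P => [|k IH] P.
  move=> [phi h]; exists phi => N v; rewrite h.
  have -> : (fun j => v (rshift 0 j)) = v by apply/funext => j; congr v; exact: val_inj.
  split=> [p|[w p]]; first by eexists; exact: p.
  by have -> : (fun i : 'I_0 => v (lshift n i)) = w by apply/funext => -[].
move=> /definable_ex d.
have {}IH := IH (fun N w v => exists x, P N (extend x w) v).
apply: definable_ext (IH _) => [N v|].
  split=> [[w [x p]]|[w p]]; first by exists (extend x w).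
  exists (fun i => w (lift ord0 i)), (w ord0).
  suff -> : extend (w ord0) (fun i => w (lift ord0 i)) = w by [].
  by apply/funext => i; case: (unliftP ord0 i) => [j|] ->; rewrite ?extend_lift ?extend0.
apply: definable_ext d => N u.
have el x : (fun i : 'I_k.+1 => extend x u (lshift n i)) = extend x (fun i => u (lshift n i)).
  apply/funext => i; case: (unliftP ord0 i) => [j|] ->; rewrite ?extend_lift ?extend0.
    by have -> : lshift n (lift ord0 j) = lift ord0 (lshift n j) by [exact: val_inj];
      rewrite extend_lift.
  by have -> : lshift n (ord0 : 'I_k.+1) = ord0 by [exact: val_inj]; rewrite extend0.
have er x : (fun j => extend x u (rshift k.+1 j)) = (fun j => u (rshift k j)).
  apply/funext => j.
  by have -> : rshift k.+1 j = lift ord0 (rshift k j) by [exact: val_inj]; rewrite extend_lift.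
by split=> -[x p]; exists x; [rewrite -el -(er x)|rewrite el er].
Qed.

End Definable.

(** In a wedge-matroid it says that the two lines meet outside the four points, since the wedge is
    otherwise its first argument. *)
Definition meet_formula : formula (2 + 2) :=
  FImp (FEq (TWedge (TVar (lshift 2 ord0)) (TVar (lshift 2 ord_max))
          (TVar (rshift 2 ord0)) (TVar (rshift 2 ord_max)))
        (TVar (lshift 2 ord0))) (FFalse _).

Lemma sat_meet_formula (N : structure) (a b : 'I_2 -> N) :
  sat meet_formula (tuple_cat a b) <->
  wedge (a ord0) (a ord_max) (b ord0) (b ord_max) <> a ord0.
Proof.
have el i : tuple_cat a b (lshift 2 i) = a i.
  by rewrite /tuple_cat -[lshift 2 i]/(unsplit (inl i)) unsplitK.
have er i : tuple_cat a b (rshift 2 i) = b i.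
  by rewrite /tuple_cat -[rshift 2 i]/(unsplit (inr i)) unsplitK.
by rewrite /= !el !er.
Qed.

(** For fixed [n] the subsets of ['I_n] form a finite conjunction, so this is a single sentence, and
    it holds in all models as soon as it holds in [M]. *)
Definition shatters (N : structure) n : Prop := exists w : 'I_(n + n) -> N,
  forall X : {set 'I_n}, exists a : 'I_2 -> N, forall i,
    wedge (a ord0) (a ord_max) (w (lshift n i)) (w (rshift n i)) <> a ord0 <-> i \in X.

Lemma shatters_definable n :
  definable (fun (N : structure) (v : 'I_0 -> N) => shatters N n).
Proof.
pose Q (N : structure) (w : 'I_(n + n) -> N) (X : {set 'I_n}) i (a : 'I_2 -> N) :=
  wedge (a ord0) (a ord_max) (w (lshift n i)) (w (rshift n i)) <> a ord0 <-> i \in X.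
apply: (@definable_exs (n + n) 0 (fun N w _ => forall X, exists a, forall i, Q N w X i a)).
apply: definable_fin => X.
apply: (@definable_exs 2 _ (fun N a u => forall i, Q N (fun i => u (lshift 0 i)) X i a)).
apply: definable_fin => i; rewrite /Q.
pose t (N : structure) (u : 'I_(2 + (n + n + 0)) -> N) :=
  wedge (u (lshift _ ord0)) (u (lshift _ ord_max)) (u (rshift 2 (lshift 0 (lshift n i))))
    (u (rshift 2 (lshift 0 (rshift n i)))) = u (lshift _ ord0).
have dt : definable t.
  exists (FEq (TWedge (TVar (lshift _ ord0)) (TVar (lshift _ ord_max))
    (TVar (rshift 2 (lshift 0 (lshift n i)))) (TVar (rshift 2 (lshift 0 (rshift n i)))))
    (TVar (lshift _ ord0))).
  by [].
case: (i \in X).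
  by apply: definable_ext (definable_not dt) => N v; split=> [h|[_ h]]; [split|exact: h].
apply: definable_ext dt => N v; split=> [h|[h _]]; first by split=> // /(_ h).
by apply: contrapT => /h.
Qed.

(* [inl (l, c)], for [c : bool], are two points spanning the line [l]; the line of
   [X] and the line of [i] meet in [inr (X, i)] if [i \in X]. *)
Definition grid n : Type := (({set 'I_n} + 'I_n) * bool + {set 'I_n} * 'I_n)%type.

Definition grid_on n (l : {set 'I_n} + 'I_n) (t : grid n) : Prop :=
  match t with
  | inl (l', _) => l' = l
  | inr (X, i) => i \in X /\ (l = inl X \/ l = inr i)
  end.

Definition grid_blk n (L : set (grid n)) : Prop := exists l, L = grid_on l.

Lemma grid_blk_uniq n (L L' : set (grid n)) u v : grid_blk L -> grid_blk L' -> u <> v ->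
  L u -> L v -> L' u -> L' v -> L = L'.
Proof.
move=> [l ->] [l' ->] uv.
case: u uv => [[m c]|[X i]] uv /=; first by move=> -> _ -> _.
case: v uv => [[m c]|[Y j]] uv /=; first by move=> _ -> _ ->.
move=> [Xi h1] [Yj h2] [_ h3] [_ h4].
case: h1 => e1; case: h2 => e2; case: h3 => e3; case: h4 => e4; congruence.
Qed.

(** Every point of the grid is on at most two blocks, so a constant rank will do. *)
Lemma grid_omits P n X : omits P (blk_rel (@grid_blk n)) X.
Proof.
apply: (omits_rank (rk := fun _ => 0)) => -[[l c]|[Y i]].
  exists (grid_on l), (grid_on l).
  split=> [q r [_ [_ [[l' ->] /= -> Lq _]]] _ _|M eM q r qr pq pr Mq Mr].
    by left.
  by have {}eM : M = grid_on l by [case: eM]; subst M; split=> //; exists (grid_on l);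
    split=> //; exists l.
have [Yi|nYi] := pselect (i \in Y); last first.
  exists set0, set0; split=> [q r [_ [_ [[l' ->] /= [] //]]]|M [] -> //].
exists (grid_on (inl Y)), (grid_on (inr i)).
split=> [q r [_ [_ [[l' ->] /= [_ h] Lq _]]] _ _|M eM q r qr pq pr Mq Mr].
  by case: h => <-; [left|right].
split=> //; exists M; split=> //; first by case: eM => ->; [exists (inl Y)|exists (inr i)].
by case: eM => ->; split=> //; [left|right].
Qed.

Section Shatter.
Variables (PP : projective_plane -> Prop) (M : structure).
Hypothesis fM : fraisse_limit (K_omits PP) M.

Let wM := limit_wedge fM.

Lemma limit_shatters n : shatters M n.
Proof.
pose R := blk_rel (@grid_blk n).
have mR : matroid R by apply: blk_rel_matroid; exact: grid_blk_uniq.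
have [||f [fI fR fC]] := @limit_universal _ _ fM (grid n) R setT mR.
- exact: finite_finset.
- by move=> P _; exact: grid_omits.
have mf a b c d p : meets R a b c d p <-> meets (@Rel M) (f a) (f b) (f c) (f d) (f p).
  by apply: meets_iff; (try exact: fI); (try exact: fR).
exists (fun o : 'I_(n + n) => match fintype.split o with
  | inl i => f (inl (inr i, true)) | inr i => f (inl (inr i, false)) end).
move=> X; exists (fun j => f (inl (inl X, j == ord0))) => i.
rewrite -[lshift n i]/(unsplit (inl i)) unsplitK -[rshift n i]/(unsplit (inr i)) unsplitK.
set a := inl (inl X, _); set b := inl (inl X, _); set c := inl (inr i, _);
  set d := inl (inr i, _).
have blkR (l : {set 'I_n} + 'I_n) t : inl (l, true) <> t -> inl (l, false) <> t ->
    R (inl (l, true)) (inl (l, false)) t <-> grid_on l t.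
  move=> n1 n2; split=> [[_ [_ [[l' ->] /= <- _ //]]]|h]; split=> //.
  by exists (grid_on l); split=> //; exists l.
have Rab t : R a b t -> grid_on (inl X) t.
  by move=> h; have [_ n1 n2] := matroid_neq mR h; apply/blkR.
have Rcd t : R c d t -> grid_on (inr i) t.
  by move=> h; have [_ n1 n2] := matroid_neq mR h; apply/blkR.
have nl : ~ line R a b c by move=> [[//|//]|/Rab].
split=> [h|Xi].
  case: (wedge_cases wM (f a) (f b) (f c) (f d)) => // hw.
  have [t _ te] : (f @` setT) (wedge (f a) (f b) (f c) (f d)).
    by apply: fC hw; [exists a|exists b|exists c|exists d].
  rewrite -te in hw; have [/Rab h1 /Rcd h2 _] := iffRL (mf _ _ _ _ _) hw.
  case: t {te hw} h1 h2 => [[l e] /= -> //|[Y j] /= [Yj [[eY]|//]] [_ [//|[ej]]]].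
  by rewrite eY ej.
have hm : meets R a b c d (inr (X, i)).
  by split=> //; apply/blkR => //=; split=> //; [left|right].
by rewrite (wedge_meets wM (iffLR (mf _ _ _ _ _) hm)) => /(fI _ _ I I).
Qed.

Lemma limit_independence : independence_property (Th M).
Proof.
exists 2, 2, meet_formula => N mN n; have [phi hphi] := shatters_definable n.
have : true_in N phi by apply: mN => v; apply/hphi; exact: limit_shatters.
move=> /(_ (fun i : 'I_0 => match notF (ltn_ord i) with end)) /hphi[w wP].
exists (fun i j => if j == ord0 then w (lshift n i) else w (rshift n i)) => X.
have [a aP] := wP [set i | `[< X i >]]%SET; exists a => i.
by rewrite sat_meet_formula /= aP inE; split=> /asboolP.
Qed.

End Shatter.

(** * Non-categoricity *)

Fixpoint term_of n (t : GenTree.tree nat) : option (term n) :=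
  match t with
  | GenTree.Leaf k => omap (@TVar n) (insub k)
  | GenTree.Node _ [:: a; b; c; d] =>
      match term_of n a, term_of n b, term_of n c, term_of n d with
      | Some a', Some b', Some c', Some d' => Some (TWedge a' b' c' d')
      | _, _, _, _ => None
      end
  | _ => None
  end.

Fixpoint formula_of n (t : GenTree.tree nat) : option (formula n) :=
  match t with
  | GenTree.Node 0 [:: a; b] =>
      if (term_of n a, term_of n b) is (Some a', Some b') then Some (FEq a' b') else None
  | GenTree.Node 1 [:: a; b; c] =>
      if (term_of n a, term_of n b, term_of n c) is (Some a', Some b', Some c')
      then Some (FRel a' b' c') else None
  | GenTree.Node 2 [:: a; b] =>
      if (formula_of n a, formula_of n b) is (Some a', Some b')
      then Some (FImp a' b') else None
  | GenTree.Node 3 [:: a] => omap (@FAll n) (formula_of n.+1 a)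
  | GenTree.Leaf _ => Some (FFalse n)
  | _ => None
  end.

Lemma term_of_surj n (t : term n) : exists c, term_of n c = Some t.
Proof.
elim: t => [i|a [a' ha] b [b' hb] c [c' hc] d [d' hd]].
  by exists (GenTree.Leaf (val i)); rewrite /= valK.
by exists (GenTree.Node 0 [:: a'; b'; c'; d']); rewrite /= ha hb hc hd.
Qed.

Lemma formula_of_surj n (phi : formula n) : exists c, formula_of n c = Some phi.
Proof.
elim: phi => {n} [n a b|n a b c|n|n a [a' ha] b [b' hb]|n a [a' ha]].
- have [[a' ha] [b' hb]] := conj (term_of_surj a) (term_of_surj b).
  by exists (GenTree.Node 0 [:: a'; b']); rewrite /= ha hb.
- have [[a' ha] [b' hb]] := conj (term_of_surj a) (term_of_surj b).
  have [c' hc] := term_of_surj c.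
  by exists (GenTree.Node 1 [:: a'; b'; c']); rewrite /= ha hb hc.
- by exists (GenTree.Leaf 0).
- by exists (GenTree.Node 2 [:: a'; b']); rewrite /= ha hb.
- by exists (GenTree.Node 3 [:: a']); rewrite /= ha.
Qed.

(* A countable reduced ultrapower: functions [nat -> M] in the closure of a countable
   family [g] under pointwise Skolem functions, modulo an ultrafilter. *)
Section SkolemUltrapower.
Variables (M : structure) (m0 : M) (W : set_system nat).
Hypothesis uW : UltraFilter W.
Variable g : nat -> nat -> M.

Let pW : ProperFilter W := @ultra_proper _ W uW.
#[local] Existing Instance pW.

(** [FAll] is the only quantifier, so the Skolem function selects a counterexample; [m0] is a
    default. *)
Definition skolem n (phi : formula n.+1) (v : 'I_n -> M) : M :=
  if pselect (exists x, ~ sat phi (extend x v)) is left h then projT1 (cid h) else m0.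

Lemma skolemP n (phi : formula n.+1) (v : 'I_n -> M) :
  sat phi (extend (skolem phi v) v) -> forall x, sat phi (extend x v).
Proof.
rewrite /skolem; case: pselect => [h|h _ x]; first by case: (cid h).
by apply: contrapT => nx; apply: h; exists x.
Qed.

Definition hull_code : countType := (nat + nat * GenTree.tree nat * seq nat)%type.

(** The codes [inl j] repeat the previous stage, so finitely many arguments can be brought to a
    common one. *)
Fixpoint hull_stage k (c : nat) : nat -> M :=
  if k is k'.+1 then
    match (unpickle c : option hull_code) with
    | Some (inl j) => hull_stage k' j
    | Some (inr (n, t, s)) =>
        if formula_of n.+1 t is Some phi then
          fun m => skolem phi (fun i : 'I_n => hull_stage k' (nth 0 s i) m)
        else hull_stage k' 0
    | None => hull_stage k' 0
    end
  else g c.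

Lemma hull_stageS k (c : hull_code) : hull_stage k.+1 (pickle c) = match c with
  | inl j => hull_stage k j
  | inr (n, t, s) =>
      if formula_of n.+1 t is Some phi then
        fun m => skolem phi (fun i : 'I_n => hull_stage k (nth 0 s i) m)
      else hull_stage k 0
  end.
Proof. by rewrite /= pickleK; case: c. Qed.

Definition hull (p : nat * nat) : nat -> M := hull_stage p.1 p.2.

Lemma hull_stage_mono k k' j : k <= k' -> exists j', hull_stage k' j' = hull_stage k j.
Proof.
move=> /subnK <-; elim: (k' - k)%N => [|d [j' IH]]; first by exists j.
by exists (pickle (inl j' : hull_code)); rewrite addSn hull_stageS.
Qed.

Lemma hull_skolem n (phi : formula n.+1) (v : 'I_n -> nat * nat) :
  exists p, hull p = fun m => skolem phi (fun i => hull (v i) m).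
Proof.
pose K := \max_(i < n) (v i).1.
have /choice[j hj] : forall i, exists j, hull_stage K j = hull (v i).
  by move=> i; apply: hull_stage_mono; exact: (leq_bigmax i).
have [t ht] := formula_of_surj phi.
pose c : hull_code := inr (n, t, [seq j i | i : 'I_n]).
exists (K.+1, pickle c).
rewrite /hull [(K.+1, pickle c).1]/= [(K.+1, pickle c).2]/= hull_stageS /c ht.
apply/funext => m.
congr (skolem phi); apply/funext => i.
have -> : nth 0 [seq j i | i : 'I_n] i = j i.
  rewrite (nth_map i) ?nth_ord_enum ?size_enum_ord //.
by rewrite hj.
Qed.

Definition heq (p q : nat * nat) : Prop := W [set m | hull p m = hull q m].

Lemma heq_refl p : heq p p.
Proof. by apply: filterS filterT => m. Qed.

Lemma heq_sym p q : heq p q -> heq q p.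
Proof. by apply: filterS => m /= ->. Qed.

Lemma heq_trans p q r : heq p q -> heq q r -> heq p r.
Proof. by move=> h k; apply: filterS (filterI h k) => m /= [-> ->]. Qed.

(** [xget] depends only on the class as a set, hence picks one representative per class; its fixed
    points serve as the quotient. *)
Definition hrep (p : nat * nat) : nat * nat := xget (0, 0) [set q | heq q p].

Lemma hrep_heq p : heq (hrep p) p.
Proof. by apply: (@xgetPex _ _ [set q | heq q p]); exists p; exact: heq_refl. Qed.

Lemma hrep_eq p q : heq p q -> hrep p = hrep q.
Proof.
move=> h; congr xget; apply/seteqP; split=> r /= rp; first exact: heq_trans h.
exact: heq_trans (heq_sym h).
Qed.

Definition hcarrier : Type := {p : nat * nat | hrep p = p}.

Definition hcl (p : nat * nat) : hcarrier := exist _ (hrep p) (hrep_eq (hrep_heq p)).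

Lemma hcarrier_eq (a b : hcarrier) : heq (sval a) (sval b) -> a = b.
Proof.
move=> h; apply: (@sval_inj _ [set p | hrep p = p]).
by have := hrep_eq h; rewrite (svalP a) (svalP b).
Qed.

(** The wedge is itself a Skolem function: the only counterexample to [x] being different from a
    wedge is that wedge. *)
Lemma hull_wedge (a b c d : hcarrier) : exists p : nat * nat, hull p =
  fun m => wedge (hull (sval a) m) (hull (sval b) m) (hull (sval c) m) (hull (sval d) m).
Proof.
pose t (i : 'I_4) : term 5 := TVar (lift ord0 i).
pose o (k : nat) : 'I_4 := inord k.
pose phi : formula 5 := FImp (FEq (TVar ord0) (TWedge (t (o 0)) (t (o 1)) (t (o 2)) (t (o 3))))
  (FFalse 5).
have [p hp] := hull_skolem phi (fun i : 'I_4 => sval (nth a [:: a; b; c; d] i)).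
exists p; rewrite hp; apply/funext => m; set v := (X in skolem phi X).
have [e|ne] := pselect (skolem phi v = wedge (v (o 0)) (v (o 1)) (v (o 2)) (v (o 3))).
  by rewrite e /v /o !inordK.
have /skolemP : sat phi (extend (skolem phi v) v).
  by rewrite /= extend0 !extend_lift => /ne.
move=> /(_ (wedge (v (o 0)) (v (o 1)) (v (o 2)) (v (o 3)))).
by rewrite /= extend0 !extend_lift => /(_ erefl).
Qed.

Definition hstructure : structure := @Structure hcarrier
  (fun a b c => W [set m | Rel (hull (sval a) m) (hull (sval b) m) (hull (sval c) m)])
  (fun a b c d => hcl (projT1 (cid (hull_wedge a b c d)))).

Let val_at n (v : 'I_n -> hstructure) m (i : 'I_n) : M := hull (sval (v i)) m.

Lemma los_term n (v : 'I_n -> hstructure) (t : term n) :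
  W [set m | hull (sval (teval v t)) m = teval (val_at v m) t].
Proof.
elim: t => [i|a ha b hb c hc d hd]; first exact: (heq_refl (sval (v i))).
rewrite /=; case: cid => p hp /=.
apply: filterS (filterI (filterI ha hb) (filterI (filterI hc hd) (hrep_heq p))) => m /=.
move=> [[<- <-] [[<- <-] e]].
by rewrite e hp.
Qed.

(** For [FAll], the sequence of chosen counterexamples lies in the hull; if the body holds even
    there, it holds everywhere. Implication is where the ultrafilter property is used. *)
Lemma los n (phi : formula n) (v : 'I_n -> hstructure) :
  sat phi v <-> W [set m | sat phi (val_at v m)].
Proof.
elim: phi v => {n} [n a b|n a b c|n|n a IHa b IHb|n a IHa] v /=.
- have [ha hb] := conj (los_term v a) (los_term v b); split=> [e|h].
    by rewrite e in ha; apply: filterS (filterI ha hb) => m /= [<- <-].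
  apply: hcarrier_eq; apply: filterS (filterI h (filterI ha hb)) => m /=.
  by move=> [e [-> ->]].
- have [ha hb hc] := And3 (los_term v a) (los_term v b) (los_term v c).
  split=> h'; apply: filterS (filterI h' (filterI ha (filterI hb hc))) => m /=.
    by move=> [e [<- [<- <-]]].
  by move=> [e [-> [-> ->]]].
- split=> // h; have : W set0 by apply: filterS h => m.
  exact: filter_not_empty.
- rewrite IHa IHb; split=> [h|h ha]; last first.
    by apply: filterS (filterI h ha) => m /= [k /k].
  have [ha|na] := in_ultra_setVsetC [set m | sat a (val_at v m)] uW.
    by apply: filterS (h ha) => m /= hb _.
  by apply: filterS na => m /= nA /nA.
have ext x m : val_at (extend x v) m = extend (hull (sval x) m) (val_at v m).
  apply/funext => i; rewrite /val_at.
  by case: (unliftP ord0 i) => [j|] ->; rewrite ?extend_lift ?extend0.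
split=> [h|h x]; last first.
  by apply/IHa; apply: filterS h => m /= h; rewrite ext; exact: h.
have [p hp] := hull_skolem a (fun i => sval (v i)).
have /IHa hx := h (hcl p); apply: filterS (filterI hx (hrep_heq p)) => m /= [].
rewrite ext /= => + e; rewrite e hp; exact: skolemP.
Qed.

Lemma hstructure_model : model (Th M) hstructure.
Proof. by move=> phi h v; apply/los; apply: filterS filterT => m _; exact: h. Qed.

Lemma hstructure_countable : countable [set: hstructure].
Proof.
apply/countable_injP; exists (fun a : hcarrier => pickle (sval a)) => a b _ _.
move=> /(pcan_inj pickleK); exact: (@sval_inj _ [set p | hrep p = p]).
Qed.

End SkolemUltrapower.

(* Points [inl b] and [inr 0], [inr 1], ...; the lines are the two parity classes and
   the triples [inl (odd i)], [inr i], [inr i.+1]. Hence [inr i] is generated by the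
   earlier points for [i >= 4]. *)
Definition ladder : Type := (bool + nat)%type.

Definition rail (b : bool) (t : ladder) : Prop := if t is inr i then odd i = b else False.

Definition rung (i : nat) (t : ladder) : Prop :=
  match t with inl b => b = odd i | inr j => j = i \/ j = i.+1 end.

Definition ladder_blk (L : set ladder) : Prop :=
  (exists b, L = rail b) \/ exists i, L = rung i.

Lemma rail_rung b i (u v : ladder) : u <> v -> rail b u -> rail b v -> rung i u ->
  rung i v -> False.
Proof.
case: u v => [//|j] [//|k] uv /= hj hk ej ek.
have jk : j <> k by move=> e; apply: uv; rewrite e.
by case: ej => ej; case: ek => ek; subst j k; (try by case: jk); move: hj hk => /= <-;
  case: (odd i).
Qed.

Lemma ladder_blk_uniq (L L' : set ladder) u v : ladder_blk L -> ladder_blk L' -> u <> v ->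
  L u -> L v -> L' u -> L' v -> L = L'.
Proof.
move=> [[b ->]|[i ->]] [[b' ->]|[i' ->]] uv Lu Lv L'u L'v.
- by case: u uv Lu L'u {Lv L'v} => //= j _ -> ->.
- by case: (rail_rung uv Lu Lv L'u L'v).
- by case: (rail_rung uv L'u L'v Lu Lv).
congr rung.
have key b k : rung i (inl b) -> rung i' (inl b) -> rung i (inr k) ->
    rung i' (inr k) -> i = i'.
  move=> /= e e' [] ek [] ek'; subst b; first by rewrite -ek -ek'.
  - by move: e'; rewrite -ek ek' /=; case: odd.
  - by move: e'; rewrite -ek' ek /=; case: odd.
  - by move: ek'; rewrite ek => -[].
case: u v uv Lu Lv L'u L'v => [c|j] [d|k] uv Lu Lv L'u L'v.
- by case: uv; rewrite Lu Lv.
- exact: key Lu L'u Lv L'v.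
- exact: key Lv L'v Lu L'u.
have jk : j <> k by move=> e; apply: uv; rewrite e.
by move: Lu Lv L'u L'v => /= [] ej [] ek [] ej' [] ek'; subst; try (by case: jk); lia.
Qed.

Definition ladder_rel := blk_rel ladder_blk.

Lemma ladder_matroid : matroid ladder_rel.
Proof. by apply: blk_rel_matroid; exact: ladder_blk_uniq. Qed.

(** Among points of no larger rank, [inr i] is collinear only along its rail and along the rung
    ending at it; the two hubs alone carry no triple. *)
Lemma ladder_omits P X : omits P ladder_rel X.
Proof.
apply: (omits_rank (rk := fun t => if t is inr i then i.+1 else 0)) => -[b|i].
  exists set0, set0; split=> [q r|M [] -> //].
  case: q r => [c|//] [d|//] [[bc _ _] [L [[[b' ->]|[j ->]] //= e1 e2 _]]].
  by case: bc; rewrite e1 e2.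
exists (rail (odd i)), (if i is j.+1 then rung j else set0); split.
  move=> q r [[pq pr qr] [L [[[b' ->] /= -> Lq _|[j ->] /= hj Lq Lr]]]] hq hr; first by left.
  right; case: hj => ej; subst; last exact: Lq.
  case: q r pq pr qr hq hr Lq Lr => [c|k] [d|l] pq pr qr hq hr /= Lq Lr.
  - by case: qr; rewrite Lq Lr.
  - by case: Lr => e; subst l; [case: pr|rewrite ltnn in hr].
  - by case: Lq => e; subst k; [case: pq|rewrite ltnn in hq].
  - by case: Lq => e; subst k; [case: pq|rewrite ltnn in hq].
move=> M eM q r qr pq pr Mq Mr; split=> //; exists M.
case: eM => eM; subst M; first by split=> //; left; exists (odd i).
case: i pq pr Mq Mr => [|i] pq pr Mq Mr //; split=> //; first by right; exists i.
by right.
Qed.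

Definition ladder_trunc m : set ladder := [set t | if t is inr i then i <= m else True].

Lemma ladder_trunc_finite m : finite_set (ladder_trunc m).
Proof.
pose s : seq ladder := [:: inl true, inl false & [seq inr i | i <- iota 0 m.+1]].
apply: (@sub_finite_set _ _ [set` s]).
  move=> [b|i] h; first by case: b {h}; rewrite /mkset /s !in_cons eqxx ?orbT.
  rewrite /mkset /s 2!in_cons; apply/orP; right; apply/orP; right.
  by apply: map_f; rewrite mem_iota.
exact: finite_seq.
Qed.

(** The rail of [inr k.+1] is spanned by its two lowest points, the rung by its hub and [inr k]. The
    bound on [k] keeps [inr k.+1] distinct from those two points. *)
Lemma ladder_meets k : 3 <= k -> meets ladder_rel (inr (odd k.+1 : nat)) (inr (odd k.+1).+2)
  (inl (odd k)) (inr k) (inr k.+1).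
Proof.
move=> k3; have [o eo] : exists o : bool, o = odd k.+1 by exists (odd k.+1).
rewrite -eo; have o1 : odd (o : nat) = o by case: (o).
have lt : (o : nat).+2 < k.+1 by case: (o); lia.
split.
- split; first by split=> -[] e; lia.
  exists (rail o); split; [by left; exists o|exact: o1| |exact: esym eo].
  by rewrite /rail /= negbK.
- split; first by split=> // -[] e; lia.
  by exists (rung k); split=> //=; [right; exists k|left|right].
move=> [[//|//]|[_ [L [[[b ->] _ _ //|[i ->]] /= h1 h2 _]]]].
by case: h1 h2 => -> [] e; lia.
Qed.

(** Variables 0 and 1 stand for the hubs, variables 2 to 5 for [inr 0] to [inr 3]. *)
Definition rail_var (i : nat) : term 6 := TVar (inord i.+2).
Definition hub_var (b : bool) : term 6 := TVar (inord b).

Fixpoint rail_term (i : nat) : term 6 :=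
  if i is k.+1 then
    if k < 3 then rail_var k.+1
    else TWedge (rail_var (odd k.+1)) (rail_var (odd k.+1).+2) (hub_var (odd k)) (rail_term k)
  else rail_var 0.

Definition ladder_gen (j : nat) : ladder := if j < 2 then inl (j == 1) else inr (j - 2).

Section NotCategorical.
Variables (PP : projective_plane -> Prop) (M : structure).
Hypothesis fM : fraisse_limit (K_omits PP) M.

Let wM := limit_wedge fM.

Lemma limit_ladder m : exists f : ladder -> M,
  (forall i j, i <= m -> j <= m -> f (inr i) = f (inr j) -> i = j) /\
  forall i, i <= m -> 3 <= m ->
    teval (fun i : 'I_6 => f (ladder_gen i)) (rail_term i) = f (inr i).
Proof.
have [||f [fI fR fC]] := @limit_universal _ _ fM ladder ladder_rel (ladder_trunc m) ladder_matroid.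
- exact: ladder_trunc_finite.
- by move=> P _; exact: ladder_omits.
exists f; split=> [i j im jm /fI e|i im m3].
  by have [] : (inr i : ladder) = inr j by apply: e.
have rv k : k < 4 -> teval (fun i : 'I_6 => f (ladder_gen i)) (rail_var k) = f (inr k).
  by move=> k4; rewrite /= inordK // /ladder_gen /= subn2.
have hv b : teval (fun i : 'I_6 => f (ladder_gen i)) (hub_var b) = f (inl b).
  by rewrite /= inordK; case: b.
elim: i im => [|k IH] km; first exact: rv.
rewrite [rail_term _]/=; case: ifP => [k3|/negbT]; first exact: rv.
rewrite -leqNgt => k3.
have -> : teval (fun i : 'I_6 => f (ladder_gen i)) (TWedge (rail_var (odd k.+1))
    (rail_var (odd k.+1).+2) (hub_var (odd k)) (rail_term k)) =
    wedge (f (inr (odd k.+1 : nat))) (f (inr (odd k.+1).+2)) (f (inl (odd k))) (f (inr k)).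
  rewrite -hv -IH; last exact: ltnW.
  by rewrite -rv; [rewrite -(rv (odd k.+1).+2) //; case: odd|case: odd].
apply: (wedge_meets wM).
have b1 : (odd k.+1).+2 <= m by apply: leq_trans m3; case: odd.
apply: (iffLR (@meets_iff _ _ ladder_rel (@Rel M) f _ _ _ _ _ _ _ _ _ _)) (ladder_meets k3).
- by apply: fI => //=; lia.
- by apply: fI => //=; lia.
- by apply: fR => //=; lia.
- by apply: fR => //=; lia.
- by apply: fR => //=; lia.
Qed.

Lemma embedding_teval (A B : structure) (f : A -> B) n (v : 'I_n -> A) (t : term n) :
  embedding f -> f (teval v t) = teval (f \o v) t.
Proof.
by move=> [_ _ fW]; elim: t => //= a ha b hb c hc d hd; rewrite fW ha hb hc hd.
Qed.

Lemma teval_gen (A : structure) n (v : 'I_n -> A) (t : term n) : gen (range v) (teval v t).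
Proof.
elim: t => [i|a ha b hb c hc d hd] /=; first by apply: sub_gen; exists i.
exact: gen_substructure.
Qed.

Lemma limit_not_categorical : ~ aleph0_categorical (Th M).
Proof.
move=> cat; have [m0 _] := limit_nonempty fM.
have /choice[f fP] := limit_ladder.
have [W [uW oW]] := ultraFilterLemma (@eventually_filter).
(* The shift by 3 keeps all six generators inside the truncated ladder. *)
pose g j m := f (m + 3) (ladder_gen j).
pose N := hstructure m0 uW g.
pose v (i : 'I_6) : N := hcl m0 uW g (0, val i).
have vI i j : teval v (rail_term i) = teval v (rail_term j) -> i = j.
  move=> /(los (FEq (rail_term i) (rail_term j)) v) /= h.
  (* If two rail terms had the same value, they would agree at some [m] beyond both indices, where
     the ladder keeps them apart. *)
  have gv : W [set m | forall o : 'I_6, hull m0 g (sval (v o)) m = g o m].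
    apply: (@filter_forall nat _ (fun (o : 'I_6) m => hull m0 g (sval (v o)) m = g o m)) => o.
    exact: (hrep_heq _ uW _ (0, val o)).
  have big : W [set m | maxn i j <= m] by apply: oW; exact: nbhs_infty_ge.
  have [m [/= e [gm ij]]] := filter_ex (filterI h (filterI gv big)).
  have ev : (fun o => hull m0 g (sval (v o)) m) = (fun o : 'I_6 => f (m + 3) (ladder_gen o)).
    by apply/funext => o; exact: gm.
  have [fI fT] := fP (m + 3).
  have [im jm] : i <= m + 3 /\ j <= m + 3.
    by split; apply: leq_trans (leq_addr _ _); apply: leq_trans ij; rewrite ?leq_maxl ?leq_maxr.
  move: e; rewrite ev !fT ?leq_addl //; exact: fI.
have infinite_of (A : structure) (h : nat -> A) : injective h -> infinite_set [set: A].
  move=> hI fin; apply: infinite_nat.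
  apply: sub_finite_set (@finite_preimage _ _ setT h _ fin) => //.
  by move=> x y _ _ /hI.
have cN : ([set: N] #= [set: nat])%card.
  apply: eq_card_nat; first exact: hstructure_countable.
  by apply: (infinite_of N (fun i => teval v (rail_term i))) => i j /vI.
have mN : model (Th M) N by exact: hstructure_model.
have cM : ([set: M] #= [set: nat])%card.
  apply: eq_card_nat; first by case: fM.
  (* The base points of the glued copy show that [M] is infinite. *)
  have [theta [tI _ _]] := ptX_iso fM m0.
  have XB k : ptX m0 (Base k) by exists 0; exists k.
  by apply: (infinite_of M (fun k => theta (Base k))) => i j h;
    have [e] := tI _ _ (XB i) (XB j) h.
have [h [_ eh]] := cat N M cN cM mN (fun phi H => H).
(* An isomorphism would carry the infinitely many rail terms into a set generated by six points of
   [M]. *)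
have fin : finite_set (gen (range (h \o v))).
  by apply: (limit_gen_finite fM); exact: finite_image.
have [hI _ _] := eh.
apply: infinite_nat.
apply: sub_finite_set (@finite_preimage _ _ (gen (range (h \o v)))
  (fun i => h (teval v (rail_term i))) _ fin) => [i _ /=|i j _ _ /hI/vI //].
by rewrite embedding_teval //; exact: teval_gen.
Qed.

End NotCategorical.

Lemma K_all_omits N : K_all N <-> K_omits (fun _ => False) N.
Proof. by split=> [h|[]]; [split|]. Qed.

Lemma K_omit_omits P N : K_omit P N <-> K_omits (fun Q => Q = P) N.
Proof.
split=> [[h /omits_planeE o]|[h o]]; first by split=> // Q ->.
by split=> //; apply/omits_planeE; exact: o.
Qed.

Lemma fraisse_limit_ext K K' M : (forall N, K N <-> K' N) ->
  fraisse_limit K M -> fraisse_limit K' M.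
Proof. by move=> KK' [cM hM aM]; split=> // N; rewrite aM. Qed.

Theorem theorem1p8 (M : structure)
    (hM : fraisse_limit K_all M \/
          exists P : projective_plane, fraisse_limit (K_omit P) M) :
  [/\ ~ aleph0_categorical (Th M),
      independence_property (Th M),
      exists ind, @stationary_independence M ind,
      group_embeds (sym nat) (aut M) &
      EPPA (age M) -> ample_generics (aut M) /\ small_index_property (aut M)].
Proof.
have [PP fM] : exists PP, fraisse_limit (K_omits PP) M.
  case: hM => [h|[P h]]; first by exists (fun _ => False); exact: fraisse_limit_ext K_all_omits h.
  by exists (fun Q => Q = P); exact: fraisse_limit_ext (K_omit_omits P) h.
have [m0 _] := limit_nonempty fM; split.
- exact: limit_not_categorical fM.
- exact: limit_independence fM.
- by exists (@indep M); exact: indep_stationary fM.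
- exact: limit_sym_embeds fM m0.
by move=> eppa; split; [exact: limit_ample fM eppa|exact: limit_small_index fM eppa].
Qed.
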